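(* Let $(\mathbf{X}_t)_{t\ge0}$ be a one-dimensional super-Brownian motion with quadratic branching mechanism $\psi(u)=2u^2$, and let $(\mathbf{L}^a)_{a\in\mathbb{R}}$ be its (total) local times. Suppose that $\mathbf{X}_0=\alpha\,\delta_0$ for some $\alpha>0$. Then, for every $a\in\mathbb{R}$ and $\lambda>0$, $$\mathbb{E}[e^{-\lambda\mathbf{L}^a}]=\exp\left(-\alpha\,\frac{3^{1/3}}{2}\Big(\lambda^{-1/3}+3^{-1/3}\,|a|\Big)^{-2}\right).$$ In particular, $$\mathbb{E}[e^{-\lambda\mathbf{L}^0}]=\exp\left(-\alpha\,\frac{3^{1/3}}{2}\,\lambda^{2/3}\right),$$ so that $\mathbf{L}^0$ is a positive stable variable with index $2/3$.
   Context: One-dimensional super-Brownian motion with branching mechanism $\psi(u)=2u^2$ is the continuous Markov process $(\mathbf{X}_t)_{t\ge0}$ with values in the finite measures on $\mathbb{R}$ such that, for every bounded nonnegative measurable $f$ on $\mathbb{R}$, $\mathbb{E}[\exp(-\langle\mathbf{X}_t,f\rangle)\mid \mathbf{X}_0]=\exp(-\langle\mathbf{X}_0,u_t\rangle)$, where $(u_t(x))_{t\ge0,x\in\mathbb{R}}$ is the unique nonnegative solution of $u_t(x)+\mathbb{E}_x\big[\int_0^t\psi(u_{t-s}(B_s))\,\mathrm{d}s\big]=\mathbb{E}_x[f(B_t)]$, with $B$ a standard linear Brownian motion started at $x$ under $\mathbb{P}_x$. Here $\delta_0$ is the Dirac measure at $0$. The (total) local times are the unique (random) continuous function $(\mathbf{L}^a)_{a\in\mathbb{R}}$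 such that $\int_0^\infty\mathrm{d}t\,\langle\mathbf{X}_t,f\rangle=\int_{\mathbb{R}}\mathrm{d}a\,f(a)\,\mathbf{L}^a$ for every Borel function $f:\mathbb{R}\to\mathbb{R}_+$ (their existence is known). *)

(* Defs.v *)
From HB Require Import structures.
From mathcomp Require Export all_boot all_order all_algebra.
From mathcomp Require Export all_classical all_reals all_analysis.
(* all_analysis does not export the measurable structure on \bar R. *)
From mathcomp Require Export measurable_realfun.
Export Order.TTheory GRing.Theory Num.Theory.
Export numFieldNormedType.Exports.

Set Implicit Arguments.
Unset Strict Implicit.
Unset Printing Implicit Defensive.

Local Open Scope classical_set_scope.
Local Open Scope ring_scope.

(* sigma(Z_i, i in D). *)
Definition generated_sigma_algebra (I T : Type) (d' : measure_display)
    (V : measurableType d') (D : set I) (Z : I -> T -> V) : set (set T) :=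
  <<s [set A | exists i C, [/\ D i, measurable C & A = Z i @^-1` C]] >>.

(* Z is a version of the conditional expectation E[Y | G]. *)
Record is_conditional_expectation (R : realType) (d : measure_display)
    (T : measurableType d) (P : probability T R) (G : set (set T))
    (Y Z : T -> R) : Prop := {
  condexp_integrable_arg : P.-integrable setT (EFin \o Y);
  condexp_integrable : P.-integrable setT (EFin \o Z);
  condexp_measurable : forall C : set R, measurable C -> G (Z @^-1` C);
  condexp_integral : forall A, G A ->
    (\int[P]_(w in A) (Y w)%:E = \int[P]_(w in A) (Z w)%:E)%E
}.

(* Only the values B t with t >= 0 are relevant. *)
Record is_brownian_motion (R : realType) (d : measure_display)
    (T : measurableType d) (P : probability T R) (x : R) (B : R -> T -> R)
    : Prop := {
  bm_measurable : forall t : R, 0 <= t -> measurable_fun setT (B t);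
  bm_start : {ae P, forall w, B 0 w = x};
  bm_continuous : forall w, {within `[0, +oo[, continuous (B ^~ w)};
  (* B_t - B_s is independent of sigma(B_r, r <= s), with law N(0, t - s);
     the second argument of normal_prob is the standard deviation *)
  bm_increments : forall s t : R, 0 <= s -> s < t ->
    forall A (C : set R),
      generated_sigma_algebra `[0, s] B A -> measurable C ->
      (P (A `&` [set w | C (B t w - B s w)%R]) =
       P A * normal_prob 0%R (Num.sqrt (t - s)%R) C)%E
}.

Section super_brownian_motion.
Context {R : realType}.

Definition psi (u : R) : R := 2 * u ^+ 2.

(* A Brownian motion B, started at x under PB x. *)
Context (dW : measure_display) (W : measurableType dW)
  (PB : R -> probability W R) (B : R -> W -> R).

Record solves_log_laplace_equation (f : R -> R) (u : R -> R -> R) : Prop := {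
  lle_measurable :
    measurable_fun [set p : R * R | 0 <= p.1] (fun p => u p.1 p.2);
  lle_ge0 : forall t x : R, 0 <= t -> 0 <= u t x;
  lle_equation : forall t x : R, 0 <= t ->
    ((u t x)%:E
       + \int[PB x]_w \int[lebesgue_measure]_(s in `[0%R, t])
           (psi (u (t - s)%R (B s w)))%:E
     = \int[PB x]_w (f (B t w))%:E)%E
}.

Definition is_unique_log_laplace_solution (f : R -> R) (u : R -> R -> R) :=
  solves_log_laplace_equation f u /\
  forall v, solves_log_laplace_equation f v ->
    forall t x : R, 0 <= t -> v t x = u t x.

Context (d : measure_display) (T : measurableType d) (P : probability T R).

(* The state space of finite measures carries the sigma-algebra generated by the
   evaluations mu |-> mu E, E Borel; this is sigma(X_r, 0 <= r <= s). *)
Definition past_sigma_algebra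
    (X : R -> T -> {finite_measure set R -> \bar R}) (s : R) : set (set T) :=
  generated_sigma_algebra
    [set p : R * set R | 0 <= p.1 <= s /\ measurable p.2]
    (fun p w => X p.1 w p.2).

(* Only the values X t with t >= 0 are relevant.  The last field is the Markov
   property together with the formula for the transition kernels,
   E_mu[exp(-<X_t, f>)] = exp(-<mu, u_t>). *)
Record is_super_brownian_motion
    (X : R -> T -> {finite_measure set R -> \bar R}) : Prop := {
  sbm_measurable : forall (t : R) (E : set R), 0 <= t -> measurable E ->
    measurable_fun setT (fun w => X t w E);
  sbm_weakly_continuous : {ae P, forall w, forall g : R -> R,
    continuous g -> (exists M : R, forall x, `|g x| <= M) ->
    {within `[0, +oo[, continuous (fun t : R => \int[X t w]_x g x)}};
  sbm_markov : forall f : R -> R,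
    measurable_fun setT f -> (forall x, 0 <= f x) ->
    (exists M : R, forall x, f x <= M) ->
    exists2 u, is_unique_log_laplace_solution f u &
      forall s t : R, 0 <= s -> 0 <= t ->
        is_conditional_expectation P (past_sigma_algebra X s)
          (fun w => expR (- \int[X (s + t) w]_x f x))
          (fun w => expR (- \int[X s w]_x u t x))
}.

Record is_local_time (X : R -> T -> {finite_measure set R -> \bar R})
    (L : R -> T -> R) : Prop := {
  lt_measurable : forall a, measurable_fun setT (L a);
  lt_continuous : {ae P, forall w, continuous (L ^~ w)};
  lt_occupation : {ae P, forall w, forall f : R -> R,
    measurable_fun setT f -> (forall x, 0 <= f x) ->
    (\int[lebesgue_measure]_(t in `[0%R, +oo[) \int[X t w]_x (f x)%:E
     = \int[lebesgue_measure]_a (f a * L a w)%R%:E)%E}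
}.

(* Y is a.s. positive and strictly stable with index b: for independent copies
   Y1, Y2 of Y, realised on the product space, and p, q > 0,
   p^(1/b) Y1 + q^(1/b) Y2 has the law of (p + q)^(1/b) Y. *)
Record is_positive_stable (b : R) (Y : T -> R) : Prop := {
  ps_index : 0 < b < 1;
  ps_measurable : measurable_fun setT Y;
  ps_positive : {ae P, forall w, 0 < Y w};
  ps_stable : forall (p q : R) (C : set R), 0 < p -> 0 < q -> measurable C ->
    ((P \x P) [set w | C (p `^ b^-1 * Y w.1 + q `^ b^-1 * Y w.2)%R]
     = P [set w | C ((p + q) `^ b^-1 * Y w)%R])%E
}.

End super_brownian_motion.

(* Main.v *)
Require Import Defs.
From mathcomp Require Import ring lra zify.

(** Formally, [E exp(- int_0^oo <X_t, g> dt) = exp(- <X_0, v>)] whenever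
    [v >= 0] is bounded and solves [v''/2 = 2 v^2 - g], and the choice
    [g = lambda * delta_a] gives the theorem: away from [a] the function
    [v(x) = 3/2 * (|x - a| + c)^-2] satisfies [v''/2 = 2 v^2], and its derivative
    jumps by [- 6 c^-3] at [a], so that [lambda = 3 c^-3].  The exponent
    [alpha * v 0] is then [alpha * 3/2 * (|a| + c)^-2] with [c = (3 / lambda)^(1/3)].

    To make this rigorous the kink of [|x - a|] is smoothed within distance [e] of [a]
    (section [smoothed_abs]).  The resulting [profile] has a cubic Taylor bound that
    is uniform on the line, and its [source] [g := 2 v^2 - v''/2] is nonnegative,
    continuous and supported in the ball of radius [e] around [a]; as [e] tends to
    [0] it tends to [lambda * delta_a] ([cvg_source_mass]).

    For fixed [e], the formal identity is proved without martingales.  The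
    semigroup [u] of the log-Laplace equation with [u_0 = v] satisfies
    [u_h = v - h g + O(h^(3/2))] uniformly in space ([log_laplace_expansion]).  By the
    Markov property, the numbers
    [A_k := E exp(- sum_(j < k) h <X_(jh), g> - <X_(kh), v>)] therefore satisfy
    [|A_(k+1) - A_k| = O(h^(3/2))] ([discretisation_step]), so [A_n] differs from
    [A_0 = exp(- alpha v 0)] by [O(sqrt h)] when [n h] is bounded.  Letting [h] tend to
    [0] turns the Riemann sums into an integral, because the paths of [X] are weakly
    continuous and [g] is continuous ([occupation_until]); letting the time horizon
    tend to infinity removes the term [<X_t, v>], because the total mass of [X_t]
    vanishes in the limit ([extinction], an explicit Riccati computation).  This gives
    [total_occupation].  The occupation density formula rewrites the occupation
    [int_0^oo <X_t, g> dt] as [int g(x) L^x dx], which tends to [lambda * L^a] as [e]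
    tends to [0], by continuity of the local times.

    Stability of [L^0] follows from the form [exp(- kappa lambda^(2/3))] of its Laplace
    transform alone ([is_positive_stable_of_laplace]): two almost surely nonnegative
    variables with the same Laplace transform have the same law
    ([eq_law_of_laplace]), because the transform of [Y >= 0] gives the moments of
    [exp(- Y)], and these determine the law of a variable with values between [0] and [1], by
    approximation with Bernstein polynomials. *)

Set Implicit Arguments.
Unset Strict Implicit.
Unset Printing Implicit Defensive.

Local Open Scope classical_set_scope.
Local Open Scope ring_scope.

(** * Bounded integrands and uniform grids *)

Section bounded_functions.
Context d (T : measurableType d) (R : realType).
Implicit Types (mu : {finite_measure set T -> \bar R}) (f g h : T -> R).

Lemma integrable_bounded mu f (M : R) : measurable_fun setT f ->
  (forall x, `|f x| <= M) -> mu.-integrable setT (EFin \o f).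
Proof.
move=> mf fM; apply: measurable_bounded_integrable => //.
  exact: fin_num_fun_lty (@fin_num_measure _ _ _ mu).
exists M; split; first exact: num_real.
by move=> y My x _; exact: le_trans (fM x) (ltW My).
Qed.

Lemma Rintegral_EFin mu f (M : R) : measurable_fun setT f ->
  (forall x, `|f x| <= M) ->
  (\int[mu]_x (f x)%:E)%E = (\int[mu]_x f x)%:E.
Proof.
move=> mf fM; rewrite fineK//.
by apply: integrable_fin_num => //; exact: integrable_bounded mf fM.
Qed.

Lemma Rintegral_dist_le mu f g h (M : R) :
  measurable_fun setT f -> measurable_fun setT g -> measurable_fun setT h ->
  (forall x, `|f x| <= M) -> (forall x, `|g x| <= M) ->
  (forall x, `|h x| <= M) ->
  (forall x, `|f x - g x| <= h x) ->
  `|\int[mu]_x f x - \int[mu]_x g x| <= \int[mu]_x h x.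
Proof.
move=> mf mg mh fM gM hM fgh.
have fgM x : `|f x - g x| <= M by exact: le_trans (fgh x) (le_trans (ler_norm _) (hM x)).
have mfg : measurable_fun setT (fun x => f x - g x) by exact: measurable_funB.
rewrite -RintegralB//; try exact: integrable_bounded.
apply: le_trans (le_normr_Rintegral _ _) _ => //.
  exact: integrable_bounded fgM.
apply: le_Rintegral => //.
- apply: (@integrable_bounded _ _ M); first exact: measurableT_comp.
  by move=> x; rewrite normr_id.
- exact: integrable_bounded hM.
Qed.

Lemma bounded_cvg_Rintegral mu (f_ : nat -> T -> R) f (M : R) :
  (forall n, measurable_fun setT (f_ n)) -> measurable_fun setT f ->
  (forall n x, `|f_ n x| <= M) ->
  {ae mu, forall x, f_ n x @[n --> \oo] --> f x} ->
  \int[mu]_x f_ n x @[n --> \oo] --> \int[mu]_x f x.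
Proof.
move=> mf_ mf fM cf.
have [] := @dominated_convergence _ _ _ mu setT measurableT
  (fun n => EFin \o f_ n) (EFin \o f) (EFin \o cst M).
- by move=> n; exact/measurable_EFinP.
- exact/measurable_EFinP.
- apply: filterS cf => x cx _; apply: cvg_EFin; first exact: nearW.
  exact: cx.
- by apply: finite_measure_integrable_cst.
- by apply: aeW => x n _ /=; rewrite lee_fin.
- move=> fi _ h; rewrite /Rintegral; apply: fine_cvg.
  by rewrite fineK//; apply: integrable_fin_num.
Qed.

Lemma le_Rintegral_cst mu f (M : R) : measurable_fun setT f ->
  (forall x, `|f x| <= M) ->
  \int[mu]_x f x <= M * fine (mu setT).
Proof.
move=> mf fM; rewrite -Rintegral_cst//; apply: le_Rintegral => //.
- exact: integrable_bounded fM.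
- exact: finite_measure_integrable_cst.
- by move=> x _; exact: le_trans (ler_norm _) (fM x).
Qed.

End bounded_functions.

Section grid.
Context {R : realType}.

(** The largest point of the uniform grid of mesh [1 / (n + 1)] at or below [s]. *)
Definition grid (n : nat) (s : R) : R :=
  (Num.truncn (n.+1%:R * s))%:R / n.+1%:R.

Lemma grid_ge0 n s : 0 <= grid n s.
Proof. by rewrite /grid divr_ge0. Qed.

Lemma grid_bounds n s : 0 <= s -> grid n s <= s < grid n s + n.+1%:R^-1.
Proof.
move=> s0; have n0 : 0 < n.+1%:R :> R by rewrite ltr0n.
have /andP[h1 h2] := truncn_itv (mulr_ge0 (ltW n0) s0).
rewrite /grid ler_pdivrMr// [s * _]mulrC h1/= -[X in _ + X]mul1r -mulrDl.
by rewrite natr1 ltr_pdivlMr// [s * _]mulrC.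
Qed.

Lemma cvg_grid s : 0 <= s -> grid n s @[n --> \oo] --> s.
Proof.
move=> s0; apply: (@squeeze_cvgr _ _ _ _ (fun n => s - n.+1%:R^-1) (cst s)).
- apply: nearW => n; have /andP[h1 h2] := grid_bounds n s0.
  by rewrite h1 andbT lerBlDr ltW.
- rewrite -[X in _ --> X]subr0; apply: cvgB; first exact: cvg_cst.
  exact: cvg_harmonic.
- exact: cvg_cst.
Qed.

End grid.

(** * Bernstein polynomials *)

Section bernstein.
Context {R : realType}.
Implicit Types (g : nat -> R) (y : R) (n : nat).

(** The expectation of [g] at a binomial variable with parameters [n] and [y]: the
    recursion conditions on the outcome of one Bernoulli trial. In this form positivity
    and the binomial variance come by induction, without any sum over binomial
    coefficients. *)
Fixpoint bernstein n g y : R :=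
  if n is n'.+1 then y * bernstein n' (g \o succn) y + (1 - y) * bernstein n' g y
  else g 0%N.

Lemma measurable_bernstein n g : measurable_fun setT (bernstein n g).
Proof.
elim: n g => [|n IH] g /=; first exact: measurable_cst.
apply: measurable_funD; apply: measurable_funM => //.
by apply: measurable_funB.
Qed.

Lemma le_bernstein n g1 g2 y : 0 <= y <= 1 -> (forall k, g1 k <= g2 k) ->
  bernstein n g1 y <= bernstein n g2 y.
Proof.
move=> y01; elim: n g1 g2 => [|n IH] g1 g2 g12 /=; first exact: g12.
apply: lerD; apply: ler_wpM2l; try lra; last exact: IH.
by apply: IH => k /=.
Qed.

Lemma bernstein_affine n g a b y :
  bernstein n (fun k => a * g k + b) y = a * bernstein n g y + b.
Proof.
elim: n g => [|n IH] g //=.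
rewrite (_ : (fun k => a * g k + b) \o succn = fun k => a * (g \o succn) k + b)//.
by rewrite !IH; ring.
Qed.

(** Binomial variance plus squared bias, the only moment computation on which the
    approximation rests. *)
Lemma bernstein_sqr n c y :
  bernstein n (fun k => (k%:R - c) ^+ 2) y =
  n%:R * y * (1 - y) + (n%:R * y - c) ^+ 2.
Proof.
elim: n c => [|n IH] c /=; first by ring.
rewrite (_ : _ \o succn = fun k => (k%:R - (c - 1)) ^+ 2); last first.
  by apply/funext => k /=; rewrite -natr1; congr (_ ^+ 2); ring.
by rewrite !IH -natr1; ring.
Qed.

(** With [n = N^2] trials the empirical mean deviates from [y] by about [1 / N]. The
    bound [|z| <= (N * z^2 + 1 / N) / 2] turns this variance estimate into a bound for
    Lipschitz functions by positivity of the operator alone. *)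
Lemma bernstein_approx (f : R -> R) (K : R) (N : nat) y :
  (forall a b, `|f a - f b| <= K * `|a - b|) -> 0 <= y <= 1 -> (0 < N)%N ->
  `|bernstein (N ^ 2) (fun k => f (k%:R / (N ^ 2)%:R)) y - f y| <= K / N%:R.
Proof.
move=> fK y01 N0.
have N0' : 0 < N%:R :> R by rewrite ltr0n.
have K0 : 0 <= K by have := le_trans (normr_ge0 _) (fK 1 0); rewrite subr0 normr1 mulr1.
have E : (N ^ 2)%:R = N%:R ^+ 2 :> R by rewrite natrX.
set g := fun k : nat => f _.
pose q k : R := (k%:R - (N ^ 2)%:R * y) ^+ 2.
(* the coefficients of the bound [|z| <= (N * z^2 + 1 / N) / 2], in terms of [q] *)
pose a := K / (2 * N%:R ^+ 3); pose b := K / (2 * N%:R).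
have gq k : `|g k - f y| <= a * q k + b.
  apply: le_trans (fK _ _) _; rewrite /a /b /q E.
  set z := k%:R / _ - y.
  have -> : k%:R - N%:R ^+ 2 * y = N%:R ^+ 2 * z.
    by rewrite /z; field; rewrite gt_eqF.
  have -> : K / (2 * N%:R ^+ 3) * (N%:R ^+ 2 * z) ^+ 2 + K / (2 * N%:R) =
            K * ((N%:R * z ^+ 2 + N%:R^-1) / 2) by field; rewrite gt_eqF.
  apply: ler_wpM2l => //.
  have h : 0 <= (N%:R * `|z| - 1) ^+ 2 / N%:R by rewrite divr_ge0 ?sqr_ge0// ltW.
  have {}h : 0 <= N%:R * z ^+ 2 - 2 * `|z| + N%:R^-1.
    by move: h; rewrite sqrrB1 exprMn real_normK ?num_real//; congr (_ <= _); field; rewrite gt_eqF.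
  by lra.
have up : bernstein (N ^ 2) g y <= f y + K / N%:R.
  apply: (@le_trans _ _ (bernstein (N ^ 2) (fun k => a * q k + (b + f y)) y)).
    by apply: le_bernstein => // k; have := gq k; rewrite ler_norml; lra.
  rewrite bernstein_affine bernstein_sqr subrr expr0n /= addr0 /a /b E.
  have -> : K / (2 * N%:R ^+ 3) * (N%:R ^+ 2 * y * (1 - y)) =
     K / (2 * N%:R) * (y * (1 - y)) by field; rewrite gt_eqF.
  have -> : K / N%:R = K / (2 * N%:R) + K / (2 * N%:R) by field; rewrite gt_eqF.
  have : 0 <= K / (2 * N%:R) by rewrite divr_ge0// mulr_ge0// ltW.
  by nra.
have dn : f y - K / N%:R <= bernstein (N ^ 2) g y.
  apply: (@le_trans _ _ (bernstein (N ^ 2) (fun k => (- a) * q k + (f y - b)) y)); last first.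
    by apply: le_bernstein => // k; have := gq k; rewrite ler_norml; lra.
  rewrite bernstein_affine bernstein_sqr subrr expr0n /= addr0 /a /b E.
  have -> : - (K / (2 * N%:R ^+ 3)) * (N%:R ^+ 2 * y * (1 - y)) =
     - (K / (2 * N%:R) * (y * (1 - y))) by field; rewrite gt_eqF.
  have -> : K / N%:R = K / (2 * N%:R) + K / (2 * N%:R) by field; rewrite gt_eqF.
  have : 0 <= K / (2 * N%:R) by rewrite divr_ge0// mulr_ge0// ltW.
  by nra.
by rewrite ler_norml; lra.
Qed.

End bernstein.

(** * Laws on the half-line and their Laplace transforms *)

Lemma clamp_dist_le (R : realType) (p q : R) :
  `|Num.max 0 (Num.min 1 p) - Num.max 0 (Num.min 1 q)| <= `|p - q|.
Proof.
rewrite /Num.max /Num.min ler_norml.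
have [p1|p1] := ltP 1 p; have [q1|q1] := ltP 1 q; rewrite ?ltr01;
  (try have [p0|p0] := ltP 0 p); (try have [q0|q0] := ltP 0 q);
  case: (ger0P (p - q)) => ?; apply/andP; split; lra.
Qed.

Section moments.
Context {R : realType} d1 d2 (T1 : measurableType d1) (T2 : measurableType d2).
Variables (P1 : probability T1 R) (P2 : probability T2 R).
Variables (U1 : T1 -> R) (U2 : T2 -> R).
Hypotheses (mU1 : measurable_fun setT U1) (mU2 : measurable_fun setT U2).
Hypotheses (U1_01 : forall w, 0 <= U1 w <= 1) (U2_01 : forall w, 0 <= U2 w <= 1).
Hypothesis moments_eq : forall n : nat,
  \int[P1]_w (U1 w ^+ n) = \int[P2]_w (U2 w ^+ n).

Let same (f : R -> R) := \int[P1]_w f (U1 w) = \int[P2]_w f (U2 w).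

Let bounded01 (f : R -> R) := exists M : R, forall y : R, 0 <= y <= 1 -> `|f y| <= M.

Let integrable_comp1 f : measurable_fun setT f -> bounded01 f ->
  P1.-integrable setT (EFin \o (fun w => f (U1 w))).
Proof.
move=> mf [M fM]; apply: (@integrable_bounded _ _ _ _ _ M).
  exact: measurableT_comp.
by move=> w; exact: fM.
Qed.

Let integrable_comp2 f : measurable_fun setT f -> bounded01 f ->
  P2.-integrable setT (EFin \o (fun w => f (U2 w))).
Proof.
move=> mf [M fM]; apply: (@integrable_bounded _ _ _ _ _ M).
  exact: measurableT_comp.
by move=> w; exact: fM.
Qed.

Let sameD f g : measurable_fun setT f -> bounded01 f ->
  measurable_fun setT g -> bounded01 g -> same f -> same g ->
  same (fun y => f y + g y).
Proof.
move=> mf bf mg bg sf sg; rewrite /same RintegralD//; try exact: integrable_comp1.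
by rewrite RintegralD//; [congr (_ + _)|exact: integrable_comp2|exact: integrable_comp2].
Qed.

Let sameB f g : measurable_fun setT f -> bounded01 f ->
  measurable_fun setT g -> bounded01 g -> same f -> same g ->
  same (fun y => f y - g y).
Proof.
move=> mf bf mg bg sf sg; rewrite /same RintegralB//; try exact: integrable_comp1.
by rewrite RintegralB//; [congr (_ - _)|exact: integrable_comp2|exact: integrable_comp2].
Qed.

Let monomial k m y : R := y ^+ k * (1 - y) ^+ m.

Let measurable_monomial k m : measurable_fun setT (monomial k m).
Proof.
by apply: measurable_funM; apply: measurable_funX => //; apply: measurable_funB.
Qed.

Let monomial_01 k m y : 0 <= y <= 1 -> 0 <= monomial k m y <= 1.
Proof.
move=> /andP[y0 y1]; have z0 : 0 <= 1 - y by rewrite subr_ge0.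
have z1 : 1 - y <= 1 by rewrite gerBl.
rewrite /monomial mulr_ge0 ?exprn_ge0//=.
by rewrite mulr_ile1 ?exprn_ge0 ?exprn_ile1.
Qed.

Let bounded_monomial k m : bounded01 (monomial k m).
Proof.
exists 1 => y y01; have /andP[a b] := monomial_01 k m y01.
by rewrite ger0_norm.
Qed.

Let same_monomial k m : same (monomial k m).
Proof.
elim: m k => [|m IH] k.
  rewrite /same /monomial.
  by under eq_Rintegral do rewrite expr0 mulr1;
     under [RHS]eq_Rintegral do rewrite expr0 mulr1.
have -> : monomial k m.+1 = fun y => monomial k m y - monomial k.+1 m y.
  by apply/funext => y; rewrite /monomial !exprS; ring.
exact: sameB.
Qed.

Let same_bernstein n g k m : (exists M : R, forall j, `|g j| <= M) ->
  same (fun y => monomial k m y * bernstein n g y).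
Proof.
elim: n g k m => [|n IH] g k m [M gM] /=.
  rewrite /same RintegralZr//; last exact: (@integrable_comp1 (monomial k m)).
  rewrite RintegralZr//; last exact: (@integrable_comp2 (monomial k m)).
  by congr (_ * _); exact: same_monomial.
have B h k' m' n' : (forall j, `|h j| <= M) ->
    bounded01 (fun y => monomial k' m' y * bernstein n' h y).
  move=> hM; exists (1 * M) => y y01; rewrite normrM ler_pM//.
    by have /andP[? ?] := monomial_01 k' m' y01; rewrite ger0_norm.
  have h' (a b : R) : bernstein n' (fun=> a) b = a.
    by elim: n' => //= n' IH'; rewrite IH'; ring.
  rewrite ler_norml; apply/andP; split.
    rewrite -[leLHS](h' (- M) y); apply: le_bernstein => // j.
    by have := hM j; rewrite ler_norml => /andP[].
  rewrite -[leRHS](h' M y); apply: le_bernstein => // j.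
  by have := hM j; rewrite ler_norml => /andP[].
have -> : (fun y => monomial k m y *
      (y * bernstein n (g \o succn) y + (1 - y) * bernstein n g y)) =
    fun y => monomial k.+1 m y * bernstein n (g \o succn) y +
             monomial k m.+1 y * bernstein n g y.
  by apply/funext => y; rewrite /monomial !exprS; ring.
apply: sameD.
- by apply: measurable_funM => //; exact: measurable_bernstein.
- by apply: B => j; exact: gM.
- by apply: measurable_funM => //; exact: measurable_bernstein.
- by apply: B.
- by apply: IH; exists M => j; exact: gM.
- by apply: IH; exists M.
Qed.

(** Equal moments give equal expectations of all products [y^k * (1 - y)^m], hence of
    all Bernstein polynomials, which approximate [f] uniformly on the unit interval. *)
Lemma same_moments_lipschitz (f : R -> R) (K M : R) : measurable_fun setT f ->
  (forall a b, `|f a - f b| <= K * `|a - b|) -> (forall a, `|f a| <= M) ->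
  \int[P1]_w f (U1 w) = \int[P2]_w f (U2 w).
Proof.
move=> mf fK fM.
have K0 : 0 <= K by have := le_trans (normr_ge0 _) (fK 1 0); rewrite subr0 normr1 mulr1.
apply/eqP; rewrite -subr_eq0 -normr_le0; apply/ler_addgt0Pl => e e0; rewrite addr0.
have [N N0 KN] : exists2 N : nat, (0 < N)%N & 2 * (K / N%:R) <= e.
  exists (Num.truncn (2 * K / e)).+1 => //.
  rewrite mulrA ler_pdivrMr ?ltr0n// [leRHS]mulrC -ler_pdivrMr//.
  by apply/ltW; rewrite -truncn_lt_nat// divr_ge0 ?mulr_ge0// ltW.
pose g k := f (k%:R / (N ^ 2)%:R).
pose b := bernstein (N ^ 2) g.
have mb : measurable_fun setT b by exact: measurable_bernstein.
have hb y : 0 <= y <= 1 -> `|b y - f y| <= K / N%:R.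
  by move=> y01; exact: bernstein_approx.
have KN0 : 0 <= K / N%:R by rewrite divr_ge0.
have bM y : 0 <= y <= 1 -> `|b y| <= M + K / N%:R.
  by move=> y01; have := hb _ y01; have := fM y; rewrite !ler_norml; lra.
have sb : \int[P1]_w b (U1 w) = \int[P2]_w b (U2 w).
  have := @same_bernstein (N ^ 2) g 0 0 (ex_intro _ M (fun=> fM _)).
  rewrite /same /monomial.
  by under eq_Rintegral do rewrite !expr0 mulr1 mul1r;
     under [RHS]eq_Rintegral do rewrite !expr0 mulr1 mul1r.
pose M' := M + K / N%:R.
have fM' y : `|f y| <= M' by rewrite (le_trans (fM y))// lerDl.
have M0 : 0 <= M by exact: le_trans (normr_ge0 _) (fM 0).
have cM : `|K / N%:R| <= M' by rewrite ger0_norm// lerDr.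
have h1 : `|\int[P1]_w b (U1 w) - \int[P1]_w f (U1 w)| <= K / N%:R.
  apply: le_trans (@Rintegral_dist_le _ _ _ P1 _ _ (cst (K / N%:R)) M' _ _ _ _ _ _ _) _ => //=.
  - exact: measurableT_comp.
  - exact: measurableT_comp.
  - by move=> w; exact: bM.
  - by move=> w; exact: hb.
  - by rewrite Rintegral_cst//= probability_setT mulr1.
have h2 : `|\int[P2]_w b (U2 w) - \int[P2]_w f (U2 w)| <= K / N%:R.
  apply: le_trans (@Rintegral_dist_le _ _ _ P2 _ _ (cst (K / N%:R)) M' _ _ _ _ _ _ _) _ => //=.
  - exact: measurableT_comp.
  - exact: measurableT_comp.
  - by move=> w; exact: bM.
  - by move=> w; exact: hb.
  - by rewrite Rintegral_cst//= probability_setT mulr1.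
apply: le_trans _ KN; move: h1 h2; rewrite sb !ler_norml => /andP[? ?] /andP[? ?]; apply/andP; split; lra.
Qed.

(** The indicator of [{y <= t}] is the limit of piecewise affine functions which
    decrease from [1] at [t] to [0] at [t + 1/n]. *)
Lemma same_moments_le (t : R) : P1 [set w | U1 w <= t] = P2 [set w | U2 w <= t].
Proof.
pose f (n : nat) z : R := Num.max 0 (Num.min 1 (1 - n%:R * (z - t))).
have mf n : measurable_fun setT (f n).
  apply: measurable_maxr => //; apply: measurable_minr => //.
  apply: measurable_funB => //; apply: measurable_funM => //.
  exact: measurable_funB.
have f01 n (z : R) : `|f n z| <= 1.
  rewrite /f ger0_norm ?le_max ?lexx//.
  by rewrite ge_max ler01 ge_min lexx.
have fK n (a b : R) : `|f n a - f n b| <= n%:R * `|a - b|.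
  have -> : n%:R * `|a - b| = `|(1 - n%:R * (b - t)) - (1 - n%:R * (a - t))|.
    by rewrite -{1}(@ger0_norm _ (n%:R : R))// -normrM; congr `|_|; ring.
  by rewrite distrC; exact: clamp_dist_le.
have cf (z : R) : f n z @[n --> \oo] --> (\1_[set x : R | x <= t] z : R).
  rewrite indicE; have [zt|zt] := leP z t.
    rewrite mem_set//=; apply: cvg_near_cst; apply: nearW => n; rewrite /f.
    have : 0 <= n%:R * (t - z) by rewrite mulr_ge0// subr_ge0.
    move=> h; rewrite min_l; last lra.
    by rewrite max_r.
  rewrite memNset /=; last by rewrite leNgt zt.
  apply: cvg_near_cst; near=> n; rewrite /f.
  have : (z - t)^-1 <= n%:R by near: n; exact: nbhs_infty_ger.
  rewrite -[_^-1]div1r ler_pdivrMr ?subr_gt0// => h.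
  by rewrite max_l// ge_min; apply/orP; right; lra.
have L d (T : measurableType d) (P : probability T R) (U : T -> R) :
   measurable_fun setT U ->
   \int[P]_w f n (U w) @[n --> \oo] --> fine (P [set w | U w <= t]).
  move=> mU; have mS : measurable [set w | U w <= t].
    rewrite -[X in measurable X]setTI.
    exact: measurable_fun_le.
  have -> : fine (P [set w | U w <= t]) = \int[P]_w (\1_[set w | U w <= t] w).
    by rewrite /Rintegral integral_indic// setIT.
  apply: (@bounded_cvg_Rintegral _ _ _ P _ _ 1) => //.
  - by move=> n; exact: measurableT_comp.
  - by apply: aeW => w; exact: cf.
have e : (fun n => \int[P1]_w f n (U1 w)) = (fun n => \int[P2]_w f n (U2 w)).
  by apply/funext => n; apply: same_moments_lipschitz (mf n) (fK n) (f01 n).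
have l1 := L _ _ P1 _ mU1; have l2 := L _ _ P2 _ mU2; rewrite -e in l2.
have h : fine (P1 [set w | U1 w <= t]) = fine (P2 [set w | U2 w <= t]).
  exact: (cvg_unique _ l1 l2).
have mS d (T : measurableType d) (U : T -> R) : measurable_fun setT U ->
    measurable [set w | U w <= t].
  move=> mU; rewrite -[X in measurable X]setTI.
  exact: measurable_fun_le.
by rewrite -[LHS]fineK ?h ?fineK//; apply: fin_num_measure; exact: mS.
Unshelve. all: by end_near. Qed.

End moments.

Section laplace.
Context {R : realType} d1 d2 (T1 : measurableType d1) (T2 : measurableType d2).
Variables (P1 : probability T1 R) (P2 : probability T2 R).

Lemma eq_law_of_ccdf (Y1 : T1 -> R) (Y2 : T2 -> R) :
  measurable_fun setT Y1 -> measurable_fun setT Y2 ->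
  (forall r, P1 [set w | r <= Y1 w] = P2 [set w | r <= Y2 w]) ->
  forall C : set R, measurable C -> P1 (Y1 @^-1` C) = P2 (Y2 @^-1` C).
Proof.
move=> mY1 mY2 h C mC.
pose Y1' : {mfun T1 >-> R} := mfun_Sub (mem_set mY1 : Y1 \in mfun).
pose Y2' : {mfun T2 >-> R} := mfun_Sub (mem_set mY2 : Y2 \in mfun).
pose n1 : {measure set R -> \bar R} := distribution P1 Y1'.
pose n2 : {measure set R -> \bar R} := distribution P2 Y2'.
have E := @RGenCInfty.measurableE R.
(* the half-lines [r, +oo[ form a pi-system that generates the Borel sets *)
apply: (@g_sigma_algebra_measure_unique _ R _ (@RGenCInfty.G R) _
  (fun n => [set` `[(- n%:R)%R, +oo[]) _ _ n1 n2) => //.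
- by move=> A [r ->]; exact: measurable_itv.
- by move=> n; exists (- n%:R).
- apply/seteqP; split => // x _; exists (Num.truncn `|x|).+1 => //=.
  rewrite in_itv/= andbT lerNl (le_trans (ler_norm _))// normrN.
  by apply/ltW; rewrite -truncn_lt_nat.
- move=> _ _ [a ->] [b ->]; exists (Num.max a b).
  by apply/seteqP; split => x /=; rewrite !in_itv/= !andbT ge_max => /andP.
- move=> _ [r ->]; rewrite /n1 /n2 /distribution /pushforward /=.
  by have := h r; congr (_ = _); congr (_ _); apply/seteqP; split => x /=;
     rewrite in_itv/= andbT.
- by move=> k; rewrite -ge0_fin_numE//; exact: fin_num_measure.
- by have := E; rewrite /measurable /= => <-.
Qed.

(** The variable [exp(- max(0, Y))] takes values in the unit interval; its moment of
    order [n] is the Laplace transform of [Y] at [n], and [Y >= r] reads [exp(- Y) <=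
    exp(- r)] for [r > 0]. *)
Lemma eq_law_of_laplace (Y1 : T1 -> R) (Y2 : T2 -> R) :
  measurable_fun setT Y1 -> measurable_fun setT Y2 ->
  {ae P1, forall w, 0 <= Y1 w} -> {ae P2, forall w, 0 <= Y2 w} ->
  (forall s : R, 0 < s ->
     \int[P1]_w expR (- (s * Y1 w)) = \int[P2]_w expR (- (s * Y2 w))) ->
  forall C : set R, measurable C -> P1 (Y1 @^-1` C) = P2 (Y2 @^-1` C).
Proof.
move=> mY1 mY2 Y1ge0 Y2ge0 lap; apply: eq_law_of_ccdf => // r.
pose U d (T : measurableType d) (Y : T -> R) w := expR (- Num.max 0 (Y w)).
have mU d (T : measurableType d) (Y : T -> R) : measurable_fun setT Y ->
    measurable_fun setT (U _ _ Y).
  move=> mY; apply: measurableT_comp => //; apply: measurableT_comp => //.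
  exact: measurable_maxr.
have U01 d (T : measurableType d) (Y : T -> R) w : 0 <= U _ _ Y w <= 1.
  by rewrite expR_ge0 -expR0 ler_expR oppr_le0 le_max lexx.
have UE d (T : measurableType d) (P : probability T R) (Y : T -> R) n :
    measurable_fun setT Y -> {ae P, forall w, 0 <= Y w} ->
    \int[P]_w (U _ _ Y w ^+ n.+1) = \int[P]_w expR (- (n.+1%:R * Y w)).
  move=> mY Y0; congr fine; apply: ae_eq_integral => //.
  - apply/measurable_EFinP; apply: measurable_funX; exact: mU.
  - apply/measurable_EFinP; apply: measurableT_comp => //.
    by apply: measurableT_comp => //; exact: measurable_funM.
  - apply: filterS Y0 => w Yw _; rewrite /U max_r// -expRM_natl; congr (expR _)%:E.
    by rewrite mulrN.
have ccdfE d (T : measurableType d) (P : probability T R) (Y : T -> R) :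
    measurable_fun setT Y -> {ae P, forall w, 0 <= Y w} ->
    P [set w | r <= Y w] =
      if r <= 0 then 1%E else P [set w | U _ _ Y w <= expR (- r)].
  move=> mY Y0; case: ifPn => [r0|]; last first.
    rewrite -ltNge => r0; congr (P _); apply/seteqP; split => w /=;
      rewrite /U ler_expR lerN2 le_max; first by move=> ->; rewrite orbT.
    by rewrite leNgt r0.
  have mS : measurable [set w | r <= Y w].
    by rewrite -[X in measurable X]setTI; exact: measurable_fun_le.
  have N0 : P (~` [set w | r <= Y w]) = 0%E.
    apply: measure_negligible; first exact: measurableC.
    by apply: filterS Y0 => w /=; exact: le_trans.
  by rewrite -[X in P X]setCK probability_setC ?N0 ?sube0//; exact: measurableC.
rewrite !ccdfE//; case: ifPn => // r0.
apply: same_moments_le; [exact: mU|exact: mU|exact: U01|exact: U01|].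
case=> [|n]; last by rewrite !UE//; exact: lap.
by under eq_Rintegral do rewrite expr0; under [RHS]eq_Rintegral do rewrite expr0;
   rewrite !Rintegral_cst//= !probability_setT.
Qed.

End laplace.

(** * Positive stable variables *)

Section stable.
Context {R : realType} d (T : measurableType d) (P : probability T R).
Variables (b k : R) (Y : T -> R).
Hypothesis b01 : 0 < b < 1.
Hypothesis k0 : 0 < k.
Hypothesis mY : measurable_fun setT Y.
Hypothesis Y0 : {ae P, forall w, 0 <= Y w}.
Hypothesis laplaceY : forall s : R, 0 < s ->
  (\int[P]_w (expR (- (s * Y w)))%:E = (expR (- (k * s `^ b)))%:E)%E.

Let mexp s : measurable_fun setT (fun w => (expR (- (s * Y w)))%:E).
Proof.
apply/measurable_EFinP; apply: measurableT_comp => //; apply: measurableT_comp => //.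
exact: measurable_funM.
Qed.

Let powRK (x : R) : 0 <= x -> (x `^ b^-1) `^ b = x.
Proof.
have /andP[b0 _] := b01.
by move=> x0; rewrite -powRrM mulVf ?gt_eqF// powRr1.
Qed.

Let pow_gt0 (x : R) : 0 < x -> 0 < x `^ b^-1.
Proof. exact: powR_gt0. Qed.

(** By Markov's inequality, [P (Y <= 0) <= E exp(- s Y) = exp(- k s^b)] for all [s], and
    the right-hand side tends to [0]. *)
Lemma stable_gt0 : {ae P, forall w, 0 < Y w}.
Proof.
have mN : measurable (Y @^-1` `]-oo, 0%R]) by rewrite -[X in measurable X]setTI; exact: mY.
exists (Y @^-1` `]-oo, 0%R]); split => //; last first.
  by move=> w /= /negP; rewrite in_itv/= -leNgt.
have pP : P (Y @^-1` `]-oo, 0%R]) = (fine (P (Y @^-1` `]-oo, 0%R])))%:E.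
  by rewrite fineK// fin_num_measure.
rewrite pP; congr EFin; set p := fine _ in pP *.
have p0 : 0 <= p by rewrite /p fine_ge0.
have bound (t : R) : 0 < t -> p <= expR (- t).
  (* the value of [s] at which the transform equals [exp(- t)] *)
  move=> t0; pose s := (t / k) `^ b^-1.
  have s0 : 0 < s by apply: pow_gt0; exact: divr_gt0.
  have <- : k * s `^ b = t by rewrite powRK ?divr_ge0 ?ltW// mulrC divfK// gt_eqF.
  rewrite -lee_fin -laplaceY// -pP -(setIT (_ @^-1` _)) -integral_indic//.
  apply: ge0_le_integral => //.
    by apply/measurable_EFinP; exact: measurable_indic.
  move=> w _; rewrite lee_fin indicE.
  case: (boolP (w \in _)) => [/set_mem/=|_]; last exact: expR_ge0.
  rewrite in_itv/= => Yw; rewrite -expR0 ler_expR oppr_ge0.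
  exact: mulr_ge0_le0 (ltW s0) Yw.
apply/eqP; rewrite eq_le p0 andbT leNgt; apply/negP => p_gt0.
(* at [t = 1 / p] the bound would give [p <= exp(- 1 / p) < p] *)
have := bound p^-1; rewrite invr_gt0 => /(_ p_gt0); apply/negP; rewrite -ltNge.
rewrite expRN -[ltRHS]invrK ltf_pV2 ?posrE ?expR_gt0 ?invr_gt0//.
by apply: lt_le_trans (expR_ge1Dx _); rewrite ltrDr.
Qed.

Lemma laplace_independent_sum (s t : R) : 0 < s -> 0 < t ->
  (\int[P \x P]_w (expR (- (s * Y w.1 + t * Y w.2)))%:E =
   (expR (- (k * (s `^ b + t `^ b))))%:E)%E.
Proof.
move=> s0 t0; rewrite fubini_tonelli1; first last.
- by move=> w; rewrite lee_fin expR_ge0.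
- apply/measurable_EFinP; apply: measurableT_comp => //; apply: measurableT_comp => //.
  apply: measurable_funD; apply: measurable_funM => //.
    exact: (measurableT_comp mY measurable_fst).
  exact: (measurableT_comp mY measurable_snd).
rewrite mulrDr opprD expRD EFinM -(laplaceY s0) -(laplaceY t0).
transitivity (\int[P]_x ((expR (- (s * Y x)))%:E * \int[P]_w (expR (- (t * Y w)))%:E))%E.
  apply: eq_integral => x _; rewrite /fubini_F/=.
  under eq_integral do rewrite opprD expRD EFinM.
  by rewrite ge0_integralZl_EFin ?expR_ge0// => w _; rewrite lee_fin expR_ge0.
rewrite laplaceY//; under eq_integral do rewrite muleC.
by rewrite ge0_integralZl_EFin ?expR_ge0// muleC.
Qed.

(** The Laplace transforms of [p^(1/b) Y1 + q^(1/b) Y2] and [(p + q)^(1/b) Y] at [s] are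
    both [exp(- k s^b (p + q))]. *)
Lemma is_positive_stable_of_laplace : is_positive_stable P b Y.
Proof.
split => //; first exact: stable_gt0.
move=> p q C p0 q0 mC.
set s1 := p `^ b^-1; set s2 := q `^ b^-1; set s3 := (p + q) `^ b^-1.
have s1_gt0 : 0 < s1 by exact: pow_gt0.
have s2_gt0 : 0 < s2 by exact: pow_gt0.
have s3_gt0 : 0 < s3 by apply: pow_gt0; exact: addr_gt0.
pose PP := (P \x P)%E : probability _ R.
pose Z1 (w : T * T) := s1 * Y w.1 + s2 * Y w.2.
pose Z2 w := s3 * Y w.
(* the set where [Y < 0], whose cylinders are null for the product *)
have mN : measurable (Y @^-1` `]-oo, 0%R[) by rewrite -[X in measurable X]setTI; exact: mY.
have N0 : P (Y @^-1` `]-oo, 0%R[) = 0%E.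
  apply/negligibleP => //; move: Y0 => [A [mA A0 sA]].
  exists A; split => // w /=; rewrite in_itv/= => Yw; apply: sA => /=.
  by apply/negP; rewrite -ltNge.
have Z1ge0 : {ae PP, forall w, 0 <= Z1 w}.
  apply: (@negligibleS _ _ _ _ (((Y @^-1` `]-oo, 0%R[) `*` setT) `|` (setT `*` (Y @^-1` `]-oo, 0%R[)))).
    move=> w /= /negP; rewrite -ltNge /Z1 => Zw.
    have [Y1|Y1] := ltP (Y w.1) 0; first by left; split => //=; rewrite in_itv.
    right; split => //=; rewrite in_itv/= ltNge; apply/negP => Y2.
    by move: Zw; apply/negP; rewrite -leNgt addr_ge0// mulr_ge0// ltW.
  apply: negligibleU; apply/negligibleP; try exact: measurableX.
    by apply: etrans (product_measure1E P P mN measurableT) _; rewrite [X in (X * _)%E]N0 mul0e.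
  by apply: etrans (product_measure1E P P measurableT mN) _; rewrite [X in (_ * X)%E]N0 mule0.
apply: (@eq_law_of_laplace _ _ _ _ _ PP P Z1 Z2) => //.
- apply: measurable_funD; apply: measurable_funM => //.
    exact: (measurableT_comp mY measurable_fst).
  exact: (measurableT_comp mY measurable_snd).
- exact: measurable_funM.
- by apply: filterS Y0 => w Yw; rewrite mulr_ge0// ltW.
move=> s s0; congr fine.
under eq_integral do rewrite /Z1 mulrDr !mulrA.
under [RHS]eq_integral do rewrite /Z2 mulrA.
rewrite [LHS]laplace_independent_sum ?mulr_gt0// laplaceY ?mulr_gt0//.
rewrite !powRM ?(ltW s0, ltW s1_gt0, ltW s2_gt0, ltW s3_gt0)//.
by rewrite !powRK ?mulrDr ?addr_ge0 ?(ltW p0) ?(ltW q0)//.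
Qed.

End stable.

(** * Moments of the centred normal law *)

Section integral_line.
Context {R : realType}.
Notation leb := (@lebesgue_measure R).

Lemma integral_line_cvg (f : R -> R) :
  leb.-integrable setT (EFin \o f) ->
  (\int[leb]_(x in `[(- n.+1%:R)%R, n.+1%:R%R]) (f x)%:E)%E @[n --> \oo] -->
  (\int[leb]_x (f x)%:E)%E.
Proof.
move=> intf.
have [] := @dominated_convergence _ _ _ leb setT measurableT
  (fun n => (EFin \o f) \_ `[- n.+1%:R, n.+1%:R]) (EFin \o f) (abse \o (EFin \o f)).
- move=> n; apply/(measurable_restrictT _ _).1 => //.
  exact: measurable_funTS (measurable_int leb intf).
- exact: (measurable_int leb intf).
- apply: aeW => x _; apply: cvg_near_cst; near=> n.
  rewrite patchE mem_set//= in_itv/=; apply/andP.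
  have : `|x| <= n.+1%:R.
    rewrite (@le_trans _ _ n%:R) ?ler_nat//; near: n; exact: nbhs_infty_ger.
  by rewrite ler_norml => /andP.
- exact: integrable_abse.
- apply: aeW => x n _; rewrite patchE; case: ifP => // _.
  by rewrite abse0; exact: abse_ge0.
- move=> _ _; apply: cvg_trans; apply: near_eq_cvg; apply: nearW => n /=.
  by rewrite [RHS]integral_mkcond.
Unshelve. all: by end_near. Qed.

(** Moments of the normal law follow from this one, with [F] a polynomial times the
    density. *)
Lemma integral_line_derive (F f : R -> R) :
  (forall x : R, is_derive x 1 F (f x)) -> continuous f ->
  leb.-integrable setT (EFin \o f) ->
  (F n.+1%:R - F (- n.+1%:R)) @[n --> \oo] --> 0 ->
  (\int[leb]_x (f x)%:E)%E = 0%E.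
Proof.
move=> dF cf intf F0.
have cF : continuous F.
  by move=> x; apply: differentiable_continuous; apply/derivable1_diffP; exact: (@ex_derive _ _ _ _ _ _ _ (dF x)).
have h := integral_line_cvg intf.
have E : (fun n : nat => (\int[leb]_(x in `[(- n.+1%:R)%R, n.+1%:R%R]) (f x)%:E)%E) =
         EFin \o (fun n : nat => F n.+1%:R - F (- n.+1%:R)).
  apply/funext => n /=; rewrite EFinB; apply: continuous_FTC2.
  - by rewrite gtrN.
  - exact: continuous_subspaceT.
  - split.
    + by move=> x _; exact: (@ex_derive _ _ _ _ _ _ _ (dF x)).
    + by apply: cvg_at_right_filter; exact: cF.
    + by apply: cvg_at_left_filter; exact: cF.
  - by move=> x _; rewrite derive1E; exact: (@derive_val _ _ _ _ _ _ _ (dF x)).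
rewrite E in h.
apply: (cvg_unique _ h) => //; apply: cvg_EFin; first exact: nearW.
exact: F0.
Qed.

End integral_line.

Section normal_moments.
Context {R : realType}.
Notation leb := (@lebesgue_measure R).
Variable s : R.
Hypothesis s0 : 0 < s.

Let s_neq0 : s != 0. Proof. by rewrite gt_eqF. Qed.
Notation p := (normal_pdf 0 s).
Notation N := (normal_prob 0 s).

Lemma ge0_integral_normal_prob (f : R -> \bar R) : (forall x, 0 <= f x)%E ->
  measurable_fun setT f ->
  (\int[N]_x f x = \int[leb]_x (f x * (p x)%:E))%E.
Proof.
move=> f0 mf.
have dom := @normal_prob_dominates R 0 s.
rewrite -(Radon_Nikodym_SigmaFinite.change_of_variables dom)//.
have mRN := measurable_int _ (Radon_Nikodym_SigmaFinite.f_integrable dom).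
apply: ae_eq_integral => //.
- exact: emeasurable_funM.
- apply: emeasurable_funM => //; apply/measurable_EFinP; exact: measurable_normal_pdf.
- apply: ae_eqe_mul2l; apply: integral_ae_eq => //.
  + exact: Radon_Nikodym_SigmaFinite.f_integrable.
  + apply/measurable_EFinP; exact: measurable_normal_pdf.
  + by move=> E _ mE; rewrite -Radon_Nikodym_SigmaFinite.f_integral.
Qed.

(** Domination by a wider Gaussian: the quotient of the two densities is [2 * exp(- z)]
    with [z = 3 x^2 / (8 s^2)], and [z^2 * exp(- z)] is bounded. It yields integrability
    of all powers up to the fourth from the total mass alone. *)
Lemma normal_pdf_pow4_le x : x ^+ 4 * p x <= 64 * s ^+ 4 * normal_pdf 0 (2 * s) x.
Proof.
have s20 : 2 * s != 0 by rewrite mulf_neq0.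
rewrite !normal_pdfE//.
have -> : normal_peak s = 2 * normal_peak (2 * s).
  rewrite /normal_peak (_ : (2 * s) ^+ 2 * pi *+ 2 = 2 ^+ 2 * (s ^+ 2 * pi *+ 2)); last first.
    by rewrite exprMn -!mulrnAr !mulrA.
  by rewrite sqrtrM ?sqr_ge0// sqrtr_sqr ger0_norm// invfM mulrA divff// mul1r.
have -> : normal_fun 0 s x = expR (- (3 * x ^+ 2 / (8 * s ^+ 2))) * normal_fun 0 (2 * s) x.
  rewrite /normal_fun -expRD; congr expR; rewrite subr0; field; rewrite s_neq0//.
set z := 3 * x ^+ 2 / (8 * s ^+ 2).
have z0 : 0 <= z by rewrite /z divr_ge0// mulr_ge0// sqr_ge0.
have ez : z ^+ 2 * expR (- z) <= 4.
  have h : 1 + z / 2 <= expR (z / 2) by exact: expR_ge1Dx.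
  (* [z^2 <= 4 * (1 + z / 2)^2 <= 4 * exp z] *)
  have E : expR (z / 2) * expR (z / 2) * expR (- z) = 1.
    by rewrite -!expRD -[RHS]expR0; congr expR; field.
  have e0 := expR_gt0 (- z).
  rewrite -[leRHS]mulr1 -E mulrA ler_pM2r//.
  by nra.
have -> : x ^+ 4 = 64 / 9 * s ^+ 4 * z ^+ 2 by rewrite /z; field.
have P0 : 0 <= normal_peak (2 * s) * normal_fun 0 (2 * s) x.
  by rewrite mulr_ge0 ?normal_peak_ge0 ?normal_fun_ge0.
set P := normal_peak (2 * s) in P0 *; set Q := normal_fun 0 (2 * s) x in P0 *.
have -> : 64 / 9 * s ^+ 4 * z ^+ 2 * (2 * P * (expR (- z) * Q)) =
  128 / 9 * s ^+ 4 * (P * Q) * (z ^+ 2 * expR (- z)) by ring.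
have S0 : 0 <= s ^+ 4 * (P * Q) by rewrite mulr_ge0// exprn_ge0// ltW.
have := ler_wpM2l S0 ez; lra.
Qed.

Lemma normal_pow4_le : (\int[N]_x (x ^+ 4)%:E <= (64 * s ^+ 4)%:E)%E.
Proof.
rewrite ge0_integral_normal_prob; last 2 first.
- by move=> x; rewrite lee_fin exprn_even_ge0.
- by apply/measurable_EFinP; exact: measurable_funX.
apply: (@le_trans _ _ (\int[leb]_x ((64 * s ^+ 4)%:E * (normal_pdf 0 (2 * s) x)%:E))%E).
  apply: ge0_le_integral => //.
  - by move=> x _; rewrite -EFinM lee_fin mulr_ge0 ?normal_pdf_ge0// exprn_even_ge0.
  - apply/measurable_EFinP; apply: measurable_funM; first exact: measurable_funX.
    exact: measurable_normal_pdf.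
  - apply/measurable_EFinP; apply: measurable_funM => //.
    exact: measurable_normal_pdf.
  - by move=> x _; rewrite -!EFinM lee_fin normal_pdf_pow4_le.
rewrite integralZl//; last exact: integrable_normal_pdf.
by rewrite integral_normal_pdf mule1.
Qed.

Lemma normal_integrable_pow k : (k <= 4)%N ->
  N.-integrable setT (fun x : R => (x ^+ k)%:E).
Proof.
move=> k4; apply: (@le_integrable _ _ _ N setT measurableT _ (fun x : R => (1 + x ^+ 4)%:E)).
- by apply/measurable_EFinP; exact: measurable_funX.
- move=> x _; rewrite lee_fin normrX.
  have h4 : 0 <= `|x| ^+ 4 by exact: exprn_ge0.
  have -> : `|1 + x ^+ 4| = 1 + `|x| ^+ 4.
    by rewrite ger0_norm ?addr_ge0 ?exprn_even_ge0// -normrX ger0_norm ?exprn_even_ge0.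
  have [x1|/ltW x1] := leP `|x| 1.
    by rewrite (le_trans (exprn_ile1 _ (normr_ge0 x) x1))// lerDl.
  by rewrite (le_trans (ler_weXn2l x1 k4))// lerDr.
- apply: (@integrableD _ _ _ N setT measurableT (EFin \o cst 1) (fun x : R => (x ^+ 4)%:E)) => //.
  + exact: finite_measure_integrable_cst.
  + apply/integrableP; split.
      by apply/measurable_EFinP; exact: measurable_funX.
    apply: le_lt_trans (ltry (64 * s ^+ 4)); apply: le_trans _ normal_pow4_le.
    rewrite le_eqVlt; apply/orP; left; apply/eqP; apply: eq_integral => x _.
    by rewrite abse_EFin ger0_norm// exprn_even_ge0.
Qed.

Lemma integrable_pow_normal_pdf k : (k <= 4)%N ->
  leb.-integrable setT (EFin \o (fun x : R => x ^+ k * p x)).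
Proof.
move=> k4; apply/integrableP; split.
  apply/measurable_EFinP; apply: measurable_funM; first exact: measurable_funX.
  exact: measurable_normal_pdf.
have /integrableP[_] := normal_integrable_pow k4.
rewrite ge0_integral_normal_prob//; last first.
  by apply: measurableT_comp => //; apply/measurable_EFinP; exact: measurable_funX.
apply: le_lt_trans; rewrite le_eqVlt; apply/orP; left; apply/eqP.
apply: eq_integral => x _ /=.
by rewrite normrM (ger0_norm (normal_pdf_ge0 _ _ _)) EFinM.
Qed.

Lemma integral_normal_prob (f : R -> R) :
  N.-integrable setT (EFin \o f) ->
  (\int[N]_x (f x)%:E = \int[leb]_x (f x * p x)%:E)%E.
Proof.
move=> intf; have /measurable_EFinP mf := measurable_int _ intf.
have P (g : R -> R) : (forall x : R, 0 <= g x) -> measurable_fun setT g ->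
    (\int[N]_x (g x)%:E = \int[leb]_x (g x * p x)%:E)%E.
  by move=> g0 mg; rewrite ge0_integral_normal_prob//; exact/measurable_EFinP.
pose a (x : R) := `|f x|.
have ma : measurable_fun setT a by exact: measurableT_comp.
have fa0 (x : R) : 0 <= f x + a x by have := ler_norm (- f x); rewrite normrN /a; lra.
have inta : N.-integrable setT (EFin \o a) by exact: integrable_norm intf.
have intfa : N.-integrable setT (EFin \o (fun x => f x + a x)).
  exact: (@integrableD _ _ _ N setT measurableT (EFin \o f) (EFin \o a)).
have L (g : R -> R) : (forall x : R, 0 <= g x) -> N.-integrable setT (EFin \o g) ->
    leb.-integrable setT (EFin \o (fun x => g x * p x)).
  move=> g0 intg; have /measurable_EFinP mg := measurable_int _ intg.
  apply/integrableP; split.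
    apply/measurable_EFinP; apply: measurable_funM => //.
    exact: measurable_normal_pdf.
  have /integrableP[_] := intg.
  have E (x : R) : `|(EFin \o g) x|%E = (g x)%:E by rewrite /= ger0_norm.
  under eq_integral do rewrite E.
  rewrite P//; apply: le_lt_trans; rewrite le_eqVlt; apply/orP; left; apply/eqP.
  by apply: eq_integral => x _ /=; rewrite ger0_norm// mulr_ge0 ?normal_pdf_ge0.
have -> : (fun x => (f x)%:E) = (fun x => (f x + a x)%:E - (a x)%:E)%E.
  by apply/funext => x; rewrite -EFinB addrK.
have a0 (x : R) : 0 <= a x by exact: normr_ge0.
rewrite integralB//= (P a)// (P (fun x => f x + a x))//; last exact: measurable_funD.
rewrite -integralB//; [|exact: (L (fun x => f x + a x))|exact: (L a)].
by apply: eq_integral => x _; rewrite -EFinB; congr EFin; ring.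
Qed.

Lemma is_derive_normal_pdf (x : R) : is_derive x (1 : R) p (- (x / s ^+ 2 * p x)).
Proof.
rewrite normal_pdfE//.
have -> : (fun x : R => normal_peak s * normal_fun 0 s x) =
  (fun x : R => normal_peak s * expR ((- (s ^+ 2 *+ 2)^-1) * x ^+ 2)).
  by apply/funext => y; rewrite /normal_fun subr0; congr (_ * expR _); rewrite mulNr mulNr mulrC.
apply: is_derive_eq.
rewrite /normal_fun subr0.
rewrite (_ : - x ^+ 2 / (s ^+ 2 *+ 2) = - (s ^+ 2 *+ 2)^-1 * x ^+ 2); last first.
  by rewrite mulNr mulNr mulrC.
by rewrite /GRing.scale /= !mulr1; field.
Qed.

Lemma normal_pdf_even (x : R) : p (- x) = p x.
Proof. by rewrite normal_pdfE// /normal_fun !subr0 sqrrN. Qed.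

Lemma normal_moment1 : (\int[N]_x x%:E = 0)%E.
Proof.
rewrite (@integral_normal_prob idfun); last exact: (@normal_integrable_pow 1).
apply: (@integral_line_derive _ (fun x => - s ^+ 2 * p x)).
- move=> x; have := is_derive_normal_pdf x => dp.
  by apply: is_derive_eq; rewrite /GRing.scale /=; field.
- move=> x; apply: cvgM; first exact: cvg_id.
  exact: continuous_normal_pdf.
- exact: (@integrable_pow_normal_pdf 1).
- under eq_fun do rewrite normal_pdf_even subrr.
  exact: cvg_cst.
Qed.

Lemma normal_moment2 : (\int[N]_x (x ^+ 2)%:E = (s ^+ 2)%:E)%E.
Proof.
rewrite (@integral_normal_prob (fun x => x ^+ 2)); last exact: (@normal_integrable_pow 2).
have int2 := @integrable_pow_normal_pdf 2 isT.
have int0 : leb.-integrable setT (EFin \o p) by exact: integrable_normal_pdf.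
have int2' : leb.-integrable setT (EFin \o (fun x : R => (s ^+ 2)^-1 * (x ^+ 2 * p x))).
  exact: (integrableZl measurableT _ int2).
have h : (\int[leb]_x (p x - (s ^+ 2)^-1 * (x ^+ 2 * p x))%:E = 0)%E.
  apply: (@integral_line_derive _ (fun x => x * p x)).
  - move=> x; have := is_derive_normal_pdf x => dp.
    by apply: is_derive_eq; rewrite /GRing.scale /=; field.
  - move=> x; apply: cvgB; first exact: continuous_normal_pdf.
    apply: cvgM; first exact: cvg_cst.
    by apply: cvgM; [exact: exprn_continuous|exact: continuous_normal_pdf].
  - exact: (@integrableB _ _ _ leb setT measurableT _ _ int0 int2').
  - pose C := 2 * (64 * s ^+ 4 * normal_peak (2 * s)).
    have C0 : 0 <= C by rewrite !mulr_ge0 ?normal_peak_ge0 ?exprn_ge0// ltW.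
    apply: (@squeeze_cvgr _ _ _ _ (cst 0) (fun n => C * n.+1%:R^-1)).
    + apply: nearW => n; rewrite normal_pdf_even mulNr opprK.
      have n0 : 0 < n.+1%:R :> R by rewrite ltr0n.
      have p0 := normal_pdf_ge0 0 s (n.+1%:R : R).
      rewrite addr_ge0 ?mulr_ge0//= ?(ltW n0)//.
      rewrite ler_pdivlMr//.
      have h1 := normal_pdf_pow4_le (n.+1%:R : R).
      have h2 : 64 * s ^+ 4 * normal_pdf 0 (2 * s) n.+1%:R <= 64 * s ^+ 4 * normal_peak (2 * s).
        apply: ler_wpM2l; first by rewrite mulr_ge0// exprn_ge0// ltW.
        by apply: normal_pdf_ub; rewrite mulf_neq0.
      have n1 : 1 <= n.+1%:R :> R by rewrite ler1n.
      have h3 : n.+1%:R ^+ 2 * p n.+1%:R <= n.+1%:R ^+ 4 * p n.+1%:R.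
        by apply: ler_wpM2r => //; apply: ler_weXn2l.
      have -> : (n.+1%:R * p n.+1%:R + n.+1%:R * p n.+1%:R) * n.+1%:R =
        2 * (n.+1%:R ^+ 2 * p n.+1%:R) by ring.
      by rewrite ler_pM2l//; lra.
    + exact: cvg_cst.
    + rewrite -[X in _ --> X](mulr0 C); apply: cvgM; first exact: cvg_cst.
      exact: cvg_harmonic.
move: h; rewrite integralB_EFin//.
rewrite integral_normal_pdf.
have -> : (\int[leb]_x ((s ^+ 2)^-1 * (x ^+ 2 * p x))%:E =
          (s ^+ 2)^-1%:E * \int[leb]_x (x ^+ 2 * p x)%:E)%E.
  by rewrite -(integralZl measurableT int2); apply: eq_integral => x _.
have fi : (\int[leb]_x (x ^+ 2 * p x)%:E)%E \is a fin_num by exact: integrable_fin_num int2.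
rewrite -(fineK fi) -EFinM -EFinB => -[h]; congr EFin.
have sq0 : s ^+ 2 != 0 by rewrite sqrf_eq0.
apply: (mulfI (invr_neq0 sq0)); rewrite mulVf//; lra.
Qed.

End normal_moments.

(** * Brownian expectations at a fixed time *)

Section brownian_law.
Context {R : realType} d (W : measurableType d) (P : probability W R).
Variables (x : R) (B : R -> W -> R).
Hypothesis hB : is_brownian_motion P x B.

(** The increment property is used on the whole space, which belongs to every
    sigma-algebra, with starting time [0] where [B 0 = x] almost surely. *)
Lemma brownian_ge0_integral (t : R) (f : R -> \bar R) : 0 < t ->
  measurable_fun setT f -> (forall y, 0 <= f y)%E ->
  (\int[P]_w f (B t w) =
   \int[normal_prob 0 (Num.sqrt t)]_y f (x + y)%R)%E.
Proof.
move=> t0 mf f0.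
pose Y w := B t w - B 0 w.
have mB s : 0 <= s -> measurable_fun setT (B s) by exact: (bm_measurable hB).
have mY : measurable_fun setT Y by apply: measurable_funB; apply: mB => //; exact: ltW.
have mfx : measurable_fun setT (fun y : R => f (x + y)).
  by apply: measurableT_comp mf _; exact: measurable_funD.
pose Y' : {mfun W >-> R} := mfun_Sub (mem_set mY : Y \in mfun).
transitivity (\int[P]_w f (x + Y w)%R)%E.
  apply: ae_eq_integral => //.
  - by apply: measurableT_comp mf _; apply: mB; exact: ltW.
  - exact: (measurableT_comp mfx mY).
  - by apply: filterS (bm_start hB) => w Bw _; rewrite /Y Bw addrC subrK.
rewrite -[LHS](@ge0_integral_pushforward _ _ W (measurableTypeR R) _ Y mY P setT (fun y => f (x + y)))//.
apply: (eq_measure_integral (normal_prob 0 (Num.sqrt t))) => C mC _ /=.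
have := bm_increments hB (lexx 0) t0 (A := setT) (C := C).
rewrite setTI probability_setT mul1e subr0; apply => //.
by rewrite /generated_sigma_algebra; exact: (@measurableT _ (g_sigma_algebraType _)).
Qed.

Lemma brownian_integral (t : R) (f : R -> R) (M : R) : 0 < t ->
  measurable_fun setT f -> (forall y, `|f y| <= M) ->
  \int[P]_w f (B t w) = \int[normal_prob 0 (Num.sqrt t)]_y f (x + y)%R.
Proof.
move=> t0 mf fM.
have mBt : measurable_fun setT (B t) by apply: (bm_measurable hB); exact: ltW.
have E : (\int[P]_w (f (B t w) + M)%:E =
          \int[normal_prob 0 (Num.sqrt t)]_y (f (x + y)%R + M)%:E)%E.
  apply: (@brownian_ge0_integral t (fun z => (f z + M)%:E)) => //.
  - by apply/measurable_EFinP; exact: measurable_funD.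
  - by move=> y; rewrite lee_fin; have := fM y; rewrite ler_norml; lra.
have [iM1 iM2] : P.-integrable setT (EFin \o cst M) /\
   (normal_prob 0 (Num.sqrt t)).-integrable setT (EFin \o cst M).
  by split; exact: finite_measure_integrable_cst.
have i1 : P.-integrable setT (EFin \o (f \o B t)).
  apply: (@integrable_bounded _ _ _ _ _ M) => [|w]; last exact: fM.
  exact: measurableT_comp.
have i2 : (normal_prob 0 (Num.sqrt t)).-integrable setT (EFin \o (fun y => f (x + y))).
  apply: (@integrable_bounded _ _ _ _ _ M) => [|w]; last exact: fM.
  by apply: measurableT_comp mf _; exact: measurable_funD.
have : \int[P]_w (f (B t w) + M) =
       \int[normal_prob 0 (Num.sqrt t)]_y (f (x + y)%R + M) by congr fine.
rewrite !RintegralD// !Rintegral_cst//= !probability_setT /= !mulr1.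
exact: addIr.
Qed.

Lemma brownian_integral0 (f : R -> R) :
  measurable_fun setT f -> (\int[P]_w (f (B 0 w))%:E = (f x)%:E)%E.
Proof.
move=> mf; transitivity (\int[P]_w (cst (f x)%:E) w)%E.
  apply: ae_eq_integral => //.
  - apply/measurable_EFinP; apply: measurableT_comp mf _.
    exact: (bm_measurable hB).
  - by apply: filterS (bm_start hB) => w -> _.
by rewrite integral_cst//= probability_setT mule1.
Qed.

(** The first order term vanishes by symmetry and the second order one gives [b * t].
    The remainder is controlled by moments of even order, since these are at hand;
    callers bound odd powers of [|y|] by even ones through the inequality between
    arithmetic and geometric means. *)
Lemma brownian_expansion (t : R) (f : R -> R) (M a b c0 c2 c4 : R) : 0 < t ->
  measurable_fun setT f -> (forall y, `|f y| <= M) ->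
  0 <= c0 -> 0 <= c2 -> 0 <= c4 ->
  (forall y, `|f (x + y) - f x - a * y - b * y ^+ 2| <= c0 + c2 * y ^+ 2 + c4 * y ^+ 4) ->
  `|\int[P]_w f (B t w) - f x - b * t| <= c0 + c2 * t + c4 * (64 * t ^+ 2).
Proof.
move=> t0 mf fM c00 c20 c40 hf.
have s0 : 0 < Num.sqrt t by rewrite sqrtr_gt0.
set s := Num.sqrt t in s0 *.
have st : s ^+ 2 = t by rewrite sqr_sqrtr// ltW.
rewrite (brownian_integral t0 mf fM).
pose N := normal_prob 0 s : probability _ _.
have ic c : N.-integrable setT (EFin \o cst c) by exact: finite_measure_integrable_cst.
have ip k c : (k <= 4)%N -> N.-integrable setT (EFin \o (fun y : R => c * y ^+ k)).
  move=> k4; exact: (integrableZl measurableT c (normal_integrable_pow s0 k4)).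
have iF : N.-integrable setT (EFin \o (fun y => f (x + y))).
  apply: (@integrable_bounded _ _ _ _ _ M) => [|w]; last exact: fM.
  by apply: measurableT_comp mf _; exact: measurable_funD.
have m1 : \int[N]_y y = 0 by rewrite /Rintegral normal_moment1.
have m2 : \int[N]_y (y ^+ 2) = t by rewrite /Rintegral normal_moment2//= st.
have m4 : \int[N]_y (y ^+ 4) <= 64 * t ^+ 2.
  have h := normal_pow4_le s0.
  have fi : (\int[N]_y (y ^+ 4)%:E)%E \is a fin_num.
    by apply: integrable_fin_num => //; exact: (normal_integrable_pow s0).
  by rewrite -lee_fin /Rintegral fineK// -st -exprM.
have Zp k c : (k <= 4)%N -> \int[N]_y (c * y ^+ k) = c * \int[N]_y (y ^+ k).
  by move=> k4; apply: RintegralZl => //; exact: normal_integrable_pow.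
have Z1 : \int[N]_y (a * y) = a * \int[N]_y y by exact: (Zp 1%N a isT).
have icx := ic (f x); have icc := ic c0.
have i1 : N.-integrable setT (EFin \o (fun y : R => a * y)) := @ip 1 a isT; have i2 := @ip 2 b isT.
have i4 := @ip 4 c4 isT; have i2' := @ip 2 c2 isT.
have iA : N.-integrable setT (EFin \o (fun y => f (x + y) - f x)).
  exact: (@integrableB _ _ _ N setT measurableT (EFin \o (fun y : R => f (x + y)))
    (EFin \o cst (f x))).
have iB : N.-integrable setT (EFin \o (fun y => f (x + y) - f x - a * y)).
  exact: (@integrableB _ _ _ N setT measurableT (EFin \o (fun y : R => f (x + y) - f x))
    (EFin \o (fun y : R => a * y))).
have iC : N.-integrable setT (EFin \o (fun y => f (x + y) - f x - a * y - b * y ^+ 2)).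
  exact: (@integrableB _ _ _ N setT measurableT
    (EFin \o (fun y : R => f (x + y) - f x - a * y)) (EFin \o (fun y : R => b * y ^+ 2))).
have iD : N.-integrable setT (EFin \o (fun y => c0 + c2 * y ^+ 2)).
  exact: (@integrableD _ _ _ N setT measurableT
    (EFin \o cst c0) (EFin \o (fun y : R => c2 * y ^+ 2))).
have iE : N.-integrable setT (EFin \o (fun y => c0 + c2 * y ^+ 2 + c4 * y ^+ 4)).
  exact: (@integrableD _ _ _ N setT measurableT
    (EFin \o (fun y : R => c0 + c2 * y ^+ 2)) (EFin \o (fun y : R => c4 * y ^+ 4))).
have E : \int[N]_y (f (x + y) - f x - a * y - b * y ^+ 2) =
         \int[N]_y f (x + y) - f x - b * t.
  rewrite RintegralB// RintegralB// RintegralB//.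
  rewrite Z1 Zp//.
  by rewrite m1 m2 mulr0 subr0 Rintegral_cst//= probability_setT mulr1.
have F : \int[N]_y (c0 + c2 * y ^+ 2 + c4 * y ^+ 4) <= c0 + c2 * t + c4 * (64 * t ^+ 2).
  rewrite RintegralD// RintegralD//.
  rewrite (Zp 2%N c2 isT) (Zp 4%N c4 isT).
  rewrite m2 Rintegral_cst//= probability_setT mulr1.
  by apply: lerD => //; exact: ler_wpM2l.
rewrite -E; apply: le_trans F; apply: le_trans (le_normr_Rintegral _ _) _ => //.
by apply: le_Rintegral => //; exact: integrable_norm iC.
Qed.

End brownian_law.

(** * Joint measurability of continuous processes *)

Section joint_measurability.
Context {R : realType} d (W : measurableType d).
Variable B : R -> W -> R.
Hypothesis mB : forall t, 0 <= t -> measurable_fun setT (B t).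
Hypothesis cB : forall w, {within `[0, +oo[, continuous (B ^~ w)}.

Let D : set (R * W) := [set p | 0 <= p.1].

Lemma measurable_time_ge0 : measurable D.
Proof.
rewrite (_ : D = `[0, +oo[%classic `*` setT).
  by apply: measurableX => //; exact: measurable_itv.
by apply/seteqP; split => -[s w] /=; rewrite /D /= in_itv/= andbT; [|case].
Qed.

Let measurable_grid n : measurable_fun D (fun p : R * W => B (grid n p.1) p.2).
Proof.
move=> mD Y mY.
have n0 : 0 < n.+1%:R :> R by rewrite ltr0n.
rewrite (_ : _ `&` _ = \bigcup_k (`[k%:R / n.+1%:R, k.+1%:R / n.+1%:R[%classic `*`
    (B (k%:R / n.+1%:R) @^-1` Y))).
  apply: bigcupT_measurable => k; apply: measurableX; first exact: measurable_itv.
  rewrite -[X in measurable X]setTI; apply: mB => //; exact: divr_ge0.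
apply/seteqP; split => -[s w] /=.
  move=> [s0 BY]; exists (Num.truncn (n.+1%:R * s)) => //; split => //=.
  rewrite in_itv/=; have /andP[h1 h2] := grid_bounds n s0.
  by rewrite h1 /= -natr1 mulrDl mul1r.
move=> [k _ [/=]]; rewrite in_itv/= => /andP[ks sk] BY.
have s0 : 0 <= s by rewrite (le_trans _ ks)// divr_ge0.
split => //; rewrite /grid.
suff -> : Num.truncn (n.+1%:R * s) = k by [].
apply: truncn_def; rewrite ?mulr_ge0//.
by rewrite [_ * s]mulrC -ler_pdivrMr// ks /= -ltr_pdivlMr.
Qed.

(** The process is the limit of its values at the grid points below the current time;
    each of these approximations is constant in time on countably many intervals. *)
Lemma measurable_continuous_process :
  measurable_fun D (fun p : R * W => B p.1 p.2).
Proof.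
apply: measurable_fun_cvg measurable_grid _ => -[s w] /= s0.
have gs := cvg_grid s0.
have sD : [set` `[0, +oo[] s by rewrite /= in_itv/= andbT.
have cBs := (subspace_continuousP _ _).1 (@cB w) s sD.
apply: cvg_comp _ cBs => U /= hU; have := gs _ hU.
by apply: (@filterS _ \oo) => n /=; apply; rewrite in_itv/= grid_ge0.
Qed.

End joint_measurability.

(** * The log-Laplace equation at small times *)

Section lipschitz_heat.
Context {R : realType} d (W : measurableType d) (P : probability W R).
Variables (x : R) (B : R -> W -> R).
Hypothesis hB : is_brownian_motion P x B.

(** From [|y| <= (s + y^2 / s) / 2] with [s = sqrt t], and the variance of [B t]. *)
Lemma brownian_lipschitz (t : R) (f : R -> R) (M K : R) : 0 <= t ->
  measurable_fun setT f -> (forall y, `|f y| <= M) ->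
  (forall a b, `|f a - f b| <= K * `|a - b|) ->
  `|\int[P]_w f (B t w) - f x| <= K * Num.sqrt t.
Proof.
rewrite le_eqVlt => /predU1P[<-|t0] mf fM fK.
  by rewrite {1}/Rintegral (brownian_integral0 hB mf) /= subrr normr0 sqrtr0 mulr0.
have K0 : 0 <= K by have := le_trans (normr_ge0 _) (fK 1 0); rewrite subr0 normr1 mulr1.
have s0 : 0 < Num.sqrt t by rewrite sqrtr_gt0.
set s := Num.sqrt t in s0 *.
have st : s ^+ 2 = t by rewrite sqr_sqrtr// ltW.
have := @brownian_expansion _ _ _ _ _ _ hB t f M 0 0 (K * s / 2) (K / (2 * s)) 0 t0 mf fM.
rewrite !mul0r subr0 addr0 => h.
have -> : K * s = K * s / 2 + K / (2 * s) * t by rewrite -st; field; rewrite gt_eqF.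
apply: h => //.
- by rewrite divr_ge0// mulr_ge0// ltW.
- by rewrite divr_ge0// mulr_ge0// ltW.
- move=> y; rewrite !mul0r !subr0 addr0; apply: le_trans (fK _ _) _.
  rewrite addrAC subrr add0r.
  have -> : K * s / 2 + K / (2 * s) * y ^+ 2 = K * ((s ^+ 2 + y ^+ 2) / (2 * s)).
    by field; rewrite gt_eqF.
  apply: ler_wpM2l => //; rewrite ler_pdivlMr ?mulr_gt0//.
  have : 0 <= (s - `|y|) ^+ 2 by exact: sqr_ge0.
  by rewrite sqrrB real_normK ?num_real//; lra.
Qed.

End lipschitz_heat.

Section small_time.
Context {R : realType} dW (W : measurableType dW).
Variables (PB : R -> probability W R) (B : R -> W -> R).
Hypothesis hB : forall x, is_brownian_motion (PB x) x B.
Notation leb := (@lebesgue_measure R).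

Variables (v : R -> R) (M : R).
Hypothesis mv : measurable_fun setT v.
Hypothesis v_ge0 : forall x, 0 <= v x.
Hypothesis v_le : forall x, v x <= M.
Variable u : R -> R -> R.
Hypothesis hu : solves_log_laplace_equation PB B v u.

Let mB t : 0 <= t -> measurable_fun setT (B t).
Proof. exact: (bm_measurable (hB 0)). Qed.

Let cB w : {within `[0, +oo[, continuous (B ^~ w)}.
Proof. exact: (bm_continuous (hB 0)). Qed.

Let M0 : 0 <= M. Proof. exact: le_trans (v_ge0 0) (v_le 0). Qed.

Let v_norm x : `|v x| <= M. Proof. by rewrite ger0_norm. Qed.

Let branching (t : R) (p : W * R) : \bar R :=
  ((fun p : W * R => (psi (u (t - p.2) (B p.2 p.1)))%:E) \_
    [set p | 0 <= p.2 <= t]) p.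

Let branching_ge0 t p : (0 <= branching t p)%E.
Proof.
rewrite /branching patchE; case: ifPn => // _.
by rewrite lee_fin /psi mulr_ge0// sqr_ge0.
Qed.

Let measurable_branching t : measurable_fun setT (branching t).
Proof.
pose D := [set p : W * R | 0 <= p.2 <= t].
have mD : measurable D.
  rewrite (_ : D = setT `*` `[0, t]%classic).
    by apply: measurableX => //; exact: measurable_itv.
  by apply/seteqP; split => -[w s] /=; rewrite /D /= in_itv/=; [|case].
apply: (@measurable_restrictT _ _ _ _ D
  (fun p : W * R => (psi (u (t - p.2) (B p.2 p.1)))%:E) mD).1.
apply/measurable_EFinP; rewrite /psi.
apply: measurable_funM => //; apply: measurable_funX.
pose b := (fun p : W * R => B p.2 p.1) \_ D.
have mb : measurable_fun setT b.
  apply: (@measurable_restrictT _ _ _ _ D _ mD).1.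
  apply: (@measurable_comp _ _ _ _ _ _ [set q : R * W | 0 <= q.1]
    (fun q => B q.1 q.2) D (fun p : W * R => (p.2, p.1))).
  - exact: measurable_time_ge0.
  - by move=> _ [[w s] /= /andP[s0 st] <-].
  - exact: measurable_continuous_process.
  - apply: measurable_funTS.
    by apply: measurable_fun_pair; [exact: measurable_snd|exact: measurable_fst].
apply: (@eq_measurable_fun _ _ _ _ D (fun p : W * R => u (t - p.2) (b p))).
  by move=> p pD; rewrite /b patchE pD.
apply: (@measurable_comp _ _ _ _ _ _ [set q : R * R | 0 <= q.1]
  (fun q => u q.1 q.2) D (fun p : W * R => (t - p.2, b p))).
- exact: measurable_time_ge0.
- by move=> _ [[w s] /= /andP[s0 st] <-] /=; rewrite subr_ge0.
- exact: (lle_measurable hu).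
- apply: measurable_funTS; apply: measurable_fun_pair => //.
  by apply: measurable_funB => //; exact: measurable_snd.
Qed.

Let J (t x : R) : \bar R :=
  (\int[PB x]_w \int[leb]_(s in `[0%R, t]) (psi (u (t - s)%R (B s w)))%:E)%E.

Let JE t x : J t x = (\int[leb]_(s in `[0%R, t])
    \int[PB x]_w (psi (u (t - s)%R (B s w)))%:E)%E.
Proof.
transitivity (\int[PB x]_w \int[leb]_s branching t (w, s))%E.
  apply: eq_integral => w _; rewrite [LHS]integral_mkcond; apply: eq_integral => s _.
  by rewrite /branching !patchE; congr (if _ then _ else _); apply/idP/idP; rewrite !inE /= in_itv.
rewrite (@fubini_tonelli _ _ W (measurableTypeR R) R (PB x) leb (branching t)
  (measurable_branching t) (branching_ge0 t)) [RHS]integral_mkcond; apply: eq_integral => s _.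
rewrite patchE; case: ifPn => sD.
  apply: eq_integral => w _; rewrite /branching patchE mem_set//=.
  by move: sD; rewrite inE /= in_itv.
under eq_integral => w _.
  rewrite /branching patchE memNset; last first.
    by move=> /= h; move: sD; rewrite notin_setE /= in_itv /=; apply.
  over.
by rewrite integral0.
Qed.

Let J_ge0 t x : (0 <= J t x)%E.
Proof.
apply: integral_ge0 => w _; apply: integral_ge0 => s _.
by rewrite lee_fin /psi mulr_ge0// sqr_ge0.
Qed.

Let heat t x : 0 <= t -> (\int[PB x]_w (v (B t w))%:E)%E =
  (\int[PB x]_w v (B t w))%:E.
Proof.
move=> t0; apply: (@Rintegral_EFin _ _ _ _ _ M) => [|w]; last exact: v_norm.
by apply: measurableT_comp mv _; exact: mB.
Qed.

(** The branching term of the equation is nonnegative, and the heat flow of [v] stays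
    below [M]. *)
Lemma log_laplace_le t x : 0 <= t -> u t x <= M.
Proof.
move=> t0; have E := lle_equation hu x t0.
rewrite heat// in E.
have h : \int[PB x]_w v (B t w) <= M.
  have mvB : measurable_fun setT (fun w => v (B t w)).
    by apply: measurableT_comp mv _; exact: mB.
  have := le_Rintegral_cst (PB x) mvB (fun w => v_norm (B t w)).
  by rewrite /= probability_setT mulr1.
rewrite -lee_fin; apply: le_trans (_ : _ <= (\int[PB x]_w v (B t w))%:E)%E _.
  by rewrite -E leeDl//; exact: J_ge0.
by rewrite lee_fin.
Qed.

Lemma log_laplace_equation_fin t x : 0 <= t ->
  J t x \is a fin_num /\ u t x = \int[PB x]_w v (B t w) - fine (J t x).
Proof.
move=> t0; have E := lle_equation hu x t0; rewrite heat// -/(J t x) in E.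
have Jfin : J t x \is a fin_num.
  rewrite ge0_fin_numE ?J_ge0//; move: E; case: (J t x) => //.
  by move=> r _; rewrite ltry.
split => //; move: E; rewrite -{1}(fineK Jfin) -EFinD => -[<-].
by rewrite addrK.
Qed.

Lemma measurable_log_laplace t : 0 <= t -> measurable_fun setT (u t).
Proof.
move=> t0; apply: (@measurable_comp _ _ _ _ _ _ [set q : R * R | 0 <= q.1]
  (fun q => u q.1 q.2) setT (fun y : R => (t, y))).
- exact: measurable_time_ge0.
- by move=> _ [y _ <-].
- exact: (lle_measurable hu).
- exact: measurable_fun_pair.
Qed.

Let measurable_psi (f : R -> R) : measurable_fun setT f ->
  measurable_fun setT (fun y => psi (f y)).
Proof. by move=> mf; apply: measurable_funM => //; exact: measurable_funX. Qed.

Let psi_norm z : 0 <= z <= M -> `|psi z| <= psi M.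
Proof.
move=> /andP[z0 zM]; rewrite /psi ger0_norm ?mulr_ge0 ?sqr_ge0//.
by rewrite ler_pM2l// lerXn2r ?nnegrE// (le_trans z0).
Qed.

Let psi_dist a b : 0 <= a <= M -> 0 <= b <= M -> `|psi a - psi b| <= 4 * M * `|a - b|.
Proof.
move=> /andP[a0 aM] /andP[b0 bM]; rewrite /psi.
have -> : 2 * a ^+ 2 - 2 * b ^+ 2 = (2 * (a + b)) * (a - b) by ring.
rewrite normrM ler_wpM2r// ger0_norm; last lra.
lra.
Qed.

Let uB_bounds t s x : 0 <= s <= t -> 0 <= u (t - s) x <= M.
Proof.
move=> /andP[s0 st]; rewrite (lle_ge0 hu) ?subr_ge0//=.
by apply: log_laplace_le; rewrite subr_ge0.
Qed.

(** After exchanging the expectation with the time integral, the branching term is the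
    integral of the estimated quantity over an interval of length [t]. *)
Lemma branching_term_bound t x c e : 0 <= t -> 0 <= c ->
  (forall s, 0 <= s <= t -> `|\int[PB x]_w psi (u (t - s) (B s w)) - c| <= e) ->
  `|fine (J t x) - c * t| <= e * t.
Proof.
move=> t0 c0 hce.
have e0 : 0 <= e by apply: le_trans (hce 0 _); rewrite ?lexx.
have rE s : 0 <= s <= t -> (\int[PB x]_w (psi (u (t - s) (B s w)))%:E)%E =
    (\int[PB x]_w psi (u (t - s) (B s w)))%:E.
  move=> st; have /andP[s0 _] := st.
  apply: (@Rintegral_EFin _ _ _ _ _ (psi M)) => [|w]; last by apply: psi_norm; exact: uB_bounds st.
  apply: (@measurableT_comp _ _ _ _ _ _ (fun y => psi (u (t - s) y))); last exact: mB.
  by apply: measurable_psi; apply: measurable_log_laplace; rewrite subr_ge0; case/andP: st.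
pose G s := (\int[PB x]_w (psi (u (t - s) (B s w)))%:E)%E.
have mG : measurable_fun `[0, t] G.
  have := @measurable_fun_fubini_tonelli_G _ _ W (measurableTypeR R) R (PB x) (branching t)
    (measurable_branching t) (branching_ge0 t).
  move=> /(@measurable_funTS _ _ _ _ `[0, t]); apply: eq_measurable_fun => s.
  rewrite inE/= in_itv/= => st; rewrite /fubini_G; apply: eq_integral => w _.
  by rewrite /branching patchE mem_set.
have Ile : (J t x <= ((c + e) * t)%:E)%E.
  rewrite JE; apply: (@le_trans _ _ (\int[leb]_(s in `[0%R, t]) (c + e)%:E)%E).
    apply: ge0_le_integral => //.
    - by move=> s _; apply: integral_ge0 => w _; rewrite lee_fin /psi mulr_ge0// sqr_ge0.
    - move=> s; rewrite /= in_itv/= => st; rewrite rE// lee_fin.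
      by have := hce _ st; rewrite ler_norml; lra.
  by rewrite integral_cst//= lebesgue_measure_itv/= lte_fin; case: ltP => h;
     rewrite ?EFinM ?sube0// (_ : t = 0) ?mule0 ?mulr0//; apply/eqP; rewrite eq_le t0 h.
have Ige : (((c - e) * t)%:E <= J t x)%E.
  rewrite JE; apply: (@le_trans _ _ (\int[leb]_(s in `[0%R, t]) (Num.max 0 (c - e))%:E)%E); last first.
    apply: ge0_le_integral => //.
    - by move=> s _; rewrite lee_fin le_max lexx.
    - move=> s; rewrite /= in_itv/= => st; rewrite rE// lee_fin ge_max.
      have := hce _ st; rewrite ler_norml => h; apply/andP; split; last lra.
      by apply: Rintegral_ge0 => w _; rewrite /psi mulr_ge0// sqr_ge0.
  rewrite integral_cst//= lebesgue_measure_itv/= lte_fin; case: ltP => h.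
    by rewrite sube0 -EFinM lee_fin ler_wpM2r// le_max lexx orbT.
  by rewrite (_ : t = 0) ?mule0 ?mulr0//; apply/eqP; rewrite eq_le t0 h.
have [Jfin _] := log_laplace_equation_fin x t0.
move: Ile Ige; rewrite -(fineK Jfin) !lee_fin ler_norml; lra.
Qed.

Variables (v1 v2 : R -> R) (K : R).
Hypothesis v_lip : forall a b, `|v a - v b| <= K * `|a - b|.
Hypothesis v_taylor : forall x y,
  `|v (x + y) - v x - v1 x * y - v2 x * y ^+ 2| <= K * `|y| ^+ 3.

Let K0 : 0 <= K.
Proof. by have := le_trans (normr_ge0 _) (v_lip 1 0); rewrite subr0 normr1 mulr1. Qed.

Let psiM0 : 0 <= psi M. Proof. by rewrite /psi mulr_ge0// sqr_ge0. Qed.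

Let mean_psi_le s t x : 0 <= s <= t ->
  0 <= \int[PB x]_w psi (u (t - s) (B s w)) <= psi M.
Proof.
move=> st; have /andP[s0 _] := st; apply/andP; split.
  by apply: Rintegral_ge0 => w _; rewrite /psi mulr_ge0// sqr_ge0.
have mf : measurable_fun setT (fun w => psi (u (t - s) (B s w))).
  apply: (@measurableT_comp _ _ _ _ _ _ (fun y => psi (u (t - s) y))); last exact: mB.
  by apply: measurable_psi; apply: measurable_log_laplace; rewrite subr_ge0; case/andP: st.
have := le_Rintegral_cst (PB x) mf (fun w => psi_norm (uB_bounds (B s w) st)).
by rewrite /= probability_setT mulr1.
Qed.

Lemma log_laplace_continuity t y : 0 <= t <= 1 ->
  `|u t y - v y| <= (K + psi M) * Num.sqrt t.
Proof.
move=> /andP[t0 t1]; have [_ ->] := log_laplace_equation_fin y t0.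
have h1 := brownian_lipschitz (hB y) t0 mv v_norm v_lip.
have h2 : `|fine (J t y) - 0 * t| <= psi M * t.
  apply: branching_term_bound => // s st; rewrite subr0.
  by have /andP[a b] := mean_psi_le y st; rewrite ger0_norm.
have ts : t <= Num.sqrt t.
  rewrite -{1}(sqr_sqrtr t0) expr2 ler_piMr ?sqrtr_ge0//.
  by rewrite -sqrtr1 ler_sqrt.
have h3 : psi M * t <= psi M * Num.sqrt t by rewrite ler_wpM2l.
move: h1 h2; rewrite mul0r subr0 !ler_norml; lra.
Qed.

(** The heat flow contributes [h * v2 x], where [v2] is half of the second derivative,
    and the branching term contributes [- h * psi (v x)]. Both errors are of order
    [h^(3/2)]: the third moment of the Brownian increment for the first, and for the
    second the oscillation, of order [sqrt h], of [u] in time and in space. *)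
Lemma log_laplace_expansion : exists2 C, 0 <= C & forall h x, 0 < h <= 1 ->
  `|u h x - (v x - h * (psi (v x) - v2 x))| <= C * (h * Num.sqrt h).
Proof.
(* [65/2 = 1/2 + 64/2], from the second and fourth moments of the normal law *)
exists (65 / 2 * K + (4 * M * (K + psi M) + 4 * M * K)).
  by rewrite !addr_ge0 ?mulr_ge0// addr_ge0.
move=> h x /andP[h0 h1]; have h0' := ltW h0.
set q := Num.sqrt h.
have q0 : 0 < q by rewrite sqrtr_gt0.
have qh : q ^+ 2 = h by rewrite sqr_sqrtr.
have [_ ->] := log_laplace_equation_fin x h0'.
have vM y : 0 <= v y <= M by rewrite v_ge0 v_le.
have heat_part : `|\int[PB x]_w v (B h w) - v x - v2 x * h| <= 65 / 2 * K * (h * q).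
  have := @brownian_expansion _ _ _ _ _ _ (hB x) h v M (v1 x) (v2 x) 0 (K * q / 2)
    (K / (2 * q)) h0 mv v_norm (lexx 0).
  have -> : 0 + K * q / 2 * h + K / (2 * q) * (64 * h ^+ 2) = 65 / 2 * K * (h * q).
    by rewrite -qh; field; rewrite gt_eqF.
  apply.
  - by rewrite divr_ge0// mulr_ge0// ltW.
  - by rewrite divr_ge0// mulr_ge0// ltW.
  - move=> y; apply: le_trans (v_taylor x y) _; rewrite add0r.
    have -> : K * q / 2 * y ^+ 2 + K / (2 * q) * y ^+ 4 =
              K * (`|y| ^+ 2 * (q ^+ 2 + `|y| ^+ 2) / (2 * q)).
      have -> : y ^+ 4 = `|y| ^+ 2 * `|y| ^+ 2 by rewrite real_normK ?num_real//; ring.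
      have -> : y ^+ 2 = `|y| ^+ 2 by rewrite real_normK ?num_real.
      by field; rewrite gt_eqF.
    apply: ler_wpM2l => //; rewrite ler_pdivlMr ?mulr_gt0//.
    have -> : `|y| ^+ 3 * (2 * q) = `|y| ^+ 2 * (2 * `|y| * q) by ring.
    apply: ler_wpM2l; first exact: exprn_ge0.
    by have := sqr_ge0 (q - `|y|); rewrite sqrrB; lra.
have branching_part : `|fine (J h x) - psi (v x) * h| <=
    (4 * M * (K + psi M) * q + 4 * M * K * q) * h.
  apply: branching_term_bound => //; first by rewrite /psi mulr_ge0// sqr_ge0.
  move=> s st; have /andP[s0 sh] := st.
  have qs : Num.sqrt s <= q by rewrite ler_sqrt.
  have qhs : Num.sqrt (h - s) <= q by rewrite ler_sqrt// gerBl.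
  have mpsiv : measurable_fun setT (fun y => psi (v y)) by exact: measurable_psi.
  have p1 : `|\int[PB x]_w psi (v (B s w)) - psi (v x)| <= 4 * M * K * q.
    apply: (@le_trans _ _ (4 * M * K * Num.sqrt s)); last first.
      by apply: ler_wpM2l => //; rewrite !mulr_ge0.
    apply: (@brownian_lipschitz _ _ _ _ _ _ (hB x) s (fun y => psi (v y)) (psi M)) => //.
    - by move=> y; apply: psi_norm.
    - move=> a b; apply: le_trans (psi_dist (vM a) (vM b)) _.
      by rewrite -[leRHS]mulrA ler_wpM2l ?mulr_ge0.
  have p2 : `|\int[PB x]_w psi (u (h - s) (B s w)) - \int[PB x]_w psi (v (B s w))|
      <= 4 * M * (K + psi M) * q.
    have -> : 4 * M * (K + psi M) * q =
        \int[PB x]_w (cst (4 * M * (K + psi M) * q) w).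
      by rewrite Rintegral_cst//= probability_setT mulr1.
    have c0 : 0 <= 4 * M * (K + psi M) * q by rewrite !mulr_ge0 ?addr_ge0// ltW.
    apply: (@Rintegral_dist_le _ _ _ _ _ _ _ (psi M + 4 * M * (K + psi M) * q)) => //.
    - apply: (@measurableT_comp _ _ _ _ _ _ (fun y => psi (u (h - s) y))); last exact: mB.
      by apply: measurable_psi; apply: measurable_log_laplace; rewrite subr_ge0.
    - by apply: measurableT_comp mpsiv _; exact: mB.
    - by move=> w; rewrite (le_trans (psi_norm (uB_bounds (B s w) st)))// lerDl.
    - by move=> w; rewrite (le_trans (psi_norm (vM (B s w))))// lerDl.
    - by move=> w; rewrite ger0_norm// lerDr.
    - move=> w; apply: le_trans (psi_dist (uB_bounds (B s w) st) (vM _)) _.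
      rewrite -[leRHS]mulrA; apply: ler_wpM2l; first by rewrite mulr_ge0.
      apply: le_trans (log_laplace_continuity _ _) _.
        by rewrite subr_ge0 sh/= (le_trans _ h1)// gerBl.
      by apply: ler_wpM2l => //; rewrite addr_ge0.
  by move: p1 p2; rewrite !ler_norml; lra.
move: heat_part branching_part; rewrite !ler_norml; lra.
Qed.

End small_time.

(** * Almost sure limits, conditional expectations, Riemann sums *)

Section ae_limits.
Context {R : realType} d (T : measurableType d) (P : probability T R).

(** Replaces an almost sure limit, which need not be measurable since the probability is
    not assumed complete, by a random variable. *)
Lemma ae_cvg_measurable (f_ : nat -> T -> R) (f : T -> R) :
  (forall n, measurable_fun setT (f_ n)) ->
  {ae P, forall w, f_ n w @[n --> \oo] --> f w} ->
  exists2 f' : T -> R, measurable_fun setT f' & {ae P, forall w, f' w = f w}.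
Proof.
move=> mf_ cf.
exists (fun w => fine (limn_esup (fun n => (f_ n w)%:E))).
  apply: (@measurableT_comp _ _ _ _ _ _ fine); first exact: fine_measurable.
  by apply: measurable_fun_limn_esup => n; exact/measurable_EFinP.
apply: filterS cf => w cw.
suff /cvg_limn_einf_sup[_ ->] : (f_ n w)%:E @[n --> \oo] --> (f w)%:E by [].
by apply: cvg_EFin; first exact: nearW; exact: cw.
Qed.

End ae_limits.

Section layer_cake.
Context {R : realType}.

Lemma sum_lt_ord (m n : nat) : (\sum_(k < n) (k < m)%N = minn m n)%N.
Proof.
elim: n => [|n IH]; first by rewrite big_ord0 minn0.
rewrite big_ord_recr /= IH; case: ltnP => nm; lia.
Qed.

(** A sum of indicators of superlevel sets that, for [z] in the unit interval, equals
    the grid approximation of [z]. When [z] is a random variable these sets belong to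
    its sigma-algebra, on which conditional expectations can be tested. *)
Definition staircase n (z : R) : R :=
  n.+1%:R^-1 * \sum_(k < n.+1) (\1_[set y : R | k.+1%:R / n.+1%:R <= y] z).

Lemma staircaseE n z : 0 <= z <= 1 -> staircase n z = grid n z.
Proof.
move=> /andP[z0 z1]; rewrite /staircase /grid mulrC; congr (_ / _).
have n0 : 0 < n.+1%:R :> R by rewrite ltr0n.
have /andP[h1 h2] := truncn_itv (mulr_ge0 (ltW n0) z0).
set m := Num.truncn _ in h1 h2 *.
have mn : (m <= n.+1)%N.
  rewrite -(ler_nat R); apply: le_trans h1 _; by rewrite ler_piMr// ltW.
rewrite -[in RHS](minn_idPl mn) -sum_lt_ord natr_sum; apply: eq_bigr => k _.
rewrite indicE; congr (_ %:R); congr nat_of_bool.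
apply/idP/idP; rewrite inE /= ler_pdivrMr// mulrC => h.
  have : k.+1%:R < m.+1%:R :> R by exact: le_lt_trans h h2.
  by rewrite ltr_nat.
by apply: le_trans h1; rewrite ler_nat.
Qed.

Lemma staircase_approx n z : 0 <= z <= 1 -> `|staircase n z - z| <= n.+1%:R^-1.
Proof.
move=> z01; have /andP[z0 _] := z01; rewrite staircaseE//.
have n0 : 0 < n.+1%:R^-1 :> R by rewrite invr_gt0 ltr0n.
have := grid_bounds n z0; move: (grid n z) n0 => g; move: (_^-1) => e n0 /andP[h1 h2].
by rewrite ler_norml; apply/andP; split; lra.
Qed.

End layer_cake.

Section take_out_what_is_known.
Context {R : realType} d (T : measurableType d) (P : probability T R).
Variables (gen : set (set T)) (Y Z H : T -> R).
Hypothesis gen_measurable : gen `<=` measurable.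
Hypothesis YZ : is_conditional_expectation P <<s gen>> Y Z.
Hypothesis mY : measurable_fun setT Y.
Hypothesis mZ : measurable_fun setT Z.
Hypothesis Y01 : forall w, 0 <= Y w <= 1.
Hypothesis Z01 : forall w, 0 <= Z w <= 1.
Hypothesis mH : measurable_fun setT (H : g_sigma_algebraType gen -> R).
Hypothesis H01 : forall w, 0 <= H w <= 1.

Let sub_measurable : <<s gen>> `<=` measurable.
Proof. by apply: smallest_sub => //; exact: sigma_algebra_measurable. Qed.

Let mH' : measurable_fun setT H.
Proof. by move=> _ C mC; apply: sub_measurable; exact: mH. Qed.

Let S n k : set T := [set w | k.+1%:R / n.+1%:R <= H w].

Let GS n k : <<s gen>> (S n k).
Proof.
have := mH measurableT (measurable_itv `[k.+1%:R / n.+1%:R : R, +oo[).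
by rewrite setTI; congr (_ _); apply/seteqP; split => w /=; rewrite in_itv/= andbT.
Qed.

Let staircase_integral n (F : T -> R) : measurable_fun setT F -> (forall w, 0 <= F w <= 1) ->
  \int[P]_w (staircase n (H w) * F w) =
  n.+1%:R^-1 * \sum_(k < n.+1) fine (\int[P]_(w in S n k) (F w)%:E)%E.
Proof.
move=> mF F01.
have F1 w : `|F w| <= 1 by have /andP[a b] := F01 w; rewrite ger0_norm.
have mS k : measurable (S n k) by exact: sub_measurable.
have m1 k : measurable_fun setT (fun w => \1_(S n k) w * F w).
  by apply: measurable_funM => //; exact: measurable_indic.
have b1 k w : `|\1_(S n k) w * F w| <= 1.
  rewrite normrM mulr_ile1// indicE; case: (_ \in _); rewrite ?normr0 ?normr1//.
have i1 k : P.-integrable setT (EFin \o (fun w => \1_(S n k) w * F w)).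
  by apply: (@integrable_bounded _ _ _ _ _ 1) => // w.
have E1 : \int[P]_w (staircase n (H w) * F w) =
    \int[P]_w (n.+1%:R^-1 * \sum_(k < n.+1) (\1_(S n k) w * F w)).
  apply: eq_Rintegral => w _; rewrite /staircase -mulrA mulr_suml; congr (_ * _).
rewrite E1 RintegralZl//; last first.
  apply: (@integrable_bounded _ _ _ _ _ n.+1%:R) => [|w].
    by apply: measurable_sum => k; exact: m1.
  apply: le_trans (ler_norm_sum _ _ _) _.
  apply: (@le_trans _ _ (\sum_(k < n.+1) 1)); first exact: ler_sum.
  by rewrite sumr_const card_ord.
congr (_ * _); rewrite /Rintegral.
have restr k : (\int[P]_(w in S n k) (F w)%:E = \int[P]_w (\1_(S n k) w * F w)%:E)%E.
  rewrite integral_mkcond; apply: eq_integral => w _.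
  by rewrite patchE indicE; case: ifP => _; rewrite ?mul1r ?mul0r.
have E2 : (\int[P]_w (\sum_(k < n.+1) \1_(S n k) w * F w)%:E =
    \sum_(k < n.+1) \int[P]_w (\1_(S n k) w * F w)%:E)%E.
  under eq_integral do rewrite -sumEFin.
  exact: (integral_sum measurableT (fun k : 'I_n.+1 => i1 k)).
rewrite E2 (eq_bigr (fun k : 'I_n.+1 => (fine (\int[P]_(w in S n k) (F w)%:E)%E)%:E)).
  by rewrite sumEFin.
move=> k _; rewrite restr fineK//.
exact: (@integrable_fin_num _ _ _ P setT measurableT _ (i1 k)).
Qed.

(** The defining property of a conditional expectation is the case where [H] is the
    indicator of an event; the general case follows by approximating [H] with
    [staircase]. *)
Lemma condexp_take_out : \int[P]_w (H w * Y w) = \int[P]_w (H w * Z w).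
Proof.
have close n (F : T -> R) : measurable_fun setT F -> (forall w, 0 <= F w <= 1) ->
    `|\int[P]_w (staircase n (H w) * F w) - \int[P]_w (H w * F w)| <= n.+1%:R^-1.
  move=> mF F01.
  have ms : measurable_fun setT (fun w => staircase n (H w)).
    apply: measurable_funM => //; apply: measurable_sum => k.
    have mS : measurable (S n k) by exact: sub_measurable.
    exact: (measurable_indic mS).
  have n1 : n.+1%:R^-1 <= 1 :> R by rewrite invf_le1 ?ltr0n// ler1n.
  have n0 : 0 <= n.+1%:R^-1 :> R by [].
  have -> : n.+1%:R^-1 = \int[P]_w (cst n.+1%:R^-1 w).
    by rewrite Rintegral_cst//= probability_setT mulr1.
  have sa w := staircase_approx n (H01 w).
  apply: (@Rintegral_dist_le _ _ _ _ _ _ _ 2) => //.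
  - exact: measurable_funM.
  - exact: measurable_funM.
  - move=> w; have /andP[a b] := F01 w; have /andP[a' b'] := H01 w.
    rewrite normrM -[2]mulr1 ler_pM// ?(ger0_norm a)//.
    move: (sa w) n0 n1; move: (staircase n (H w)) (_^-1) => st e.
    by rewrite !ler_norml => /andP[? ?] ? ?; apply/andP; split; lra.
  - move=> w; have /andP[a b] := F01 w; have /andP[a' b'] := H01 w.
    by rewrite ger0_norm ?mulr_ge0// (@le_trans _ _ 1) ?mulr_ile1// ler1n.
  - by move=> w; rewrite ger0_norm// (le_trans n1)// ler1n.
  - move=> w; have /andP[a b] := F01 w.
    rewrite -mulrBl normrM -[leRHS]mulr1; apply: ler_pM => //=; last by rewrite ger0_norm.
have same n : \int[P]_w (staircase n (H w) * Y w) = \int[P]_w (staircase n (H w) * Z w).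
  rewrite !staircase_integral//; congr (_ * _); apply: eq_bigr => k _; congr fine.
  exact: (condexp_integral YZ).
apply/eqP; rewrite -subr_eq0 -normr_le0; apply/ler_addgt0Pl => e e0; rewrite addr0.
have [n ne] : exists n : nat, 2 * n.+1%:R^-1 <= e.
  exists (Num.truncn (2 / e)); rewrite ler_pdivrMr ?ltr0n// mulrC -ler_pdivrMr//.
  by apply/ltW; rewrite -truncn_lt_nat// divr_ge0// ltW.
apply: le_trans ne.
have hY := close n Y mY Y01; have hZ := close n Z mZ Z01.
rewrite same in hY; move: hY hZ; move: (n.+1%:R^-1) => e'.
rewrite !ler_norml => /andP[? ?] /andP[? ?].
by apply/andP; split; lra.
Qed.

End take_out_what_is_known.

Section riemann_sums.
Context {R : realType}.
Notation leb := (@lebesgue_measure R).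
Variables (F : R -> R) (b : R).
Hypothesis b0 : 0 < b.
Hypothesis cF : {within `[0, +oo[, continuous F}.

Let mesh n : R := b / n.+1%:R.

Let cell n k : set R := `[k%:R * mesh n, k.+1%:R * mesh n[%classic.

Let step n (s : R) : R := \sum_(k < n.+1) F (k%:R * mesh n) * \1_(cell n k) s.

Let mesh_gt0 n : 0 < mesh n. Proof. by rewrite divr_gt0// ltr0n. Qed.

Let stepE n s : 0 <= s < b -> step n s = F (b * grid n (s / b)).
Proof.
move=> /andP[s0 sb]; have n0 : 0 < n.+1%:R :> R by rewrite ltr0n.
set m := Num.truncn (n.+1%:R * (s / b)).
have sb0 : 0 <= n.+1%:R * (s / b) by rewrite mulr_ge0// divr_ge0// ltW.
have /andP[h1 h2] := truncn_itv sb0.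
have mn : (m < n.+1)%N.
  by rewrite truncn_lt_nat// gtr_pMr// ltr_pdivrMr// mul1r.
have cellE k : (s \in cell n k) = (k == m).
  have E : n.+1%:R * (s / b) = s / mesh n by rewrite /mesh; field; rewrite ?gt_eqF.
  rewrite eq_sym /m truncn_eq// E /cell ler_pdivlMr// ltr_pdivrMr//.
  by apply/idP/idP; rewrite inE /= in_itv.
rewrite /step (bigD1 (Ordinal mn))//= big1 ?addr0.
  rewrite indicE cellE eqxx mulr1; congr F; rewrite /grid /mesh -/m; ring.
move=> k /eqP km; rewrite indicE cellE; case: eqP => [e|_]; last by rewrite mulr0.
by exfalso; apply: km; apply/val_inj.
Qed.

(** The Riemann sum is the integral of a step function, which converges pointwise by
    continuity of [F]. *)
Lemma cvg_riemann_sums :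
  \sum_(k < n.+1) (mesh n * F (k%:R * mesh n)) @[n --> \oo] -->
  \int[leb]_(s in `[0, b[) F s.
Proof.
have mD : measurable (`[0, b[%classic : set (measurableTypeR R)) by exact: measurable_itv.
have fD : (leb `[0%R, b[ < +oo)%E.
  by rewrite lebesgue_measure_itv/= lte_fin b0 sube0 ltry.
have sub : `[0, b]%classic `<=` (`[0, +oo[%classic : set R).
  by move=> x /=; rewrite !in_itv/= andbT => /andP[].
have [M FM] : exists M, forall x, 0 <= x <= b -> `|F x| <= M.
  have cFb : {within `[0, b], continuous F} by exact: continuous_subspaceW cF.
  have [M [_ hM]] := compact_bounded (continuous_compact cFb (@segment_compact _ 0 b)).
  exists (M + 1) => x xb; apply: hM; first by rewrite ltrDl.
  by exists x => //=; rewrite in_itv.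
have M0 : 0 <= M by apply: (le_trans (normr_ge0 (F 0))); apply: FM; rewrite lexx ltW.
have mF : measurable_fun `[0, b[ F.
  apply: subspace_continuous_measurable_fun; first exact: measurable_itv.
  apply: continuous_subspaceW cF => x /=.
  by rewrite !in_itv/= andbT => /andP[].
have mcell n k : measurable (cell n k) by exact: measurable_itv.
have cellT n (k : 'I_n.+1) : leb (cell n k `&` `[0%R, b[%classic) = (mesh n)%:E.
  have n0 : 0 < n.+1%:R :> R by rewrite ltr0n.
  have -> : cell n k `&` `[0%R, b[%classic = cell n k.
    apply/setIidl => s; rewrite /cell /= !in_itv/= => /andP[ks sk]; apply/andP; split.
      by rewrite (le_trans _ ks)// mulr_ge0// ltW.
    rewrite (lt_le_trans sk)// /mesh mulrA ler_pdivrMr// mulrC ler_pM2l// ler_nat.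
    exact: ltn_ord.
  rewrite /cell lebesgue_measure_itv/= lte_fin -natr1 mulrDl mul1r ltrDl mesh_gt0.
  by rewrite -EFinB addrC addKr.
have icell n k : leb.-integrable `[0, b[ (EFin \o (fun s => F (k%:R * mesh n) * \1_(cell n k) s)).
  apply: measurable_bounded_integrable => //.
    by apply: measurable_funM => //; exact: (measurable_indic (mcell n k)).
  exists `|F (k%:R * mesh n)|; split; first exact: num_real.
  move=> y /ltW Fy s _ /=; rewrite normrM (le_trans _ Fy)// ler_piMr//.
  by rewrite indicE; case: (_ \in _); rewrite ?normr0 ?normr1.
have E n : (\int[leb]_(s in `[0%R, b[) (step n s)%:E =
    (\sum_(k < n.+1) (mesh n * F (k%:R * mesh n)))%:E)%E.
  rewrite /step; under eq_integral do rewrite -sumEFin.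
  rewrite (integral_sum mD (fun k : 'I_n.+1 => icell n k)) -sumEFin.
  apply: eq_bigr => k _ /=.
  under eq_integral do rewrite EFinM.
  rewrite integralZl//; last first.
    apply: measurable_bounded_integrable => //; first exact: (measurable_indic (mcell n k)).
    exists 1; split; first exact: num_real.
    move=> y /ltW y1 s _ /=; rewrite (le_trans _ y1)//.
    by rewrite indicE; case: (_ \in _); rewrite ?normr0 ?normr1.
  rewrite (integral_indic leb mD (mcell n k)).
  transitivity ((F (k%:R * mesh n))%:E * (mesh n)%:E)%E; last by rewrite -EFinM mulrC.
  by congr (_ * _)%E; exact: cellT.
have grid_in n s : 0 <= s -> 0 <= b * grid n (s / b) <= s.
  move=> s0; have sb0 : 0 <= s / b by rewrite divr_ge0// ltW.
  have /andP[h _] := grid_bounds n sb0.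
  by rewrite (mulr_ge0 (ltW b0) (grid_ge0 _ _))/= mulrC -ler_pdivlMr.
have [] := @dominated_convergence _ _ _ leb `[0, b[%classic mD
  (fun n => EFin \o step n) (EFin \o F) (EFin \o cst M).
- move=> n; apply/measurable_EFinP; apply: measurable_sum => k.
  by apply: measurable_funM => //; apply: measurable_indic; exact: measurable_itv.
- exact/measurable_EFinP.
- apply: aeW => s; rewrite /= in_itv/= => sb; apply: cvg_EFin; first exact: nearW.
  have /andP[s0 sltb] := sb.
  under eq_fun do rewrite /= stepE//.
  have gs : b * grid n (s / b) @[n --> \oo] --> s.
    rewrite [X in _ --> X](_ : s = b * (s / b)); last by rewrite mulrC divfK ?gt_eqF.
    by apply: cvgMl_tmp; apply: cvg_grid; rewrite divr_ge0// ltW.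
  have sD : [set` `[0, +oo[] s by rewrite /= in_itv/= andbT.
  have cFs := (subspace_continuousP _ _).1 cF s sD.
  apply: cvg_comp _ cFs => U /= hU; have := gs _ hU.
  apply: (@filterS _ \oo) => n /=; apply; rewrite in_itv/= andbT.
  by have /andP[] := grid_in n s s0.
- apply: measurable_bounded_integrable => //.
  by exists M; split; [exact: num_real|move=> y /ltW My s _ /=; rewrite ger0_norm].
- apply: aeW => s n; rewrite /= in_itv/= => sb; rewrite lee_fin stepE//.
  have /andP[s0 sltb] := sb; have /andP[g0 gs] := grid_in n s s0.
  by apply: FM; rewrite g0 (le_trans gs)// ltW.
move=> iF _ h.
have -> : (fun n => \sum_(k < n.+1) (mesh n * F (k%:R * mesh n))) =
    (fun n => fine (\int[leb]_(s in `[0%R, b[) (step n s)%:E)).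
  by apply/funext => n; rewrite E.
rewrite /Rintegral; apply: fine_cvg; rewrite fineK//.
exact: integrable_fin_num iF.
Qed.

End riemann_sums.

(** * Spatially constant solutions *)

Section riccati.
Context {R : realType}.
Notation leb := (@lebesgue_measure R).
Variable a : R.
Hypothesis a_ge0 : 0 <= a.

(** For [t >= 0], the solution of [y' = - 2 y^2], [y 0 = a]. The absolute value extends
    it to a continuous function on the whole line. *)
Definition riccati (t : R) : R := a / (1 + 2 * a * `|t|).

Let den_gt0 (t : R) : 0 < 1 + 2 * a * `|t|.
Proof. by rewrite ltr_pwDl// !mulr_ge0. Qed.

Lemma riccati_ge0 t : 0 <= riccati t.
Proof. by rewrite divr_ge0// ltW. Qed.

Lemma continuous_riccati : continuous riccati.
Proof.
move=> t; apply: cvgM; first exact: cvg_cst.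
apply: cvgV; first by rewrite gt_eqF.
apply: cvgD; first exact: cvg_cst.
apply: cvgM; first exact: cvg_cst.
exact: norm_continuous.
Qed.

Lemma integral_riccati (t : R) : 0 <= t ->
  (\int[leb]_(s in `[0%R, t]) (psi (riccati (t - s)%R))%:E = (a - riccati t)%:E)%E.
Proof.
rewrite le_eqVlt => /predU1P[<-|t0].
  by rewrite set_itv1 integral_set1 /riccati normr0 mulr0 addr0 divr1 subrr.
pose D (s : R) := 1 + 2 * a * (t - s).
pose F s := a * (D s)^-1.
have D_gt0 s : s <= t -> 0 < D s.
  by move=> st; rewrite ltr_pwDl// !mulr_ge0// subr_ge0.
have dF s : s <= t -> is_derive s (1 : R) F (psi (a / D s)).
  move=> st; have D0 : D s != 0 by rewrite gt_eqF ?D_gt0.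
  have dD : is_derive s (1 : R) D (- (2 * a)).
    by apply: is_derive_eq; rewrite /GRing.scale /=; ring.
  have dV := is_deriveV D0 dD.
  by apply: is_derive_eq; rewrite /GRing.scale /psi /=; field.
have cF s : s <= t -> {for s, continuous F}.
  move=> st; apply: differentiable_continuous; apply/derivable1_diffP.
  exact: (@ex_derive _ _ _ _ _ _ _ (dF s st)).
have E s : s <= t -> riccati (t - s) = a / D s.
  by move=> st; rewrite /riccati ger0_norm// subr_ge0.
rewrite (@continuous_FTC2 _ (fun s => psi (riccati (t - s))) F 0 t t0).
- rewrite -EFinB /F /D subrr mulr0 addr0 invr1 mulr1 subr0 /riccati ger0_norm//.
  exact: ltW.
- apply: continuous_subspaceT => s; rewrite /psi.
  apply: cvgM; first exact: cvg_cst.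
  apply: (@continuous_comp _ _ _ (fun s => riccati (t - s)) (fun z => z ^+ 2)).
    apply: (@continuous_comp _ _ _ (fun s => t - s) riccati).
      by apply: cvgB; [exact: cvg_cst|exact: cvg_id].
    exact: continuous_riccati.
  exact: exprn_continuous.
- split.
  + move=> s; rewrite in_itv/= => /andP[_ /ltW st].
    exact: (@ex_derive _ _ _ _ _ _ _ (dF s st)).
  + by apply: cvg_at_right_filter; apply: cF; exact: ltW.
  + by apply: cvg_at_left_filter; exact: cF.
- move=> s; rewrite in_itv/= => /andP[_ /ltW st].
  by rewrite derive1E (@derive_val _ _ _ _ _ _ _ (dF s st)) E.
Qed.

(** For constant initial data the heat flow acts trivially, and the log-Laplace equation
    reduces to [y t + int_0^t 2 y^2 = a]. *)
Lemma riccati_log_laplace dW (W : measurableType dW) (PB : R -> probability W R)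
    (B : R -> W -> R) :
  solves_log_laplace_equation PB B (fun=> a) (fun t _ => riccati t).
Proof.
split.
- apply: measurable_funTS; apply: measurableT_comp; last exact: measurable_fst.
  exact: continuous_measurable_fun continuous_riccati.
- by move=> t x _; exact: riccati_ge0.
- move=> t x t0; under eq_integral do rewrite integral_riccati//.
  rewrite !integral_cst//= !probability_setT !mule1 -EFinD.
  by congr EFin; ring.
Qed.

End riccati.

(** * Total occupation of super-Brownian motion *)

(** The bound is [1 - exp(- c)] rather than [c] because its expectation for a random [c
    = <X_t, e>] is controlled by Laplace functionals, without any moment of the mass. *)
Lemma expRN_dist_le (R : realType) (a b c : R) : 0 <= a -> 0 <= b -> `|a - b| <= c ->
  `|expR (- a) - expR (- b)| <= 1 - expR (- c).
Proof.
wlog ab : a b / a <= b => [hw|] a0 b0 abc.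
  have [ab|/ltW ba] := leP a b; first exact: hw.
  by rewrite distrC; apply: hw => //; rewrite distrC.
rewrite ger0_norm; last by rewrite subr_ge0 ler_expR lerN2.
have -> : expR (- b) = expR (- a) * expR (- (b - a)) by rewrite -expRD; congr expR; ring.
have e1 : expR (- a) <= 1 by rewrite -expR0 ler_expR oppr_le0.
have e2 : expR (- c) <= expR (- (b - a)).
  by rewrite ler_expR lerN2; move: abc; rewrite distrC ger0_norm ?subr_ge0.
have e3 : expR (- (b - a)) <= 1 by rewrite -expR0 ler_expR oppr_le0 subr_ge0.
have := expR_ge0 (- a); nra.
Qed.

Lemma unit_norm_le1 (R : realType) (a : R) : 0 <= a <= 1 -> `|a| <= 1.
Proof. by move=> /andP[a0 a1]; rewrite ger0_norm. Qed.

Lemma unitM_norm_le1 (R : realType) (a b : R) :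
  0 <= a <= 1 -> 0 <= b <= 1 -> `|a * b| <= 1.
Proof. by move=> /unit_norm_le1 a1 /unit_norm_le1 b1; rewrite normrM mulr_ile1. Qed.

Lemma unitB_norm_le1 (R : realType) (a : R) : 0 <= a <= 1 -> `|1 - a| <= 1.
Proof. by move=> /andP[a0 a1]; rewrite ger0_norm; lra. Qed.

Lemma unitM_dist_le (R : realType) (a b c q : R) :
  0 <= a <= 1 -> `|b - c| <= q -> `|a * b - a * c| <= q.
Proof.
move=> /unit_norm_le1 a1 bc; rewrite -mulrBr normrM; apply: le_trans bc.
by rewrite -[leRHS]mul1r ler_wpM2r.
Qed.

Section superprocess.
Context {R : realType} dW (W : measurableType dW).
Variables (PB : R -> probability W R) (B : R -> W -> R).
Hypothesis hB : forall x, is_brownian_motion (PB x) x B.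
Context d (T : measurableType d) (P : probability T R).
Variable X : R -> T -> {finite_measure set R -> \bar R}.
Hypothesis hX : is_super_brownian_motion PB B P X.
Variable alpha : R.
Hypothesis alpha_gt0 : 0 < alpha.
Hypothesis hX0 : {ae P, forall w, forall E : set R, measurable E ->
            X 0%R w E = (alpha%:E * \d_(0%R : R) E)%E}.

Local Notation pairing t f w := (\int[X t w]_x f x).

Let bounded_by (M : R) (f : R -> R) :=
  [/\ measurable_fun setT f, forall x, 0 <= f x & forall x, f x <= M].

Let bnorm M f x : bounded_by M f -> `|f x| <= M.
Proof. by move=> [_ f0 fM]; rewrite ger0_norm. Qed.

Let pair_ge0 M f t w : bounded_by M f -> 0 <= (pairing t f w).
Proof. by move=> [_ f0 _]; exact: Rintegral_ge0. Qed.

Let pair_integrable M f t w : bounded_by M f -> (X t w).-integrable setT (EFin \o f).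
Proof.
by move=> bf; apply: (@integrable_bounded _ _ _ _ _ M) => [|x]; [case: bf|exact: bnorm].
Qed.

Let pairD M f M' g t w : bounded_by M f -> bounded_by M' g ->
  \int[X t w]_x (f x + g x) = (pairing t f w) + (pairing t g w).
Proof. by move=> bf bg; apply: RintegralD => //; [exact: pair_integrable bf|exact: pair_integrable bg]. Qed.

Let pairZ M f c t w : bounded_by M f -> \int[X t w]_x (c * f x) = c * (pairing t f w).
Proof. by move=> bf; apply: RintegralZl => //; exact: pair_integrable bf. Qed.

Let pair_le M f M' g t w : bounded_by M f -> bounded_by M' g ->
  (forall x, f x <= g x) -> (pairing t f w) <= (pairing t g w).
Proof. by move=> bf bg fg; apply: le_Rintegral => //; [exact: pair_integrable bf|exact: pair_integrable bg]. Qed.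

Let bounded_cst c : 0 <= c -> bounded_by c (fun=> c).
Proof. by move=> c0; split => //; exact: measurable_cst. Qed.

Let solution M f : bounded_by M f -> exists2 u, is_unique_log_laplace_solution PB B f u &
  forall s t : R, 0 <= s -> 0 <= t ->
    is_conditional_expectation P (past_sigma_algebra X s)
      (fun w => expR (- (pairing (s + t) f w))) (fun w => expR (- (pairing s (u t) w))).
Proof. by move=> [mf f0 fM]; apply: (sbm_markov hX) => //; exists M. Qed.

Let exp01 M f t w : bounded_by M f -> 0 <= expR (- (pairing t f w)) <= 1.
Proof.
by move=> bf; rewrite expR_ge0/= -expR0 ler_expR oppr_le0; exact: pair_ge0 bf.
Qed.

Let solution_bounded M f u t : bounded_by M f ->
  solves_log_laplace_equation PB B f u -> 0 <= t -> bounded_by M (u t).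
Proof.
move=> [mf f0 fM] hu t0; split.
- exact: (measurable_log_laplace hu).
- by move=> x; exact: (lle_ge0 hu).
- by move=> x; exact: (log_laplace_le hB mf f0 fM hu).
Qed.

Lemma log_laplace_time0 f u x : measurable_fun setT f ->
  solves_log_laplace_equation PB B f u -> u 0 x = f x.
Proof.
move=> mf hu; have := lle_equation hu x (lexx 0).
rewrite (brownian_integral0 (hB x) mf).
under eq_integral do rewrite set_itv1 integral_set1.
by rewrite integral0 adde0 => -[].
Qed.

(** The Laplace functional is an integrable random variable since it appears in the
    conditional expectation of the Markov property with a null time step. *)
Let measurable_exp M f t : bounded_by M f -> 0 <= t ->
  measurable_fun setT (fun w => expR (- (pairing t f w))).
Proof.
move=> bf t0; have [u _ h] := solution bf.
have := condexp_integrable_arg (h t 0 t0 (lexx 0)).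
by rewrite addr0 => /measurable_int/measurable_EFinP.
Qed.

(** The generating class of [past_sigma_algebra], made explicit so that it can index
    [g_sigma_algebraType]. *)
Let past_gen (s : R) : set (set T) :=
  [set A | exists (i : R * set R) (C : set (\bar R)),
    [/\ [set p : R * set R | 0 <= p.1 <= s /\ measurable p.2] i, measurable C &
     A = (fun w => X i.1 w i.2) @^-1` C]].

Let past_gen_measurable s : past_gen s `<=` measurable.
Proof.
move=> _ [[r E] [C [/= [/andP[r0 _] mE] mC ->]]].
have := sbm_measurable hX r0 mE; move=> /(_ measurableT C mC).
by rewrite setTI.
Qed.

Let past_mono r s : r <= s -> <<s past_gen r>> `<=` <<s past_gen s>>.
Proof.
move=> rs; apply: smallest_sub; first exact: smallest_sigma_algebra.
move=> A [i [C [/= [/andP[i0 ir] mi] mC EA]]]; apply: sub_sigma_algebra.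
by exists i, C; split => //=; split => //; rewrite i0 (le_trans ir).
Qed.

(** For a null time step, [exp(- <X_r, f>)] is its own conditional expectation given the
    past at time [r], because [u_0 = f]. *)
Let past_measurable_exp M f r s : bounded_by M f -> 0 <= r -> r <= s ->
  measurable_fun setT ((fun w => expR (- (pairing r f w))) : g_sigma_algebraType (past_gen s) -> R).
Proof.
move=> bf r0 rs _ C mC; rewrite setTI; apply: (past_mono rs).
have [u [hu _] h] := solution bf.
have := condexp_measurable (h r 0 r0 (lexx 0)) mC.
rewrite (_ : u 0 = f)//; apply/funext => x.
by apply: log_laplace_time0 hu; case: bf.
Qed.

Lemma start_integral (f : R -> R) : measurable_fun setT f -> (forall x, 0 <= f x) ->
  {ae P, forall w, (pairing 0 f w) = alpha * f 0}.
Proof.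
move=> mf f0; apply: filterS hX0 => w Xw.
pose k := NngNum (ltW alpha_gt0).
rewrite /Rintegral (eq_measure_integral (mscale k \d_(0 : R))); last first.
  by move=> A mA _; exact: Xw.
have mfE : measurable_fun setT (fun x : R => (f x)%:E) by exact/measurable_EFinP.
rewrite (ge0_integral_mscale _ measurableT k mfE); last by move=> x _; rewrite lee_fin.
rewrite (integral_dirac _ measurableT mfE).
by rewrite diracT mul1e -EFinM.
Qed.

Let laplace_start M f u t : bounded_by M f -> is_unique_log_laplace_solution PB B f u ->
  0 <= t -> \int[P]_w expR (- (pairing t f w)) = expR (- (alpha * u t 0)).
Proof.
move=> bf [hu hun] t0; have [u' [hu' _] h] := solution bf.
have -> : u t 0 = u' t 0 by rewrite (hun _ hu').
have bu := solution_bounded bf hu' t0; have [mu u0 _] := bu.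
transitivity (\int[P]_w expR (- pairing 0 (u' t) w)).
  have pastT : past_sigma_algebra X 0 setT.
    exact: (@measurableT _ (g_sigma_algebraType (past_gen 0))).
  have := condexp_integral (h 0 t (lexx 0) t0) pastT.
  by rewrite add0r /Rintegral => ->.
transitivity (\int[P]_w cst (expR (- (alpha * u' t 0))) w).
  congr fine; apply: ae_eq_integral => //.
    by apply/measurable_EFinP; exact: measurable_exp bu _.
    by apply/measurable_EFinP; exact: measurable_cst.
  by apply: filterS (start_integral mu u0) => w -> _.
by rewrite Rintegral_cst//= probability_setT mulr1.
Qed.

(** The solution started from the constant [e] stays below [e], and [1 - exp(- z) <= z]. *)
Lemma small_mass (e t : R) : 0 <= e -> 0 <= t ->
  \int[P]_w (1 - expR (- pairing t (fun=> e) w)) <= alpha * e.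
Proof.
move=> e0 t0; have be := bounded_cst e0.
have [u hu _] := solution be.
have L := laplace_start be hu t0.
have bu := solution_bounded be hu.1 t0.
have me : measurable_fun setT (fun w => expR (- pairing t (fun=> e) w)).
  exact: measurable_exp be t0.
rewrite RintegralB//; last 2 first.
- exact: finite_measure_integrable_cst.
- apply: (@integrable_bounded _ _ _ _ _ 1) => // w.
  exact: unit_norm_le1 (exp01 t w be).
rewrite Rintegral_cst//= probability_setT mulr1 L.
have ub : u t 0 <= e by case: bu.
have h := expR_ge1Dx (- (alpha * u t 0)).
have : alpha * u t 0 <= alpha * e by rewrite ler_pM2l.
lra.
Qed.

Lemma total_mass_laplace (e t : R) : 0 <= e -> 0 <= t ->
  \int[P]_w expR (- pairing t (fun=> e) w) = expR (- (alpha * riccati e t)).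
Proof.
move=> e0 t0; have be := bounded_cst e0.
have [u hu _] := solution be.
by rewrite (laplace_start be hu t0) -(hu.2 _ (riccati_log_laplace e0 PB B) t 0 t0).
Qed.

(** The Riccati solution tends to [0] whatever its initial value: the total mass of
    [X_t] tends to [0] in law. *)
Lemma extinction (e : R) : 0 <= e ->
  \int[P]_w expR (- pairing n.+1%:R (fun=> e) w) @[n --> \oo] --> (1 : R).
Proof.
move=> e0.
have -> : (fun n : nat => \int[P]_w expR (- pairing n.+1%:R (fun=> e) w)) =
    (fun n : nat => expR (- (alpha * riccati e n.+1%:R))).
  by apply/funext => n; rewrite total_mass_laplace.
have r0 : riccati e n.+1%:R @[n --> \oo] --> (0 : R).
  apply: (@squeeze_cvgr _ _ _ _ (cst 0) (fun n => n.+1%:R^-1)).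
  - apply: nearW => n; rewrite riccati_ge0//= /riccati ger0_norm//.
    have n0 : 0 < n.+1%:R :> R by rewrite ltr0n.
    have D0 : 0 < 1 + 2 * e * n.+1%:R by rewrite ltr_pwDl// !mulr_ge0.
    rewrite ler_pdivrMr// mulrDr mulr1 (mulrC (2 * e)) mulKf ?gt_eqF//.
    have : 0 < n.+1%:R^-1 :> R by rewrite invr_gt0.
    by move: (_^-1) => q q0; lra.
  - exact: cvg_cst.
  - exact: cvg_harmonic.
have ar0 : alpha * riccati e n.+1%:R @[n --> \oo] --> alpha * 0 by exact: cvgMl_tmp.
rewrite -[X in _ --> X]expR0 -oppr0 -(mulr0 alpha).
apply: (@cvg_comp _ _ _ (fun n : nat => - (alpha * riccati e n.+1%:R)) expR); last exact: continuous_expR.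
exact: cvgN.
Qed.

Section discretisation.
Variables (v v1 v2 : R -> R) (M K Mg : R).
Hypothesis bv : bounded_by M v.
Hypothesis v_lip : forall a b, `|v a - v b| <= K * `|a - b|.
Hypothesis v_taylor : forall x y,
  `|v (x + y) - v x - v1 x * y - v2 x * y ^+ 2| <= K * `|y| ^+ 3.
Let g x := psi (v x) - v2 x.
Hypothesis bg : bounded_by Mg g.

Let weight h k w := \prod_(j < k) expR (- (h * pairing (j%:R * h) g w)).

Let A h k := \int[P]_w (weight h k w * expR (- pairing (k%:R * h) v w)).

Let weight01 h k w : 0 <= h -> 0 <= weight h k w <= 1.
Proof.
move=> h0; rewrite /weight; elim: k => [|k IH]; first by rewrite big_ord0 ler01 lexx.
rewrite big_ord_recr /=; have /andP[a b] := IH.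
have e1 : expR (- (h * pairing (k%:R * h) g w)) <= 1.
  by rewrite -expR0 ler_expR oppr_le0 mulr_ge0//; exact: pair_ge0 bg.
by rewrite mulr_ge0 ?expR_ge0//= mulr_ile1 ?expR_ge0.
Qed.

Let bhg h : 0 <= h -> bounded_by (h * Mg) (fun x => h * g x).
Proof.
move=> h0; have [mg g0 gM] := bg; split.
- exact: measurable_funM.
- by move=> x; rewrite mulr_ge0.
- by move=> x; rewrite ler_wpM2l.
Qed.

Let past_measurable_weight h k s : 0 <= h -> k%:R * h <= s + h -> 0 <= s ->
  measurable_fun setT (weight h k : g_sigma_algebraType (past_gen s) -> R).
Proof.
move=> h0 ks s0; apply: measurable_prod => j _.
have -> : (fun w => expR (- (h * pairing (j%:R * h) g w))) =
  (fun w => expR (- pairing (j%:R * h) (fun x => h * g x) w)).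
  by apply/funext => w; rewrite (pairZ _ _ _ bg).
apply: past_measurable_exp (bhg h0) _ _; first exact: mulr_ge0.
have : j.+1%:R * h <= k%:R * h by rewrite ler_wpM2r// ler_nat.
by rewrite -natr1 mulrDl mul1r; lra.
Qed.

Let measurable_weight h k : 0 <= h -> measurable_fun setT (weight h k).
Proof.
move=> h0 _ C mC.
have s0 : 0 <= k%:R * h by rewrite mulr_ge0.
have ks : k%:R * h <= k%:R * h + h by rewrite lerDl.
have := @past_measurable_weight h k (k%:R * h) h0 ks s0 measurableT C mC.
exact: (smallest_sub (@sigma_algebra_measurable _ T) (@past_gen_measurable (k%:R * h))).
Qed.

(** Conditioning on the past at time [s = k h] replaces [<X_(s+h), v>] by [<X_s, u_h>].
    The weights up to time [s] are measurable for that past. Since [h g + u_h - v =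
    O(h^(3/2))], the two exponents differ by at most [<X_s, e>] for a constant [e] of
    order [h^(3/2)], and [small_mass] bounds the expected effect. *)
Lemma discretisation_step : exists2 C, 0 <= C & forall h k, 0 < h <= 1 ->
  `|A h k.+1 - A h k| <= alpha * (C * (h * Num.sqrt h)).
Proof.
have [u [hu _] markov] := solution bv.
have [mv v0 vM] := bv.
have [C C0 expansion] := log_laplace_expansion hB mv v0 vM hu v_lip v_taylor.
exists C => // h k h01; have /andP[h0 h1] := h01; have h0' := ltW h0.
have [s sE] : exists s, s = k%:R * h by exists (k%:R * h).
have s0 : 0 <= s by rewrite sE mulr_ge0.
have [e eE] : exists e, e = C * (h * Num.sqrt h) by exists (C * (h * Num.sqrt h)).
have e0 : 0 <= e by rewrite eE !mulr_ge0 ?sqrtr_ge0.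
have be := bounded_cst e0.
have bu := solution_bounded bv hu h0'.
have sS : k.+1%:R * h = s + h by rewrite -natr1 mulrDl mul1r sE.
have weightS w : weight h k.+1 w = weight h k w * expR (- (h * pairing s g w)).
  by rewrite {1}/weight big_ord_recr/= -sE.
have AE : A h k = \int[P]_w (weight h k w * expR (- pairing s v w)).
  by rewrite /A sE; reflexivity.
have AS : A h k.+1 = \int[P]_w (weight h k.+1 w * expR (- pairing s (u h) w)).
  rewrite /A sS; apply: (condexp_take_out (@past_gen_measurable s) (markov s h s0 h0')).
  - exact: measurable_exp bv (addr_ge0 s0 h0').
  - exact: measurable_exp bu s0.
  - by move=> w; exact: exp01 bv.
  - by move=> w; exact: exp01 bu.
  - by apply: past_measurable_weight; rewrite ?sS.
  - by move=> w; exact: weight01.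
have bhgu : bounded_by (h * Mg + M) (fun x => h * g x + u h x).
  have [mu u0 uM] := bu; have [mhg hg0 hgM] := bhg h0'; split.
  - exact: measurable_funD.
  - by move=> x; exact: addr_ge0.
  - by move=> x; exact: lerD.
have error_le x : `|u h x - (v x - h * g x)| <= e by rewrite eE; exact: expansion.
rewrite AS AE -eE; apply: le_trans (small_mass e0 s0).
clear AS AE eE sE sS.
have mw j := @measurable_weight h j h0'.
apply: (@Rintegral_dist_le _ _ _ _ _ _ _ 1).
- exact: (measurable_funM (mw k.+1) (measurable_exp bu s0)).
- exact: (measurable_funM (mw k) (measurable_exp bv s0)).
- exact: (measurable_funB (measurable_cst _) (measurable_exp be s0)).
- by move=> w; exact: unitM_norm_le1 (weight01 k.+1 w h0') (exp01 s w bu).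
- by move=> w; exact: unitM_norm_le1 (weight01 k w h0') (exp01 s w bv).
- by move=> w; exact: unitB_norm_le1 (exp01 s w be).
move=> w; rewrite weightS -mulrA -expRD.
have -> : - (h * pairing s g w) - pairing s (u h) w =
    - (\int[X s w]_x (h * g x + u h x)).
  by rewrite (pairD _ _ (bhg h0') bu) (pairZ _ _ _ bg); ring.
apply: unitM_dist_le (weight01 k w h0') _.
apply: expRN_dist_le; [exact: pair_ge0 bhgu|exact: pair_ge0 bv|].
have iu := pair_integrable s w bhgu; have iv := pair_integrable s w bv.
apply: (@Rintegral_dist_le _ _ _ (X s w) _ _ _ (h * Mg + M + M + e)).
- by case: bhgu.
- by [].
- exact: measurable_cst.
- move=> x; rewrite (le_trans (bnorm x bhgu))// -addrA lerDl addr_ge0//.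
  exact: le_trans (v0 0) (vM 0).
- move=> x; rewrite (le_trans (bnorm x bv))// addrAC lerDr addr_ge0//.
  by case: bhgu => _ f0 fM; have := le_trans (f0 0) (fM 0).
- move=> x; rewrite ger0_norm// lerDr addr_ge0//; last exact: le_trans (v0 0) (vM 0).
  by case: bhgu => _ f0 fM; have := le_trans (f0 0) (fM 0).
move=> x; apply: le_trans (error_le x).
by rewrite le_eqVlt; apply/orP; left; apply/eqP; congr `|_|; ring.
Qed.

Let A0 h : A h 0 = expR (- (alpha * v 0)).
Proof.
have [u hu _] := solution bv; have [mv _ _] := bv.
have L := laplace_start bv hu (lexx 0).
rewrite (log_laplace_time0 0 mv hu.1) in L.
rewrite -L /A mul0r; apply: eq_Rintegral => w _.
by rewrite /weight big_ord0 mul1r.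
Qed.

Lemma discretisation_error : exists2 C, 0 <= C & forall h n, 0 < h <= 1 ->
  `|A h n - expR (- (alpha * v 0))| <= C * (n%:R * h) * Num.sqrt h.
Proof.
have [C C0 hC] := discretisation_step.
exists (alpha * C); first by rewrite mulr_ge0// ltW.
move=> h n h01; rewrite -(A0 h); elim: n => [|n IH].
  by rewrite subrr normr0 mul0r mulr0 mul0r.
apply: le_trans (ler_distD (A h n) _ _) _.
have -> : alpha * C * (n.+1%:R * h) * Num.sqrt h =
  alpha * (C * (h * Num.sqrt h)) + alpha * C * (n%:R * h) * Num.sqrt h.
  by rewrite -natr1; ring.
by apply: lerD => //; exact: hC.
Qed.

Hypothesis cg : continuous g.

Let path_continuous : {ae P, forall w, {within `[0, +oo[, continuous (fun t => pairing t g w)}}.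
Proof.
apply: filterS (sbm_weakly_continuous hX) => w; apply => //.
by exists Mg => x; exact: bnorm.
Qed.

(** The identity is exact in the limit of vanishing mesh: with [n + 1] steps of length
    [b / (n + 1)] the discretisation error is of order [b * sqrt (b / n)]. *)
Lemma occupation_until (b : R) : 0 < b -> exists I : T -> R,
  [/\ measurable_fun setT I,
      {ae P, forall w, I w = \int[@lebesgue_measure R]_(s in `[0, b[) pairing s g w} &
      \int[P]_w (expR (- I w) * expR (- pairing b v w)) = expR (- (alpha * v 0))].
Proof.
move=> b0.
pose h n : R := b / n.+1%:R.
pose S n w := \sum_(j < n.+1) (h n * pairing (j%:R * h n) g w).
have h0 n : 0 < h n by rewrite divr_gt0// ltr0n.
have nh n : n.+1%:R * h n = b by rewrite /h mulrC divfK// pnatr_eq0.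
have wS n w : weight (h n) n.+1 w = expR (- S n w).
  by rewrite /weight /S -sumrN expR_sum.
have mS n : measurable_fun setT (S n).
  apply: measurable_sum => j; apply: measurable_funM => //.
  (* the pairing is measurable as a logarithm of its Laplace functional *)
  have := measurable_exp bg (mulr_ge0 (ler0n R j) (ltW (h0 n))) => mE.
  have -> : (fun w => pairing (j%:R * h n) g w) = (fun w => - ln (expR (- pairing (j%:R * h n) g w))).
    by apply/funext => w; rewrite expRK opprK.
  by apply: measurableT_comp => //; apply: measurableT_comp mE => //; exact: measurable_ln.
have cS : {ae P, forall w, S n w @[n --> \oo] -->
    \int[@lebesgue_measure R]_(s in `[0, b[) pairing s g w}.
  by apply: filterS path_continuous => w cw; exact: cvg_riemann_sums.
have [I mI IE] := ae_cvg_measurable mS cS.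
exists I; split => //.
have bvb := measurable_exp bv (ltW b0).
have cvA : \int[P]_w (expR (- S n w) * expR (- pairing b v w)) @[n --> \oo] -->
    \int[P]_w (expR (- I w) * expR (- pairing b v w)).
  apply: (@bounded_cvg_Rintegral _ _ _ P _ _ 1).
  - move=> n; apply: measurable_funM => //.
    by apply: measurableT_comp => //; exact: measurableT_comp.
  - apply: measurable_funM => //.
    by apply: measurableT_comp => //; exact: measurableT_comp.
  - by move=> n w; rewrite -wS; exact: unitM_norm_le1 (weight01 _ w (ltW (h0 n))) (exp01 b w bv).
  - apply: filterS2 cS IE => w cw ->; apply: cvgMr_tmp.
    apply: (@cvg_comp _ _ _ (fun n => - S n w) expR); last exact: continuous_expR.
    exact: cvgN.
have AE n : \int[P]_w (expR (- S n w) * expR (- pairing b v w)) = A (h n) n.+1.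
  by rewrite /A nh; apply: eq_Rintegral => w _; rewrite wS.
have [C C0 hC] := discretisation_error.
apply: (cvg_unique _ cvA) => //.
apply/cvgrPdist_le => e e0.
have hn0 : h n @[n --> \oo] --> b * 0 by apply: cvgMl_tmp; exact: cvg_harmonic.
have sqn0 : Num.sqrt (h n) @[n --> \oo] --> Num.sqrt (b * 0).
  by apply: (@cvg_comp _ _ _ h Num.sqrt _ _ _ hn0); exact: sqrt_continuous.
have sq0 : C * b * Num.sqrt (h n) @[n --> \oo] --> (0 : R).
  rewrite [X in _ --> X](_ : 0 = C * b * Num.sqrt (b * 0)).
    exact: cvgMl_tmp.
  by rewrite mulr0 sqrtr0 mulr0.
near=> n; rewrite distrC AE; apply: le_trans (hC _ _ _) _.
  rewrite h0/= /h ler_pdivrMr ?ltr0n// mul1r.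
  rewrite (@le_trans _ _ n%:R) ?ler_nat//; near: n; exact: nbhs_infty_ger.
rewrite nh.
have h1 : 0 <= C * b * Num.sqrt (h n) by rewrite !mulr_ge0 ?sqrtr_ge0// ltW.
rewrite -[leLHS](ger0_norm h1) -[X in `|X|]subr0 distrC.
by near: n; move/cvgrPdist_le : sq0; apply.
Unshelve. all: by end_near. Qed.

(** The function [v] is bounded by a constant [M], so [exp(- <X_t, v>)] lies between
    [exp(- <X_t, M>)] and [1], and disappears as [t] tends to infinity by [extinction].
    The function [I] need not be measurable, whence the version [J]. *)
Lemma total_occupation (I : T -> R) :
  {ae P, forall w, (\int[@lebesgue_measure R]_(t in `[0%R, +oo[) (pairing t g w)%:E = (I w)%:E)%E} ->
  exists J : T -> R,
  [/\ measurable_fun setT J, forall w, 0 <= J w, {ae P, forall w, J w = I w} &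
      \int[P]_w expR (- J w) = expR (- (alpha * v 0))].
Proof.
move=> hI.
have /choice[J_ hJ] : forall n : nat, exists I : T -> R,
  [/\ measurable_fun setT I,
      {ae P, forall w, I w = \int[@lebesgue_measure R]_(s in `[0, n.+1%:R[) pairing s g w} &
      \int[P]_w (expR (- I w) * expR (- pairing n.+1%:R v w)) = expR (- (alpha * v 0))].
  by move=> n; apply: occupation_until.
have mJ_ n : measurable_fun setT (J_ n) by have [] := hJ n.
have JE : {ae P, forall w, forall n, J_ n w = \int[@lebesgue_measure R]_(s in `[0, n.+1%:R[) pairing s g w}.
  by apply/ae_foralln => n; have [] := hJ n.
have cJ : {ae P, forall w, J_ n w @[n --> \oo] --> I w}.
  apply: filterS3 JE hI path_continuous => w Jw Iw cw.
  under eq_fun do rewrite Jw.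
  rewrite /Rintegral; apply: fine_cvg; rewrite -Iw.
  have mpath : measurable_fun (`[0, +oo[%classic : set R) (fun t => pairing t g w).
    by apply: subspace_continuous_measurable_fun => //; exact: measurable_itv.
  have -> : (`[0%R, +oo[%classic : set R) = \bigcup_n `[0%R, n.+1%:R[%classic.
    apply/seteqP; split => x /=; rewrite in_itv/= ?andbT.
      move=> x0; exists (Num.truncn x) => //=; rewrite in_itv/= x0/=.
      by rewrite -truncn_lt_nat.
    by move=> [n _] /=; rewrite in_itv/= => /andP[].
  apply: ge0_nondecreasing_set_cvg_integral.
  - move=> m n mn; apply/subsetPset => x /=; rewrite !in_itv/= => /andP[-> xm]/=.
    by rewrite (lt_le_trans xm)// ler_nat.
  - by move=> n; exact: measurable_itv.
  - move=> n; apply/measurable_EFinP; apply: subspace_continuous_measurable_fun.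
      exact: measurable_itv.
    by apply: continuous_subspaceW cw => x /=; rewrite !in_itv/= andbT => /andP[].
  - by move=> n x _; rewrite lee_fin; exact: pair_ge0 bg.
have [J mJ JI] := ae_cvg_measurable mJ_ cJ.
have J_ge0 n : {ae P, forall w, 0 <= J_ n w}.
  apply: filterS JE => w ->; apply: Rintegral_ge0 => s _; exact: pair_ge0 bg.
have J_ge0' : {ae P, forall w, forall n, 0 <= J_ n w} by exact/ae_foralln.
have J0 : {ae P, forall w, 0 <= J w}.
  apply: filterS3 J_ge0' cJ JI => w Jn cw ->.
  rewrite -(cvg_lim (@Rhausdorff R) cw); apply: limr_ge; last exact: nearW.
  by apply/cvg_ex; exists (I w).
have mexp (F : T -> R) : measurable_fun setT F ->
    measurable_fun setT (fun w => expR (- Num.max 0 (F w))).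
  by move=> mF; apply: measurableT_comp => //; apply: measurableT_comp => //; exact: measurable_maxr.
have exp_max (F : T -> R) w : 0 <= expR (- Num.max 0 (F w)) <= 1.
  by rewrite expR_ge0/= -expR0 ler_expR oppr_le0 le_max lexx.
have [mv v0 vM] := bv; have M0 : 0 <= M := le_trans (v0 0) (vM 0).
have bM := bounded_cst M0.
have mEv n := measurable_exp bv (ler0n R n.+1).
have mEM n := measurable_exp bM (ler0n R n.+1).
(* truncation at 0 makes the integrands bounded everywhere, and changes them only on a
   null set *)
pose a n := \int[P]_w expR (- Num.max 0 (J_ n w)).
have a_near n : `|a n - expR (- (alpha * v 0))| <=
    1 - \int[P]_w expR (- pairing n.+1%:R (fun=> M) w).
  have [_ _ <-] := hJ n.
  have -> : \int[P]_w (expR (- J_ n w) * expR (- pairing n.+1%:R v w)) =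
      \int[P]_w (expR (- Num.max 0 (J_ n w)) * expR (- pairing n.+1%:R v w)).
    congr fine; apply: ae_eq_integral => //.
    - apply/measurable_EFinP; apply: measurable_funM => //.
      by apply: measurableT_comp => //; exact: measurableT_comp.
    - by apply/measurable_EFinP; apply: measurable_funM => //; exact: mexp.
    - by apply: filterS (J_ge0 n) => w Jw _; rewrite max_r.
  have -> : 1 - \int[P]_w expR (- pairing n.+1%:R (fun=> M) w) =
      \int[P]_w (1 - expR (- pairing n.+1%:R (fun=> M) w)).
    rewrite RintegralB//; last 2 first.
    - exact: finite_measure_integrable_cst.
    - apply: (@integrable_bounded _ _ _ _ _ 1) => // w.
      exact: unit_norm_le1 (exp01 _ w bM).
    by rewrite Rintegral_cst//= probability_setT mulr1.
  apply: (@Rintegral_dist_le _ _ _ P _ _ _ 1).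
  - exact: mexp.
  - by apply: measurable_funM => //; exact: mexp.
  - exact: measurable_funB.
  - by move=> w; exact: unit_norm_le1 (exp_max _ w).
  - by move=> w; exact: unitM_norm_le1 (exp_max _ w) (exp01 _ w bv).
  - by move=> w; exact: unitB_norm_le1 (exp01 _ w bM).
  - move=> w; have /andP[b1 b2] := exp_max (J_ n) w.
    have /andP[c1 c2] := exp01 n.+1%:R w bv.
    have le : expR (- pairing n.+1%:R (fun=> M) w) <= expR (- pairing n.+1%:R v w).
      by rewrite ler_expR lerN2; exact: pair_le bv bM vM.
    rewrite -{1}[expR (- Num.max 0 _)]mulr1 -mulrBr normrM (ger0_norm b1).
    by rewrite ger0_norm ?subr_ge0//; nra.
have ca : a n @[n --> \oo] --> expR (- (alpha * v 0)).
  apply/cvgrPdist_le => e e0.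
  have /cvgrPdist_le/(_ e e0) := extinction M0.
  apply: filterS => n hn; rewrite distrC; apply: le_trans (a_near n) _.
  by apply: le_trans hn; exact: ler_norm.
have ca' : a n @[n --> \oo] --> \int[P]_w expR (- Num.max 0 (J w)).
  apply: (@bounded_cvg_Rintegral _ _ _ P _ _ 1).
  - by move=> n; exact: mexp.
  - exact: mexp.
  - by move=> n w; exact: unit_norm_le1 (exp_max _ w).
  - have cJ' : {ae P, forall w, J_ n w @[n --> \oo] --> J w}.
      by apply: filterS2 cJ JI => w cw ->.
    apply: filterS3 J_ge0' J0 cJ' => w Jn Jw cw.
    have -> : (fun n => expR (- Num.max 0 (J_ n w))) = (fun n => expR (- J_ n w)).
      by apply/funext => n; rewrite max_r.
    rewrite max_r//; apply: (@cvg_comp _ _ _ (fun n => - J_ n w) expR); last exact: continuous_expR.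
    exact: cvgN.
exists (fun w => Num.max 0 (J w)); split.
- exact: measurable_maxr.
- by move=> w; rewrite le_max lexx.
- by apply: filterS2 J0 JI => w Jw <-; rewrite max_r.
- exact: (cvg_unique _ ca' ca).
Qed.

End discretisation.

End superprocess.

(** * Uniform Taylor expansions *)

Section uniform_big_O.
Context {R : realType}.
Implicit Types F G : R -> R -> R.

(** Uniform in the base point [x]. This class is stable under the ring operations, which
    is how Taylor expansions of composite functions are obtained below without computing
    derivatives. *)
Definition bigO (n : nat) F :=
  exists2 C, 0 <= C & forall x y, `|y| <= 1 -> `|F x y| <= C * `|y| ^+ n.

Lemma bigOD n F G : bigO n F -> bigO n G -> bigO n (fun x y => F x y + G x y).
Proof.
move=> [C C0 hC] [D D0 hD]; exists (C + D); first exact: addr_ge0.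
move=> x y y1; apply: le_trans (ler_normD _ _) _.
by rewrite mulrDl; apply: lerD; [exact: hC|exact: hD].
Qed.

Lemma bigOM n m F G : bigO n F -> bigO m G -> bigO (n + m) (fun x y => F x y * G x y).
Proof.
move=> [C C0 hC] [D D0 hD]; exists (C * D); first exact: mulr_ge0.
move=> x y y1; rewrite normrM exprD mulrACA.
by apply: ler_pM => //; [exact: hC|exact: hD].
Qed.

Lemma bigO_weaken n m F : (m <= n)%N -> bigO n F -> bigO m F.
Proof.
move=> mn [C C0 hC]; exists C => // x y y1; apply: le_trans (hC x y y1) _.
by apply: ler_wpM2l => //; exact: ler_wiXn2l.
Qed.

Lemma bigO_bounded C F : (forall x y, `|F x y| <= C) -> bigO 0 F.
Proof.
move=> hC; exists C; first exact: le_trans (normr_ge0 _) (hC 0 0).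
by move=> x y _; rewrite expr0 mulr1.
Qed.

Lemma bigO_cst c : bigO 0 (fun _ _ => c).
Proof. by apply: (@bigO_bounded `|c|). Qed.

Lemma bigO_increment : bigO 1 (fun _ y => y).
Proof. by exists 1 => // x y _; rewrite expr1 mul1r. Qed.

Lemma bigO_increment_sqr : bigO 2 (fun _ y => y ^+ 2).
Proof. by exists 1 => // x y _; rewrite normrX mul1r. Qed.

End uniform_big_O.

Section taylor.
Context {R : realType}.
Variables (f f1 f2 : R -> R) (C : R).
Hypothesis f_le : forall x, `|f x| <= C.
Hypothesis f1_le : forall x, `|f1 x| <= C.
Hypothesis f2_le : forall x, `|f2 x| <= C.
Hypothesis f_taylor : bigO 3 (fun x y => f (x + y) - f x - f1 x * y - f2 x * y ^+ 2).

(** For increments larger than [1] the bounds on [f], [f1] and [f2] suffice. *)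
Lemma taylor_global : exists2 K,
  (forall x y, `|f (x + y) - f x - f1 x * y - f2 x * y ^+ 2| <= K * `|y| ^+ 3) &
  (forall a b, `|f a - f b| <= K * `|a - b|).
Proof.
have C0 : 0 <= C by exact: le_trans (normr_ge0 _) (f_le 0).
have [D D0 hD] := f_taylor.
exists (D + 4 * C).
  move=> x y; have [y1|/ltW y1] := leP `|y| 1.
    apply: le_trans (hD x y y1) _; apply: ler_wpM2r; first exact: exprn_ge0.
    by rewrite lerDl mulr_ge0.
  have h k : (k <= 3)%N -> C * `|y| ^+ k <= C * `|y| ^+ 3.
    by move=> k3; apply: ler_wpM2l => //; exact: ler_weXn2l.
  apply: (@le_trans _ _ (C + C + C * `|y| + C * `|y| ^+ 2)).
    apply: le_trans (ler_normB _ _) _; apply: lerD.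
      apply: le_trans (ler_normB _ _) _; apply: lerD.
        by apply: le_trans (ler_normB _ _) _; apply: lerD.
      by rewrite normrM ler_wpM2r.
    by rewrite normrM normrX ler_wpM2r// exprn_ge0.
  have := h 0 isT; have := h 1 isT; have := h 2 isT; rewrite expr0 expr1 mulr1.
  have : 0 <= D * `|y| ^+ 3 by rewrite mulr_ge0// exprn_ge0.
  by rewrite mulrDl; lra.
move=> a b; pose y := a - b; have -> : a = b + y by rewrite /y addrC subrK.
rewrite [b + y - b]addrAC subrr add0r; have [y1|/ltW y1] := leP `|y| 1.
  have -> : f (b + y) - f b =
    (f (b + y) - f b - f1 b * y - f2 b * y ^+ 2) + f1 b * y + f2 b * y ^+ 2 by ring.
  apply: le_trans (ler_normD _ _) _; apply: le_trans (lerD (ler_normD _ _) (lexx _)) _.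
  have h k : (1 <= k)%N -> `|y| ^+ k <= `|y|.
    by move=> k1; rewrite -[leRHS]expr1; apply: ler_wiXn2l.
  have e3 := ler_wpM2l D0 (h 3 isT); have e2 := ler_wpM2l C0 (h 2 isT).
  have t1 : `|f1 b * y| <= C * `|y| by rewrite normrM ler_wpM2r.
  have t2 : `|f2 b * y ^+ 2| <= C * `|y| ^+ 2.
    by rewrite normrM normrX ler_wpM2r// exprn_ge0.
  have t3 := hD b y y1; have y0 : 0 <= C * `|y| by rewrite mulr_ge0.
  by rewrite mulrDl; lra.
apply: le_trans (ler_normB _ _) _.
have := f_le (b + y); have := f_le b.
have : C <= C * `|y| by rewrite ler_peMr.
have : 0 <= D * `|y| by rewrite mulr_ge0.
by rewrite mulrDl; lra.
Qed.

End taylor.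

Section positive_part_powers.
Context {R : realType}.
Implicit Types x y : R.

Definition pos x : R := Num.max 0 x.

Lemma pos_ge0 x : 0 <= pos x. Proof. by rewrite le_max lexx. Qed.
Lemma pos_id x : 0 <= x -> pos x = x. Proof. exact: max_r. Qed.
Lemma pos_eq0 x : x <= 0 -> pos x = 0. Proof. exact: max_l. Qed.

Lemma pos_cube_taylor x y :
  `|pos (x + y) ^+ 3 - pos x ^+ 3 - 3 * pos x ^+ 2 * y - 3 * pos x * y ^+ 2| <= `|y| ^+ 3.
Proof.
have [x0|/ltW x0] := leP 0 x; have [xy|/ltW xy] := leP 0 (x + y).
- rewrite !pos_id// -normrX le_eqVlt; apply/orP; left; apply/eqP; congr `|_|; ring.
- rewrite (pos_id x0) (pos_eq0 xy) -normrX.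
  have -> : 0 ^+ 3 - x ^+ 3 - 3 * x ^+ 2 * y - 3 * x * y ^+ 2 = y ^+ 3 - (x + y) ^+ 3 by ring.
  have y0 : y <= 0 by lra.
  have a1 : (x + y) ^+ 3 <= 0.
    by rewrite exprS mulr_le0_ge0// sqr_ge0.
  have a2 : y ^+ 3 <= (x + y) ^+ 3.
    have -> : (x + y) ^+ 3 = y ^+ 3 + x * (x ^+ 2 + 3 * x * y + 3 * y ^+ 2) by ring.
    by rewrite lerDl mulr_ge0//; nra.
  rewrite (ler0_norm (le_trans a2 a1)) ler_norml; lra.
- rewrite (pos_eq0 x0) (pos_id xy) -normrX.
  rewrite !(expr0n, mulr0, mul0r, subr0) /=.
  rewrite normrX normrX; apply: lerXn2r; rewrite ?nnegrE//.
  rewrite !ger0_norm; lra.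
- by rewrite (pos_eq0 x0) (pos_eq0 xy) !(expr0n, mulr0, mul0r, subr0)/= normr0 exprn_ge0.
Qed.

Lemma pos_sqr_taylor x y : `|pos (x + y) ^+ 2 - pos x ^+ 2 - 2 * pos x * y| <= y ^+ 2.
Proof.
have [x0|/ltW x0] := leP 0 x; have [xy|/ltW xy] := leP 0 (x + y).
- rewrite !pos_id// ger0_norm; last by nra.
  by rewrite le_eqVlt; apply/orP; left; apply/eqP; ring.
- by rewrite (pos_id x0) (pos_eq0 xy) ler_norml; apply/andP; split; nra.
- by rewrite (pos_eq0 x0) (pos_id xy) ler_norml; apply/andP; split; nra.
- by rewrite (pos_eq0 x0) (pos_eq0 xy) ler_norml; apply/andP; split; nra.
Qed.

Lemma continuous_pos : continuous pos.
Proof.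
move=> x; apply: (@continuous_max _ _ (cst 0) idfun x); first exact: cvg_cst.
exact: cvg_id.
Qed.

Lemma is_derive_of_quadratic (f : R -> R) (x l C : R) :
  (forall y, `|f (x + y) - f x - l * y| <= C * y ^+ 2) -> is_derive x (1 : R) f l.
Proof.
move=> hf.
have C0 : 0 <= C.
  by have := le_trans (normr_ge0 _) (hf 1); rewrite expr1n mulr1.
have D : h^-1 *: (f (h *: (1 : R) + x) - f x) @[h --> 0^'] --> l.
  apply/cvgrPdist_le => e e0.
  near=> h.
  have h0 : h != 0 by near: h; exact: nbhs_dnbhs_neq.
  have hC : C * `|h| <= e.
    rewrite (@le_trans _ _ ((C + 1) * `|h|))//; first by rewrite ler_wpM2r// lerDl.
    rewrite mulrC -ler_pdivlMr ?ltr_wpDl//.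
    near: h; apply: nbhs_dnbhs; apply/nbhs_ballP.
    exists (e / (C + 1)) => /=; first by rewrite divr_gt0// ltr_wpDl.
    by move=> h; rewrite /ball/= sub0r normrN => /ltW.
  rewrite /GRing.scale /= mulr1 [h + x]addrC.
  have -> : l - h^-1 * (f (x + h) - f x) = - (h^-1 * (f (x + h) - f x - l * h)) by field.
  rewrite normrN normrM normfV ler_pdivrMl ?normr_gt0//.
  apply: le_trans (hf h) _.
  have -> : h ^+ 2 = `|h| * `|h| by rewrite -expr2 real_normK ?num_real.
  by rewrite mulrA mulrC ler_wpM2l.
apply: DeriveDef; first by apply/cvg_ex; exists l.
exact: cvg_lim.
Unshelve. all: by end_near. Qed.

End positive_part_powers.

(** * A smoothed absolute value *)

Section smoothed_abs.
Context {R : realType}.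
Variables (a e : R).
Hypothesis e0 : 0 < e.

(** The second difference quotient, at scale [e], of [max(0, t)^3 / 3], minus [t]: a
    function of class C^2, equal to [|x - a|] at distance at least [e] from [a]. The
    function [sabs1] is its derivative and [sabs2] half of its second derivative, a tent
    of mass [1]. *)
Definition sabs (x : R) : R :=
  (pos (x - a + e) ^+ 3 - 2 * pos (x - a) ^+ 3 + pos (x - a - e) ^+ 3) / (3 * e ^+ 2)
  - (x - a).

Definition sabs1 (x : R) : R :=
  (pos (x - a + e) ^+ 2 - 2 * pos (x - a) ^+ 2 + pos (x - a - e) ^+ 2) / e ^+ 2 - 1.

Definition sabs2 (x : R) : R :=
  (pos (x - a + e) - 2 * pos (x - a) + pos (x - a - e)) / e ^+ 2.

Let e_neq0 : e != 0. Proof. by rewrite gt_eqF. Qed.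

Lemma sabsE x : sabs x = `|x - a| + pos (e - `|x - a|) ^+ 3 / (3 * e ^+ 2).
Proof.
rewrite /sabs; move: (x - a) => t; have [t0|t0] := ger0P t.
  have te0 : 0 <= t + e by have := e0; lra.
  rewrite (pos_id te0) (pos_id t0).
  have [te|/ltW te] := leP t e.
    rewrite (@pos_eq0 _ (t - e)) ?subr_le0// (@pos_id _ (e - t)) ?subr_ge0//.
    by field.
  rewrite (@pos_id _ (t - e)) ?subr_ge0// (@pos_eq0 _ (e - t)) ?subr_le0//.
  by field.
rewrite (pos_eq0 (ltW t0)) (@pos_eq0 _ (t - e)); last by have := e0; lra.
rewrite opprK; have [te|/ltW te] := leP 0 (t + e).
  by rewrite (pos_id te) (@pos_id _ (e + t)) 1?addrC//; field.
by rewrite (pos_eq0 te) (@pos_eq0 _ (e + t)) 1?addrC//; field.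
Qed.

Lemma sabs1_sqr_eq1 x : e <= `|x - a| -> sabs1 x ^+ 2 = 1.
Proof.
rewrite /sabs1; move: (x - a) => t; have [t0|t0] := ger0P t => te.
  have te0 : 0 <= t + e by have := e0; lra.
  rewrite (pos_id te0) (pos_id t0).
  by rewrite (@pos_id _ (t - e)) ?subr_ge0//; field.
rewrite (pos_eq0 (ltW t0)) (@pos_eq0 _ (t - e)); last by have := e0; lra.
rewrite (@pos_eq0 _ (t + e)); last by have := e0; lra.
by field.
Qed.

Lemma sabs1_le x : `|sabs1 x| <= 1.
Proof.
rewrite /sabs1; move: (x - a) => t.
suff /andP[h1 h2] : 0 <= pos (t + e) ^+ 2 - 2 * pos t ^+ 2 + pos (t - e) ^+ 2 <= 2 * e ^+ 2.
  have e2 : 0 < e ^+ 2 by rewrite exprn_gt0.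
  rewrite ler_norml lerBrDr lerBlDr addNr divr_ge0 ?(ltW e2)//=.
  by rewrite ler_pdivrMr// -[1 + 1]/(2 : R).
have [t0|/ltW t0] := leP 0 t.
  have te0 : 0 <= t + e by have := e0; lra.
  rewrite (pos_id te0) (pos_id t0).
  have [te|/ltW te] := leP t e.
    have te1 : t - e <= 0 by rewrite subr_le0.
    by rewrite (pos_eq0 te1); have := e0; move=> ?; apply/andP; split; nra.
  have te1 : 0 <= t - e by rewrite subr_ge0.
  by rewrite (pos_id te1); have := e0; move=> ?; apply/andP; split; nra.
have te1 : t - e <= 0 by have := e0; lra.
rewrite (pos_eq0 t0) (pos_eq0 te1).
have [te|/ltW te] := leP 0 (t + e).
  by rewrite (pos_id te); have := e0; move=> ?; apply/andP; split; nra.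
by rewrite (pos_eq0 te); have := e0; move=> ?; apply/andP; split; nra.
Qed.

Lemma sabs2E x : sabs2 x = pos (e - `|x - a|) / e ^+ 2.
Proof.
rewrite /sabs2; move: (x - a) => t; congr (_ / _).
have [t0|t0] := ger0P t.
  have te0 : 0 <= t + e by have := e0; lra.
  rewrite (pos_id te0) (pos_id t0).
  have [te|/ltW te] := leP t e.
    by rewrite (@pos_eq0 _ (t - e)) ?subr_le0// (@pos_id _ (e - t)) ?subr_ge0//; ring.
  by rewrite (@pos_id _ (t - e)) ?subr_ge0// (@pos_eq0 _ (e - t)) ?subr_le0//; ring.
rewrite (pos_eq0 (ltW t0)) (@pos_eq0 _ (t - e)); last by have := e0; lra.
by rewrite opprK [e + t]addrC; ring.
Qed.

Lemma sabs2_ge0 x : 0 <= sabs2 x.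
Proof. by rewrite sabs2E divr_ge0 ?pos_ge0// sqr_ge0. Qed.

Lemma sabs2_le x : sabs2 x <= e^-1.
Proof.
rewrite sabs2E ler_pdivrMr ?exprn_gt0//.
have -> : e^-1 * e ^+ 2 = e by field.
rewrite /pos ge_max (ltW e0)/= gerBl; exact: normr_ge0.
Qed.

Lemma sabs2_eq0 x : e <= `|x - a| -> sabs2 x = 0.
Proof. by move=> h; rewrite sabs2E pos_eq0 ?mul0r// subr_le0. Qed.

Lemma sabs_bounds x : `|x - a| <= sabs x <= `|x - a| + e.
Proof.
rewrite sabsE; have e2 : 0 < 3 * e ^+ 2 by rewrite mulr_gt0// exprn_gt0.
rewrite lerDl divr_ge0 ?(ltW e2) ?exprn_ge0 ?pos_ge0//= lerD2l ler_pdivrMr//.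
have p1 : pos (e - `|x - a|) <= e by rewrite /pos ge_max (ltW e0)/= gerBl normr_ge0.
have p2 : pos (e - `|x - a|) ^+ 3 <= e ^+ 3 by rewrite lerXn2r ?nnegrE ?pos_ge0// ltW.
apply: (le_trans p2).
have -> : e * (3 * e ^+ 2) = 3 * e ^+ 3 by ring.
by rewrite ler_peMl ?exprn_ge0 ?ltW// ltr1n.
Qed.

Let continuous_second_difference n : continuous (fun x : R =>
  pos (x - a + e) ^+ n - 2 * pos (x - a) ^+ n + pos (x - a - e) ^+ n).
Proof.
have ca : continuous (fun x : R => x - a).
  by move=> x; apply: cvgB; [exact: cvg_id|exact: cvg_cst].
have cX (l : R -> R) : continuous l -> continuous (fun x => pos (l x) ^+ n).
  move=> cl x; apply: (@continuous_comp _ _ _ (fun x => pos (l x)) (fun z => z ^+ n)).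
    by apply: (@continuous_comp _ _ _ l pos); [exact: cl|exact: continuous_pos].
  exact: exprn_continuous.
have c1 : continuous (fun x : R => pos (x - a + e) ^+ n).
  by apply: (cX (fun x => x - a + e)) => x; apply: cvgD; [exact: ca|exact: cvg_cst].
have c2 : continuous (fun x : R => pos (x - a - e) ^+ n).
  by apply: (cX (fun x => x - a - e)) => x; apply: cvgB; [exact: ca|exact: cvg_cst].
move=> x; apply: cvgD; last exact: c2.
apply: cvgB; first exact: c1.
by apply: cvgM; [exact: cvg_cst|exact: (cX _ ca)].
Qed.

Lemma continuous_sabs : continuous sabs.
Proof.
move=> x; apply: cvgB; first by apply: cvgM; [exact: continuous_second_difference|exact: cvg_cst].
by apply: cvgB; [exact: cvg_id|exact: cvg_cst].
Qed.

Lemma continuous_sabs1 : continuous sabs1.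
Proof.
move=> x; apply: cvgB; last exact: cvg_cst.
by apply: cvgM; [exact: continuous_second_difference|exact: cvg_cst].
Qed.

Lemma continuous_sabs2 : continuous sabs2.
Proof.
move=> x; apply: cvgM; last exact: cvg_cst.
exact: (@continuous_second_difference 1).
Qed.

Lemma sabs_taylor x y :
  `|sabs (x + y) - sabs x - sabs1 x * y - sabs2 x * y ^+ 2| <=
    4 / (3 * e ^+ 2) * `|y| ^+ 3.
Proof.
pose r t := pos (t + y) ^+ 3 - pos t ^+ 3 - 3 * pos t ^+ 2 * y - 3 * pos t * y ^+ 2.
have -> : sabs (x + y) - sabs x - sabs1 x * y - sabs2 x * y ^+ 2 =
    (r (x - a + e) - 2 * r (x - a) + r (x - a - e)) / (3 * e ^+ 2).
  rewrite /sabs /sabs1 /sabs2 /r.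
  have -> : x + y - a + e = x - a + e + y by ring.
  have -> : x + y - a - e = x - a - e + y by ring.
  have -> : x + y - a = x - a + y by ring.
  by field.
have e2 : 0 < 3 * e ^+ 2 by rewrite mulr_gt0// exprn_gt0.
rewrite normrM normfV (gtr0_norm e2) mulrAC ler_wpM2r ?invr_ge0 ?(ltW e2)//.
have hr t := pos_cube_taylor t y.
have h1 := hr (x - a + e); have h2 := hr (x - a); have h3 := hr (x - a - e).
apply: le_trans (ler_normD _ _) _; apply: le_trans (lerD (ler_normB _ _) (lexx _)) _.
rewrite normrM ger0_norm// -/(r (x - a + e)) -/(r (x - a)) -/(r (x - a - e)) in h1 h2 h3 *.
lra.
Qed.

Lemma sabs1_taylor x y : `|sabs1 (x + y) - sabs1 x - 2 * sabs2 x * y| <=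
  4 / e ^+ 2 * y ^+ 2.
Proof.
pose r t := pos (t + y) ^+ 2 - pos t ^+ 2 - 2 * pos t * y.
have -> : sabs1 (x + y) - sabs1 x - 2 * sabs2 x * y =
    (r (x - a + e) - 2 * r (x - a) + r (x - a - e)) / e ^+ 2.
  rewrite /sabs1 /sabs2 /r.
  have -> : x + y - a + e = x - a + e + y by ring.
  have -> : x + y - a - e = x - a - e + y by ring.
  have -> : x + y - a = x - a + y by ring.
  by field.
have e2 : 0 < e ^+ 2 by rewrite exprn_gt0.
rewrite normrM normfV (gtr0_norm e2) mulrAC ler_wpM2r ?invr_ge0 ?(ltW e2)//.
have hr t := pos_sqr_taylor t y.
have h1 := hr (x - a + e); have h2 := hr (x - a); have h3 := hr (x - a - e).
apply: le_trans (ler_normD _ _) _; apply: le_trans (lerD (ler_normB _ _) (lexx _)) _.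
rewrite normrM ger0_norm// -/(r (x - a + e)) -/(r (x - a)) -/(r (x - a - e)) in h1 h2 h3 *.
lra.
Qed.

(** A primitive of [sabs2] is [sabs1 / 2], and [sabs1] goes from [- 1] to [1]. *)
Lemma integral_sabs2 :
  (\int[lebesgue_measure]_(x in `[(a - e)%R, (a + e)%R]) (sabs2 x)%:E = 1%:E)%E.
Proof.
have dF x : is_derive x (1 : R) (fun z => sabs1 z / 2) (sabs2 x).
  apply: (@is_derive_of_quadratic _ _ _ _ (2 / e ^+ 2)) => y.
  have -> : sabs1 (x + y) / 2 - sabs1 x / 2 - sabs2 x * y =
    (sabs1 (x + y) - sabs1 x - 2 * sabs2 x * y) / 2 by field.
  rewrite normrM normfV (@ger0_norm _ (2 : R))// ler_pdivrMr//.
  by apply: le_trans (sabs1_taylor x y) _; rewrite le_eqVlt; apply/orP; left; apply/eqP; field.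
have cF : continuous (fun z => sabs1 z / 2).
  by move=> x; apply: cvgM; [exact: continuous_sabs1|exact: cvg_cst].
rewrite (@continuous_FTC2 _ sabs2 (fun z => sabs1 z / 2)).
- rewrite -EFinB; congr EFin; rewrite /sabs1.
  have -> : a + e - a = e by ring.
  have -> : a - e - a = - e by ring.
  rewrite addNr subrr (@pos_id _ (e + e)) ?addr_ge0 ?(ltW e0)// (pos_id (ltW e0)).
  rewrite (pos_eq0 (lexx 0)) (@pos_eq0 _ (- e)) ?oppr_le0 ?(ltW e0)//.
  rewrite (@pos_eq0 _ (- e - e)); last by have := e0; lra.
  by field.
- by have := e0; lra.
- exact: continuous_subspaceT continuous_sabs2.
- split.
  + by move=> x _; exact: (@ex_derive _ _ _ _ _ _ _ (dF x)).
  + by apply: cvg_at_right_filter; exact: cF.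
  + by apply: cvg_at_left_filter; exact: cF.
- by move=> x _; rewrite derive1E (@derive_val _ _ _ _ _ _ _ (dF x)).
Qed.

End smoothed_abs.

(** * The profile and its source *)

Section profile.
Context {R : realType}.
Variables (a e c : R).
Hypothesis e0 : 0 < e.
Hypothesis c0 : 0 < c.

Let phi := sabs a e.
Let phi1 := sabs1 a e.
Let phi2 := sabs2 a e.

Definition inv_sabs x : R := (phi x + c)^-1.

(** The smoothed version of [3/2 * (|x - a| + c)^-2]. In the next definitions,
    [profile1] is its derivative and [profile2] half of its second derivative. *)
Definition profile x : R := 3 / 2 * inv_sabs x ^+ 2.
Definition profile1 x : R := - 3 * phi1 x * inv_sabs x ^+ 3.
Definition profile2 x : R :=
  9 / 2 * phi1 x ^+ 2 * inv_sabs x ^+ 4 - 3 * phi2 x * inv_sabs x ^+ 3.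
(** This expression of [psi (profile x) - profile2 x] shows its sign and its support:
    [|sabs1| <= 1], with equality at distance at least [e] from [a], where [sabs2]
    vanishes. *)
Definition source x : R :=
  9 / 2 * (1 - phi1 x ^+ 2) * inv_sabs x ^+ 4 + 3 * phi2 x * inv_sabs x ^+ 3.

Let phi_ge0 x : 0 <= phi x.
Proof. by have /andP[h _] := sabs_bounds a e0 x; exact: le_trans h. Qed.

Let den_gt0 x : 0 < phi x + c. Proof. by rewrite ltr_wpDl. Qed.

Lemma inv_sabs_gt0 x : 0 < inv_sabs x. Proof. by rewrite invr_gt0. Qed.

Lemma inv_sabs_le x : inv_sabs x <= c^-1.
Proof. by rewrite lef_pV2 ?posrE// lerDr. Qed.

Let inv_sabsX_le n x : `|inv_sabs x ^+ n| <= c^-1 ^+ n.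
Proof.
have s0 := inv_sabs_gt0 x; rewrite ger0_norm ?exprn_ge0 ?(ltW s0)//.
by rewrite lerXn2r ?nnegrE ?inv_sabs_le ?(ltW s0)// invr_ge0 ltW.
Qed.

Lemma sourceE x : source x = psi (profile x) - profile2 x.
Proof. by rewrite /source /psi /profile /profile2; field. Qed.

Let phi1_sqr_le x : phi1 x ^+ 2 <= 1.
Proof.
by rewrite -real_normK ?num_real// exprn_ile1// sabs1_le.
Qed.

Lemma source_ge0 x : 0 <= source x.
Proof.
have s0 := ltW (inv_sabs_gt0 x).
rewrite addr_ge0// mulr_ge0 ?exprn_ge0// mulr_ge0 ?subr_ge0//.
exact: sabs2_ge0.
Qed.

Lemma source_eq0 x : e <= `|x - a| -> source x = 0.
Proof.
move=> h; rewrite /source /phi1 /phi2 sabs1_sqr_eq1// sabs2_eq0//.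
by rewrite subrr !(mulr0, mul0r) addr0.
Qed.

Let phi2_le x : `|phi2 x| <= e^-1.
Proof. by rewrite ger0_norm ?sabs2_le ?sabs2_ge0. Qed.

(** With [W = inv_sabs (x + y)] and [z = (sabs (x + y) - sabs x) * inv_sabs x], one has
    [inv_sabs x = W * (1 + z)], where [z] is of order [1] in [y]. Expanding [W^2] in
    powers of [z] up to [z^2], with the explicit remainder [- W^2 * (4 z^3 + 3 z^4)],
    leaves only terms of order [3]. *)
Lemma profile_taylor :
  bigO 3 (fun x y => profile (x + y) - profile x - profile1 x * y - profile2 x * y ^+ 2).
Proof.
pose D x y := phi (x + y) - phi x.
pose rho x y := D x y - phi1 x * y - phi2 x * y ^+ 2.
pose s x y := phi2 x * y ^+ 2 + rho x y.
pose z x y := D x y * inv_sabs x.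
have Orho : bigO 3 rho.
  exists (4 / (3 * e ^+ 2)).
    by rewrite divr_ge0// mulr_ge0// sqr_ge0.
  by move=> x y _; exact: sabs_taylor.
have Ow n : bigO 0 (fun x _ => inv_sabs x ^+ n) by apply: bigO_bounded => x _; exact: inv_sabsX_le.
have OW n : bigO 0 (fun x y => inv_sabs (x + y) ^+ n) by apply: bigO_bounded => x y; exact: inv_sabsX_le.
have O1 : bigO 0 (fun x _ => phi1 x) by apply: bigO_bounded => x _; exact: sabs1_le.
have O2 : bigO 0 (fun x _ => phi2 x) by apply: bigO_bounded => x _; exact: phi2_le.
have Os : bigO 2 s.
  apply: bigOD; last exact: bigO_weaken Orho.
  exact: (bigOM O2 bigO_increment_sqr).
have OD : bigO 1 D.
  have -> : D = fun x y => phi1 x * y + s x y.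
    by apply/funext => x; apply/funext => y; rewrite /s /rho; ring.
  apply: bigOD; last exact: bigO_weaken Os.
  exact: (bigOM O1 bigO_increment).
have Oz : bigO 1 z by exact: (bigOM OD (Ow 1%N)).
have -> : (fun x y => profile (x + y) - profile x - profile1 x * y - profile2 x * y ^+ 2) =
  fun x y => (- 3 / 2) * (inv_sabs (x + y) ^+ 2 * (4 * (z x y * (z x y * z x y)) +
      3 * (z x y * (z x y * (z x y * z x y)))))
    + ((- 3) * (inv_sabs x ^+ 3 * rho x y)
    + (9 / 2) * (inv_sabs x ^+ 4 * (2 * (phi1 x * (y * s x y)) + s x y * s x y))).
  apply/funext => x; apply/funext => y.
  have E : inv_sabs x = inv_sabs (x + y) * (1 + z x y).
    rewrite /z /D /inv_sabs; have h1 := den_gt0 x; have h2 := den_gt0 (x + y).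
    by field; rewrite !gt_eqF.
  rewrite /profile /profile1 /profile2 /s /rho.
  set W := inv_sabs (x + y) in E *.
  have -> : 3 / 2 * W ^+ 2 - 3 / 2 * inv_sabs x ^+ 2 =
    (- 3 / 2) * (W ^+ 2 * (4 * (z x y * (z x y * z x y)) +
      3 * (z x y * (z x y * (z x y * z x y))))) - 3 * D x y * inv_sabs x ^+ 3
      + 9 / 2 * D x y ^+ 2 * inv_sabs x ^+ 4.
    have -> : 3 * D x y * inv_sabs x ^+ 3 = 3 * z x y * inv_sabs x ^+ 2 by rewrite /z; ring.
    have -> : 9 / 2 * D x y ^+ 2 * inv_sabs x ^+ 4 = 9 / 2 * z x y ^+ 2 * inv_sabs x ^+ 2.
      by rewrite /z; ring.
    by rewrite E; field.
  by field.
have C k : bigO 0 (fun _ _ : R => k) := bigO_cst k.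
have Ozz := bigOM Oz Oz; have Ozzz := bigOM Oz Ozz; have Ozzzz := bigOM Oz Ozzz.
apply: bigOD.
  apply: (bigOM (C _)); apply: (bigOM (OW 2%N)); apply: bigOD.
    exact: (bigOM (C 4) Ozzz).
  exact: (@bigO_weaken _ 4 3 _ isT (bigOM (C 3) Ozzzz)).
apply: bigOD.
  exact: (bigOM (C _) (bigOM (Ow 3%N) Orho)).
apply: (bigOM (C _)); apply: (bigOM (Ow 4%N)); apply: bigOD.
  exact: (bigOM (C 2) (bigOM O1 (bigOM bigO_increment Os))).
exact: (@bigO_weaken _ 4 3 _ isT (bigOM Os Os)).
Qed.

Lemma continuous_inv_sabs : continuous inv_sabs.
Proof.
move=> x; apply: cvgV; first by rewrite gt_eqF.
by apply: cvgD; [exact: continuous_sabs|exact: cvg_cst].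
Qed.

Lemma continuous_source : continuous source.
Proof.
have cX (f : R -> R) n : continuous f -> continuous (fun x => f x ^+ n).
  by move=> cf x; apply: (@continuous_comp _ _ _ f (fun z => z ^+ n)); [exact: cf|exact: exprn_continuous].
move=> x; apply: cvgD; apply: cvgM; try exact: (cX _ _ continuous_inv_sabs).
  apply: cvgM; first exact: cvg_cst.
  by apply: cvgB; [exact: cvg_cst|exact: (cX _ _ (@continuous_sabs1 _ a e))].
by apply: cvgM; [exact: cvg_cst|exact: continuous_sabs2].
Qed.

Lemma measurable_profile : measurable_fun setT profile.
Proof.
apply: measurable_funM => //; apply: measurable_funX.
exact: continuous_measurable_fun continuous_inv_sabs.
Qed.

Let inv_sabsX_ge0 n x : 0 <= inv_sabs x ^+ n.
Proof. by rewrite exprn_ge0// ltW// inv_sabs_gt0. Qed.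

Lemma profile_ge0 x : 0 <= profile x.
Proof. by rewrite mulr_ge0. Qed.

Lemma source_le x : source x <= 9 / 2 * c^-1 ^+ 4 + 3 * e^-1 * c^-1 ^+ 3.
Proof.
have s4 := inv_sabsX_le 4 x; have s3 := inv_sabsX_le 3 x.
rewrite (ger0_norm (inv_sabsX_ge0 4 x)) in s4; rewrite (ger0_norm (inv_sabsX_ge0 3 x)) in s3.
apply: lerD; apply: ler_pM => //.
- by rewrite mulr_ge0// subr_ge0.
- by rewrite ler_piMr// gerBl sqr_ge0.
- by rewrite mulr_ge0// sabs2_ge0.
- by rewrite ler_wpM2l// sabs2_le.
Qed.

Definition profile_bound : R :=
  3 / 2 * c^-1 ^+ 2 + 3 * c^-1 ^+ 3 + (9 / 2 * c^-1 ^+ 4 + 3 * e^-1 * c^-1 ^+ 3).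

Let cX_ge0 n : 0 <= c^-1 ^+ n. Proof. by rewrite exprn_ge0// invr_ge0 ltW. Qed.

Let p3_ge0 : 0 <= 3 * c^-1 ^+ 3. Proof. exact: mulr_ge0 (cX_ge0 3). Qed.
Let p4_ge0 : 0 <= 9 / 2 * c^-1 ^+ 4. Proof. exact: mulr_ge0 (cX_ge0 4). Qed.
Let p2_ge0 : 0 <= 3 / 2 * c^-1 ^+ 2. Proof. exact: mulr_ge0 (cX_ge0 2). Qed.
Let q3_ge0 : 0 <= 3 * e^-1 * c^-1 ^+ 3.
Proof. by apply: mulr_ge0 (cX_ge0 3); rewrite mulr_ge0// invr_ge0 ltW. Qed.

Lemma profile_le x : `|profile x| <= profile_bound.
Proof.
rewrite ger0_norm ?profile_ge0// /profile_bound -addrA.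
have s2 := inv_sabsX_le 2 x; rewrite (ger0_norm (inv_sabsX_ge0 2 x)) in s2.
apply: ler_wpDr; last by rewrite ler_wpM2l.
by rewrite !addr_ge0 ?p3_ge0 ?p4_ge0 ?q3_ge0.
Qed.

Lemma profile1_le x : `|profile1 x| <= profile_bound.
Proof.
rewrite /profile_bound [X in X + _]addrC -addrA; apply: ler_wpDr.
  by rewrite !addr_ge0 ?p2_ge0 ?p4_ge0 ?q3_ge0.
rewrite /profile1 normrM [`|_ * phi1 x|]normrM normrN (@ger0_norm _ 3)// -mulrA ler_wpM2l//.
rewrite -[leRHS]mul1r.
exact: (ler_pM (normr_ge0 _) (normr_ge0 _) (sabs1_le a e0 x) (inv_sabsX_le 3 x)).
Qed.

Lemma profile2_le x : `|profile2 x| <= profile_bound.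
Proof.
rewrite /profile_bound addrC; apply: ler_wpDr; first by rewrite addr_ge0 ?p2_ge0 ?p3_ge0.
apply: le_trans (ler_normB _ _) _; apply: lerD; rewrite normrM; apply: ler_pM => //; try exact: inv_sabsX_le.
  rewrite normrM [leRHS](_ : _ = 9 / 2 * 1); last by rewrite mulr1.
  by rewrite ger0_norm// ler_wpM2l// ger0_norm// sqr_ge0.
by rewrite normrM ger0_norm// ler_wpM2l.
Qed.

End profile.

(** * The sources concentrate to a Dirac mass *)

Section source_mass.
Context {R : realType}.
Notation leb := (@lebesgue_measure R).
Variables (a c : R) (L : R -> R).
Hypothesis c0 : 0 < c.
Hypothesis cL : continuous L.

Section fixed_width.
Variable e : R.
Hypothesis e0 : 0 < e.
Notation src := (source a e c).

Let D : set (measurableTypeR R) := `[a - e, a + e]%classic.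

Let mD : measurable D. Proof. exact: measurable_itv. Qed.

Let DP x : D x <-> `|x - a| <= e.
Proof. by rewrite /D /= in_itv/= ler_distl. Qed.

Let lebD : leb D = (2 * e)%:E.
Proof.
rewrite /D lebesgue_measure_itv/= lte_fin ifT; last by have := e0; lra.
by rewrite -EFinB; congr EFin; ring.
Qed.

Let integrable_continuous (f : R -> R) : continuous f -> leb.-integrable D (EFin \o f).
Proof.
move=> cf; apply: continuous_compact_integrable; first exact: segment_compact.
exact: continuous_subspaceT.
Qed.

Lemma integral_source : (\int[leb]_x (src x * L x)%:E =
  (\int[leb]_(x in D) (src x * L x))%:E)%E.
Proof.
rewrite fineK; last first.
  apply: integrable_fin_num => //; apply: integrable_continuous => x.
  by apply: cvgM; [exact: continuous_source|exact: cL].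
rewrite [RHS]integral_mkcond; apply: eq_integral => x _; rewrite patchE.
case: ifPn => // /negP xD; rewrite source_eq0 ?mul0r// leNgt; apply/negP => h.
by apply: xD; rewrite inE; apply/DP; exact: ltW.
Qed.

(** Near [a] the first term of [source] is bounded, hence contributes [O(e)]. In the
    second one, [inv_sabs] is within [2 e c^-2] of [c^-1], the local time is within
    [eta] of its value at [a], and [sabs2] has mass [1]. *)
Lemma source_mass_estimate (eta : R) :
  (forall x, `|x - a| <= e -> `|L x - L a| <= eta) ->
  `|\int[leb]_(x in D) (src x * L x) - 3 * c^-1 ^+ 3 * L a| <=
    e * (27 * c^-1 ^+ 4 * `|L a| + 9 * c^-1 ^+ 4 * eta) + 3 * c^-1 ^+ 3 * eta.
Proof.
move=> hL; set k := c^-1; have k0 : 0 < k by rewrite invr_gt0.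
have k0' := ltW k0.
have eta0 : 0 <= eta.
  by have := hL a; rewrite !subrr !normr0; apply; exact: ltW.
pose p2 := sabs2 a e.
have p2_0 x : 0 <= p2 x by exact: sabs2_ge0.
have cp2 : continuous p2 by exact: continuous_sabs2.
have ip2 := integrable_continuous cp2.
have m1 : \int[leb]_(x in D) p2 x = 1.
  by rewrite /Rintegral; have := integral_sabs2 a e0; rewrite /D => ->.
pose A := 9 / 2 * k ^+ 4 * (`|L a| + eta).
pose B := k ^+ 3 * eta + `|L a| * (6 * k ^+ 4 * e).
have A0 : 0 <= A by rewrite !mulr_ge0 ?exprn_ge0 ?addr_ge0.
have B0 : 0 <= B by rewrite addr_ge0 ?mulr_ge0 ?exprn_ge0 ?(ltW e0).
have pt x : D x -> `|src x * L x - 3 * k ^+ 3 * L a * p2 x| <= A + 3 * B * p2 x.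
  move=> /DP xa; have hLx := hL x xa.
  set w := inv_sabs a e c x.
  have w0 : 0 < w by exact: inv_sabs_gt0.
  have wk : w <= k by exact: inv_sabs_le.
  have p1 : sabs1 a e x ^+ 2 <= 1.
    by rewrite -real_normK ?num_real// exprn_ile1// sabs1_le.
  have p1' : 0 <= sabs1 a e x ^+ 2 by exact: sqr_ge0.
  have kw : k - w <= 2 * e * k ^+ 2.
    have /andP[f1 f2] := sabs_bounds a e0 x.
    have fe : sabs a e x <= 2 * e by lra.
    have f0 : 0 <= sabs a e x by exact: le_trans f1.
    have -> : k - w = sabs a e x * (w * k).
      by rewrite /k /w /inv_sabs; field; rewrite !gt_eqF// ltr_wpDl.
    apply: ler_pM => //; first by rewrite mulr_ge0// ltW.
    by rewrite expr2 ler_wpM2r.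
  have w3 : `|k ^+ 3 - w ^+ 3| <= 6 * k ^+ 4 * e.
    rewrite ger0_norm; last by rewrite subr_ge0 lerXn2r ?nnegrE// ltW.
    have -> : k ^+ 3 - w ^+ 3 = (k - w) * (k ^+ 2 + k * w + w ^+ 2) by ring.
    have -> : 6 * k ^+ 4 * e = (2 * e * k ^+ 2) * (3 * k ^+ 2) by ring.
    apply: ler_pM => //; rewrite ?subr_ge0//.
      by rewrite !addr_ge0 ?mulr_ge0 ?sqr_ge0// ltW.
    by have := ltW w0; nra.
  have -> : src x * L x - 3 * k ^+ 3 * L a * p2 x =
      9 / 2 * (1 - sabs1 a e x ^+ 2) * w ^+ 4 * L x +
      3 * p2 x * (w ^+ 3 * (L x - L a) - L a * (k ^+ 3 - w ^+ 3)).
    by rewrite /source -/w /p2; ring.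
  apply: le_trans (ler_normD _ _) _; apply: lerD.
    rewrite normrM /A; apply: ler_pM => //.
      rewrite ger0_norm; last by rewrite !mulr_ge0 ?subr_ge0 ?exprn_ge0 ?(ltW w0).
      apply: ler_pM => //; rewrite ?mulr_ge0 ?subr_ge0 ?exprn_ge0 ?(ltW w0)//.
        by rewrite ler_piMr// gerBl.
      by rewrite lerXn2r ?nnegrE// ltW.
    rewrite -[L x](subrK (L a)) addrC; apply: le_trans (ler_normD _ _) _.
    by rewrite lerD2l.
  rewrite normrM (ger0_norm (mulr_ge0 _ _))// mulrAC ler_wpM2r//.
  rewrite ler_wpM2l//; apply: le_trans (ler_normB _ _) _; apply: lerD.
    rewrite normrM ger0_norm ?exprn_ge0 ?(ltW w0)//; apply: ler_pM => //.
      by rewrite exprn_ge0// ltW.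
    by rewrite lerXn2r ?nnegrE// ltW.
  by rewrite normrM ler_wpM2l.
have iS : leb.-integrable D (EFin \o (fun x => src x * L x)).
  by apply: integrable_continuous => x; apply: cvgM; [exact: continuous_source|exact: cL].
have iP q : leb.-integrable D (EFin \o (fun x => q * p2 x)).
  by apply: integrable_continuous => x; apply: cvgM; [exact: cvg_cst|exact: cp2].
have iA : leb.-integrable D (EFin \o cst A).
  by apply: integrable_continuous => x; exact: cvg_cst.
have iD : leb.-integrable D (EFin \o (fun x => src x * L x - 3 * k ^+ 3 * L a * p2 x)).
  exact: (integrableB mD iS (iP _)).
have iE : leb.-integrable D (EFin \o (fun x => A + 3 * B * p2 x)).
  exact: (integrableD mD iA (iP _)).
have E : \int[leb]_(x in D) (src x * L x - 3 * k ^+ 3 * L a * p2 x) =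
    \int[leb]_(x in D) (src x * L x) - 3 * k ^+ 3 * L a.
  by rewrite (RintegralB mD iS (iP _)) (RintegralZl _ mD ip2) m1 mulr1.
have F : \int[leb]_(x in D) (A + 3 * B * p2 x) = 2 * e * A + 3 * B.
  rewrite (RintegralD mD iA (iP _)) (RintegralZl _ mD ip2) m1 mulr1.
  by rewrite Rintegral_cst// [X in fine X]lebD /= [A * _]mulrC.
rewrite -E; apply: le_trans (le_normr_Rintegral mD iD) _.
apply: (@le_trans _ _ (\int[leb]_(x in D) (A + 3 * B * p2 x))).
  by apply: le_Rintegral => //; exact: integrable_norm iD.
rewrite F le_eqVlt; apply/orP; left; apply/eqP; by rewrite /A /B; field.
Qed.

End fixed_width.

Lemma cvg_source_mass :
  \int[leb]_(x in `[(a - n.+1%:R^-1)%R, (a + n.+1%:R^-1)%R]) (source a n.+1%:R^-1 c x * L x)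
  @[n --> \oo] --> 3 * c^-1 ^+ 3 * L a.
Proof.
pose A := 27 * c^-1 ^+ 4 * `|L a| + 9 * c^-1 ^+ 4.
pose B := 3 * c^-1 ^+ 3.
have k0 n : 0 <= c^-1 ^+ n by rewrite exprn_ge0// invr_ge0 ltW.
have k4 : 0 <= 9 * c^-1 ^+ 4 by exact: mulr_ge0 (k0 4%N).
have A0 : 0 <= A.
  by apply: addr_ge0 => //; apply: mulr_ge0 => //; exact: mulr_ge0 (k0 4%N).
have B0 : 0 <= B by exact: mulr_ge0 (k0 3%N).
apply/cvgrPdist_le => d d0.
pose eta := Num.min 1 (d / (2 * (B + 1))).
have eta0 : 0 < eta by rewrite lt_min ltr01/= divr_gt0// mulr_gt0// ltr_wpDl.
have eta1 : eta <= 1 by rewrite ge_min lexx.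
have etaB : B * eta <= d / 2.
  apply: (@le_trans _ _ ((B + 1) * (d / (2 * (B + 1))))).
    apply: ler_pM => //; [exact: ltW|by rewrite lerDl|by rewrite ge_min lexx orbT].
  by rewrite le_eqVlt; apply/orP; left; apply/eqP; field; rewrite gt_eqF// ltr_wpDl.
have /cvgrPdist_le/(_ eta eta0) := @cL a.
move=> /nbhs_ballP[r /= r0 hr].
have small : (fun n : nat => n.+1%:R^-1 : R) @ \oo --> (0 : R) by exact: cvg_harmonic.
have /cvgrPdist_lt/(_ r r0) near_r := small.
have dA : 0 < d / (2 * (A + 1)) by rewrite divr_gt0// mulr_gt0// ltr_wpDl.
have /cvgrPdist_le/(_ _ dA) near_d := small.
near=> n.
have e0 : 0 < n.+1%:R^-1 :> R by rewrite invr_gt0 ltr0n.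
have er : n.+1%:R^-1 < r.
  by rewrite -[ltLHS]ger0_norm// -[X in `|X|]subr0 distrC; near: n; exact: near_r.
have ed : n.+1%:R^-1 <= d / (2 * (A + 1)).
  by rewrite -[leLHS]ger0_norm// -[X in `|X|]subr0 distrC; near: n; exact: near_d.
have hL x : `|x - a| <= n.+1%:R^-1 -> `|L x - L a| <= eta.
  move=> xa; rewrite distrC; apply: hr; rewrite /ball/= distrC.
  exact: le_lt_trans er.
rewrite distrC; apply: le_trans (source_mass_estimate e0 hL) _.
move: e0 ed; move: (n.+1%:R^-1) => e e0 ed.
have eA : e * A <= d / 2.
  apply: (@le_trans _ _ (d / (2 * (A + 1)) * (A + 1))).
    by apply: ler_pM => //; [exact: ltW|by rewrite lerDl].
  by rewrite le_eqVlt; apply/orP; left; apply/eqP; field; rewrite gt_eqF// ltr_wpDl.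
have : e * (27 * c^-1 ^+ 4 * `|L a| + 9 * c^-1 ^+ 4 * eta) <= e * A.
  rewrite ler_wpM2l ?(ltW e0)// /A lerD2l ler_piMr//.
rewrite -/B; lra.
Unshelve. all: by end_near. Qed.

End source_mass.

(** * Laplace transforms of local times *)

Lemma expRN_norm_le1 (R : realType) (x : R) : 0 <= x -> `|expR (- x)| <= 1.
Proof. by move=> x0; rewrite ger0_norm// -expR0 ler_expR oppr_le0. Qed.

Lemma cvg_profile (R : realType) (a c x : R) : 0 < c ->
  profile a n.+1%:R^-1 c x @[n --> \oo] --> 3 / 2 * (`|x - a| + c)^-1 ^+ 2.
Proof.
move=> c0.
have ch : (fun n : nat => n.+1%:R^-1 : R) @ \oo --> (0 : R) by exact: cvg_harmonic.
have cs : sabs a n.+1%:R^-1 x @[n --> \oo] --> `|x - a|.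
  apply: (@squeeze_cvgr _ _ _ _ (cst `|x - a|) (fun n => `|x - a| + n.+1%:R^-1)).
  - by apply: nearW => n; apply: sabs_bounds; rewrite invr_gt0.
  - exact: cvg_cst.
  - by rewrite -[X in _ --> X]addr0; apply: cvgD => //; exact: cvg_cst.
have cw : inv_sabs a n.+1%:R^-1 c x @[n --> \oo] --> (`|x - a| + c)^-1.
  apply: cvgV; first by rewrite gt_eqF// ltr_wpDl.
  by apply: (cvgD cs); exact: cvg_cst.
apply: cvgM; first exact: cvg_cst.
by rewrite expr2; apply: (cvgM cw cw).
Qed.

Section local_time.
Context {R : realType} dW (W : measurableType dW).
Variables (PB : R -> probability W R) (B : R -> W -> R).
Hypothesis hB : forall x, is_brownian_motion (PB x) x B.
Context d (T : measurableType d) (P : probability T R).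
Variable X : R -> T -> {finite_measure set R -> \bar R}.
Hypothesis hX : is_super_brownian_motion PB B P X.
Variable L : R -> T -> R.
Hypothesis hL : is_local_time P X L.
Variable alpha : R.
Hypothesis alpha_gt0 : 0 < alpha.
Hypothesis hX0 : {ae P, forall w, forall E : set R, measurable E ->
            X 0%R w E = (alpha%:E * \d_(0%R : R) E)%E}.

Section width.
Variables a e c : R.
Hypotheses (e0 : 0 < e) (c0 : 0 < c).

Lemma occupation_source : exists J : T -> R,
  [/\ measurable_fun setT J, forall w, 0 <= J w,
      {ae P, forall w, J w = \int[@lebesgue_measure R]_(x in `[(a - e)%R, (a + e)%R])
        (source a e c x * L x w)} &
      \int[P]_w expR (- J w) = expR (- (alpha * profile a e c 0))].
Proof.
have [K tK lK] := taylor_global (profile_le a e0 c0)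
  (profile1_le a e0 c0) (profile2_le a e0 c0) (@profile_taylor _ a e c e0 c0).
have ms : measurable_fun setT (source a e c).
  exact: continuous_measurable_fun (@continuous_source _ a e c e0 c0).
have Mg x : 0 <= source a e c x <= 9 / 2 * c^-1 ^+ 4 + 3 * e^-1 * c^-1 ^+ 3.
  by rewrite source_ge0// source_le.
have gE : (fun x => psi (profile a e c x) - profile2 a e c x) = source a e c.
  by apply/funext => x; rewrite sourceE.
apply: (total_occupation hB hX alpha_gt0 hX0 (v := profile a e c) _ lK tK
  (M := profile_bound e c) (Mg := 9 / 2 * c^-1 ^+ 4 + 3 * e^-1 * c^-1 ^+ 3)).
- split; first exact: measurable_profile.
    exact: profile_ge0.
  by move=> x; apply: le_trans (ler_norm _) _; exact: profile_le.
- by rewrite gE; split => // x; rewrite -sourceE; [exact: source_ge0|exact: source_le].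
- by rewrite gE; exact: continuous_source.
- apply: filterS2 (lt_occupation hL) (lt_continuous hL) => w occ cL.
  rewrite -integral_source//.
  rewrite -[RHS]occ//; last by move=> x; exact: source_ge0.
  apply: eq_integral => t _; rewrite gE; apply/esym.
  apply: (@Rintegral_EFin _ _ _ _ _ _ ms) => x.
  by rewrite ger0_norm ?source_ge0//; exact: source_le.
Qed.

End width.

(** The parameter is expressed through the shift [c], with [lambda = 3 c^-3]. Local
    times are not assumed nonnegative; this comes out of the proof, since [lambda * L a]
    is an almost sure limit of nonnegative variables. *)
Lemma local_time_laplace_shift (a c : R) : 0 < c ->
  {ae P, forall w, 0 <= L a w} /\
  \int[P]_w expR (- (3 * c^-1 ^+ 3 * Num.max 0 (L a w))) =
    expR (- (alpha * (3 / 2 * (`|a| + c)^-1 ^+ 2))).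
Proof.
move=> c0; set k := 3 * c^-1 ^+ 3.
have k0 : 0 < k by rewrite mulr_gt0// exprn_gt0// invr_gt0.
have en0 n : 0 < n.+1%:R^-1 :> R by rewrite invr_gt0.
have /choice[J hJ] := fun n : nat => @occupation_source a _ c (en0 n) c0.
have J0 n w : 0 <= J n w by have [_ h _ _] := hJ n.
have JE : {ae P, forall w, forall n, J n w =
    \int[@lebesgue_measure R]_(x in `[(a - n.+1%:R^-1)%R, (a + n.+1%:R^-1)%R])
        (source a n.+1%:R^-1 c x * L x w)}.
  by apply/ae_foralln => n; have [] := hJ n.
have cJ : {ae P, forall w, J n w @[n --> \oo] --> k * L a w}.
  apply: filterS2 JE (lt_continuous hL) => w Jw cL.
  under eq_fun do rewrite Jw.
  exact: cvg_source_mass.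
have L0 : {ae P, forall w, 0 <= L a w}.
  apply: filterS cJ => w cw; rewrite -(pmulr_rge0 _ k0) -(cvg_lim _ cw)//.
  by apply: limr_ge; [apply/cvg_ex; exists (k * L a w)|exact: nearW].
split => //.
have mmax : measurable_fun setT (fun w => Num.max 0 (L a w)).
  by apply: measurable_maxr => //; exact: lt_measurable hL _.
have lhs : \int[P]_w expR (- J n w) @[n --> \oo] -->
    \int[P]_w expR (- (k * Num.max 0 (L a w))).
  apply: (@bounded_cvg_Rintegral _ _ _ _ _ _ 1).
  - move=> n; apply: measurableT_comp => //; apply: measurableT_comp => //.
    by have [] := hJ n.
  - apply: measurableT_comp => //; apply: measurableT_comp => //.
    exact: measurable_funM.
  - by move=> n w; exact: expRN_norm_le1.
  - apply: filterS2 cJ L0 => w cw Lw.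
    rewrite max_r//; apply: (cvg_comp _ expR (cvgN cw)).
    exact: continuous_expR.
have rhs : \int[P]_w expR (- J n w) @[n --> \oo] -->
    expR (- (alpha * (3 / 2 * (`|a| + c)^-1 ^+ 2))).
  have E n : \int[P]_w expR (- J n w) = expR (- (alpha * profile a n.+1%:R^-1 c 0)).
    by have [] := hJ n.
  under eq_fun do rewrite E.
  have cp := cvg_profile (a := a) (x := 0) c0.
  rewrite sub0r normrN in cp.
  have ca : - (alpha * profile a n.+1%:R^-1 c 0) @[n --> \oo] -->
      - (alpha * (3 / 2 * (`|a| + c)^-1 ^+ 2)).
    by apply: cvgN; apply: cvgMl_tmp.
  apply: (cvg_comp _ expR ca).
  exact: continuous_expR.
exact: (cvg_unique _ lhs rhs).
Qed.

End local_time.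

Lemma cube_rootK (R : realType) (x : R) : 0 <= x -> (x `^ (1 / 3)) ^+ 3 = x.
Proof.
by move=> x0; rewrite -powR_mulrn ?powR_ge0// -powRrM mul1r mulVf// powRr1.
Qed.

Section local_time_laplace.
Context {R : realType} dW (W : measurableType dW).
Variables (PB : R -> probability W R) (B : R -> W -> R).
Hypothesis hB : forall x, is_brownian_motion (PB x) x B.
Context d (T : measurableType d) (P : probability T R).
Variable X : R -> T -> {finite_measure set R -> \bar R}.
Hypothesis hX : is_super_brownian_motion PB B P X.
Variable L : R -> T -> R.
Hypothesis hL : is_local_time P X L.
Variable alpha : R.
Hypothesis alpha_gt0 : 0 < alpha.
Hypothesis hX0 : {ae P, forall w, forall E : set R, measurable E ->
            X 0%R w E = (alpha%:E * \d_(0%R : R) E)%E}.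

Lemma local_time_laplace (a lambda : R) : 0 < lambda ->
  (\int[P]_w (expR (- (lambda * L a w)))%:E =
   (expR (- (alpha * (3 `^ (1 / 3) / 2) *
     (lambda `^ (- (1 / 3)) + 3 `^ (- (1 / 3)) * `|a|) ^- 2)))%:E)%E.
Proof.
move=> l0; pose q : R := 3 `^ (1 / 3); pose l := lambda `^ (1 / 3).
have q0 : 0 < q by exact: powR_gt0.
have l_gt0 : 0 < l by exact: powR_gt0.
have q3 : q ^+ 3 = 3 by exact: cube_rootK.
have l3 : l ^+ 3 = lambda by apply: cube_rootK; exact: ltW.
(* the shift [c = q / l] satisfies [3 c^-3 = lambda] *)
have [La lap] := local_time_laplace_shift hB hX hL alpha_gt0 hX0 a (divr_gt0 q0 l_gt0).
have massE : 3 * (q / l)^-1 ^+ 3 = lambda.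
  by rewrite invf_div expr_div_n l3 q3 mulrC divfK.
rewrite massE in lap.
have -> : alpha * (q / 2) * (lambda `^ (- (1 / 3)) + 3 `^ (- (1 / 3)) * `|a|) ^- 2 =
    alpha * (3 / 2 * (`|a| + q / l)^-1 ^+ 2).
  rewrite !powRN -/q -/l -q3.
  have n0 := normr_ge0 a; move: n0; move: `|a| => r r0.
  have p1 : 0 < r * l + q by rewrite ltr_wpDl// mulr_ge0// ltW.
  have p2 : 0 < q + r * l by rewrite addrC.
  by field; rewrite ?gt_eqF.
have mexp (f : T -> R) : measurable_fun setT f ->
    measurable_fun setT (fun w => expR (- (lambda * f w))).
  move=> mf; apply: measurableT_comp => //; apply: measurableT_comp => //.
  exact: measurable_funM.
have mL := lt_measurable hL a.
have mmax : measurable_fun setT (fun w => Num.max 0 (L a w)) by exact: measurable_maxr.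
rewrite -lap -(@Rintegral_EFin _ _ _ P _ 1 (mexp _ mmax)).
  apply: ae_eq_integral => //; try by apply/measurable_EFinP; exact: mexp.
  by apply: filterS La => w Lw _; rewrite max_r.
move=> w; apply: expRN_norm_le1; apply: (mulr_ge0 (ltW l0)).
by rewrite le_max lexx.
Qed.

Lemma local_time_laplace0 (lambda : R) : 0 < lambda ->
  (\int[P]_w (expR (- (lambda * L 0 w)))%:E =
   (expR (- (alpha * (3 `^ (1 / 3) / 2) * lambda `^ (2 / 3))))%:E)%E.
Proof.
move=> l0; rewrite local_time_laplace// normr0 mulr0 addr0 powRN exprVn invrK.
by rewrite -powR_mulrn ?powR_ge0// -powRrM mul1r [3^-1 * _]mulrC.
Qed.

Lemma local_time_ge0 (a : R) : {ae P, forall w, 0 <= L a w}.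
Proof. by have [] := local_time_laplace_shift hB hX hL alpha_gt0 hX0 a ltr01. Qed.

End local_time_laplace.

Theorem corollary6 (R : realType)
  (dW : measure_display) (W : measurableType dW)
  (PB : R -> probability W R) (B : R -> W -> R)
  (hB : forall x, is_brownian_motion (PB x) x B)
  (d : measure_display) (T : measurableType d) (P : probability T R)
  (X : R -> T -> {finite_measure set R -> \bar R})
  (hX : is_super_brownian_motion PB B P X)
  (L : R -> T -> R) (hL : is_local_time P X L)
  (alpha : R) (halpha : 0 < alpha)
  (hX0 : {ae P, forall w, forall E : set R, measurable E ->
            X 0%R w E = (alpha%:E * \d_(0%R : R) E)%E}) :
  [/\ forall a lambda : R, 0 < lambda ->
        'E_P[fun w => expR (- (lambda * L a w))]%E =
        (expR (- (alpha * (3 `^ (1 / 3) / 2) *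
           (lambda `^ (- (1 / 3)) + 3 `^ (- (1 / 3)) * `|a|) ^- 2)))%:E,
      forall lambda : R, 0 < lambda ->
        'E_P[fun w => expR (- (lambda * L 0%R w))]%E =
        (expR (- (alpha * (3 `^ (1 / 3) / 2) * lambda `^ (2 / 3))))%:E
    & is_positive_stable P (2 / 3) (L 0)].
Proof.
split.
- move=> a lambda l0; rewrite unlock.
  exact: (local_time_laplace hB hX hL halpha hX0).
- move=> lambda l0; rewrite unlock.
  exact: (local_time_laplace0 hB hX hL halpha hX0).
- apply: (@is_positive_stable_of_laplace _ _ _ _ _ (alpha * (3 `^ (1 / 3) / 2))).
  + by apply/andP; split; lra.
  + by rewrite mulr_gt0// divr_gt0// powR_gt0.
  + exact: lt_measurable hL 0.
  + exact: (local_time_ge0 hB hX hL halpha hX0).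
  + exact: (local_time_laplace0 hB hX hL halpha hX0).
Qed.
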